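(* Let $m,n\ge 1$ be integers with $m>n$ and $m+n>3$, and let $\psi:\mathbb{N}\to\mathbb{R}^+$ be an approximating function, i.e. $\psi(r)\to 0$ as $r\to\infty$ (no monotonicity of $\psi$ is assumed). Then \[ |W_0(m,n;\psi)|_{mn}= \begin{cases} 0 & \text{if } \sum_{r=1}^{\infty}\psi(r)^n r^{m-n-1}<\infty,\\[4pt] 1 & \text{if } \sum_{r=1}^{\infty}\psi(r)^n r^{m-n-1}=\infty, \end{cases} \] where $|\cdot|_{mn}$ denotes $mn$-dimensional Lebesgue measure.
   Context: An $m\times n$ real matrix is identified with a point of $\mathbb{R}^{mn}$. For a row vector $\mathbf{q}\in\mathbb{Z}^m$ and an $m\times n$ matrix $X$, $\mathbf{q}X\in\mathbb{R}^n$ is the usual product, and $|\cdot|$ (without subscript) denotes the supremum norm on vectors. The set of $\psi$-approximable matrices is \[ W_0(m,n;\psi)=\{X\in[0,1]^{mn} : |\mathbf{q}X|<\psi(|\mathbf{q}|)\ \text{for infinitely many } \mathbf{q}\in\mathbb{Z}^m\setminus\{\mathbf{0}\}\}. \] *)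

(* Defs.v *)
From HB Require Import structures.
From mathcomp Require Import all_boot all_order all_algebra.
From mathcomp Require Import all_classical all_reals all_analysis.
From mathcomp Require Import measurable_realfun.

Set Implicit Arguments.
Unset Strict Implicit.
Unset Printing Implicit Defensive.

Import Order.TTheory GRing.Theory Num.Theory.
Import numFieldNormedType.Exports.

Local Open Scope classical_set_scope.
Local Open Scope ring_scope.

(* k-dimensional Lebesgue measure on the Borel sets of R^k, as the iterated
   product of the one-dimensional one. As for the underlying [\x], the value is
   meaningful on measurable sets only; [lebesgue_tuple_measure] and
   [lebesgue_tuple_box] below characterize it, and [measurable_W0] shows that
   the set [W0] is Borel. *)
Fixpoint lebesgue_tuple (R : realType) (k : nat) :
    set (k.-tuple (measurableTypeR R)) -> \bar R :=
  if k is k'.+1 then fun A =>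
    (@lebesgue_measure R \x @lebesgue_tuple R k')%E
      [set p | A (cons_tuple p.1 p.2)]
  else \d_[tuple].

(* The row-major identification of R^(mn) with the m x n matrices. *)
Definition mx_of_tuple (R : realType) (m n : nat)
    (t : (m * n).-tuple (measurableTypeR R)) : 'M[R]_(m, n) :=
  vec_mx (\row_i (tnth t i : R)).

Definition lebesgue_mx (R : realType) (m n : nat) (A : set 'M[R]_(m, n)) :
    \bar R :=
  lebesgue_tuple (@mx_of_tuple R m n @^-1` A).

(* Natural-number valued, so that it can be fed to the approximating function;
   on real matrices the supremum norm is the library's [mx_norm]. *)
Definition supnorm_int (m : nat) (q : 'rV[int]_m) : nat :=
  (\max_(i < m) `|q ord0 i|)%N.

Definition W0 (R : realType) (m n : nat) (psi : nat -> R) : set 'M[R]_(m, n) :=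
  [set X : 'M[R]_(m, n) | (forall i j, 0 <= X i j <= 1) /\
    infinite_set [set q : 'rV[int]_m |
      q != 0 /\ mx_norm (map_mx intr q *m X) < psi (supnorm_int q)]].

Fact product_sigma_finite d1 d2 (T1 : measurableType d1)
    (T2 : measurableType d2) (R : realType)
    (m1 : {sigma_finite_measure set T1 -> \bar R})
    (m2 : {sigma_finite_measure set T2 -> \bar R}) :
  sigma_finite setT (m1 \x m2)%E.
Proof.
have /sigma_finiteP[F [TF ndF Foo]] := sigma_finiteT m1.
have /sigma_finiteP[G [TG ndG Goo]] := sigma_finiteT m2.
exists (fun n => F n `*` G n).
  rewrite -setXTT TF TG; apply/seteqP; split => -[x y]; last first.
    by move=> [n _ [? ?]]; split; exists n.
  move=> [/= [i _ Fix] [j _ Gjy]]; exists (maxn i j) => //; split.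
  - by move: x Fix; exact/subsetPset/ndF/leq_maxl.
  - by move: y Gjy; exact/subsetPset/ndG/leq_maxr.
move=> k; have [? ?] := Foo k; have [? ?] := Goo k.
split; first exact: measurableX.
by rewrite product_measure1E// lte_mul_pinfty// ge0_fin_numE.
Qed.

Section lebesgue_tuple_theory.
Context (R : realType).
Local Notation T := (measurableTypeR R).
Local Open Scope ereal_scope.

Section cons_measure.
Context (k : nat) (m1 : {sigma_finite_measure set T -> \bar R})
  (m2 : {sigma_finite_measure set (k.-tuple T) -> \bar R}).

Definition cons_measure (A : set (k.+1.-tuple T)) : \bar R :=
  (m1 \x m2) [set p | A (cons_tuple p.1 p.2)].

Let mcons : measurable_fun [set: T * k.-tuple T] (fun p => cons_tuple p.1 p.2).
Proof. exact: measurable_cons. Qed.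

Let cons0 : cons_measure set0 = 0.
Proof. exact: measure0. Qed.

Let cons_ge0 A : 0 <= cons_measure A.
Proof. exact: measure_ge0. Qed.

Let cons_sigma_additive : semi_sigma_additive cons_measure.
Proof.
move=> F mF tF mUF.
rewrite /cons_measure (_ : [set p | _] =
    \bigcup_n [set p | F n (cons_tuple p.1 p.2)]); last by apply/seteqP; split.
have mG n : measurable [set p : T * k.-tuple T | F n (cons_tuple p.1 p.2)].
  by rewrite -[X in measurable X]setTI; exact: mcons.
apply: measure_semi_sigma_additive => //.
- apply/trivIsetP => i j _ _ ij.
  move/trivIsetP: tF => /(_ _ _ I I ij) Fij.
  apply/seteqP; split => // p [pi pj].
  by have : (F i `&` F j) (cons_tuple p.1 p.2) by []; rewrite Fij.
- exact: bigcupT_measurable.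
Qed.

HB.instance Definition _ := isMeasure.Build _ _ _ cons_measure
  cons0 cons_ge0 cons_sigma_additive.

Let cons_sigma_finite : sigma_finite setT cons_measure.
Proof.
have [F FT Ffin] : sigma_finite setT (m1 \x m2) by exact: product_sigma_finite.
pose g (t : k.+1.-tuple T) := (thead t, [tuple of behead t]).
have gK p : g (cons_tuple p.1 p.2) = p.
  by case: p => x t; rewrite /g /= theadE; congr pair; exact: val_inj.
exists (fun i => g @^-1` F i); first by rewrite -preimage_bigcup -FT.
move=> i; have [mFi Fi] := Ffin i; split.
  rewrite -[X in measurable X]setTI.
  suff: measurable_fun setT g by apply.
  apply/measurable_fun_pairP; split.
    exact: (measurable_tnth ord0).
  exact: measurable_behead.
rewrite /cons_measure (_ : [set p | _] = F i)//.
by apply/seteqP; split => p /=; rewrite gK.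
Qed.

HB.instance Definition _ := Measure_isSigmaFinite.Build _ _ _ cons_measure
  cons_sigma_finite.

End cons_measure.

Lemma lebesgue_tuple_measure k :
  exists mu : {sigma_finite_measure set (k.-tuple T) -> \bar R},
    @lebesgue_tuple R k = mu.
Proof.
elim: k => [|k [mu IH]]; first by exists (\d_([tuple] : 0.-tuple T)).
by exists (cons_measure (@lebesgue_measure R) mu); rewrite /= IH.
Qed.

Lemma lebesgue_tuple_box k (B : 'I_k -> set T) :
  (forall i, measurable (B i)) ->
  lebesgue_tuple [set t : k.-tuple T | forall i, B i (tnth t i)] =
  \prod_(i < k) lebesgue_measure (B i).
Proof.
elim: k B => [|k IH] B mB.
  rewrite big_ord0 /= diracE mem_set//.
  by case.
rewrite big_ord_recl -IH//=.
have [mu ->] := lebesgue_tuple_measure k.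
rewrite -product_measure1E//; last first.
  rewrite (_ : [set t | _] = \bigcap_(i in setT)
      ((@tnth k T)^~ (i : 'I_k) @^-1` B (lift ord0 i))).
    apply: fin_bigcap_measurable => // i _; rewrite -[X in measurable X]setTI.
    exact: measurable_tnth.
  by apply/seteqP; split => t /= Bt i; [move=> _|]; exact: Bt.
congr (_ _); apply/seteqP; split => -[x t] /= => [Bt|[Bx Bt] i].
  split; first exact: (Bt ord0).
  by move=> i; have := Bt (lift ord0 i); rewrite tnthS.
by case: (unliftP ord0 i) => [j|] ->; rewrite ?tnthS.
Qed.

End lebesgue_tuple_theory.

Lemma mx_of_tupleE (R : realType) m n
    (t : (m * n).-tuple (measurableTypeR R)) i j :
  mx_of_tuple t i j = tnth t (mxvec_index i j).
Proof. by rewrite !mxE. Qed.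

Lemma infinite_set_countP (T : countType) (S : set T) :
  infinite_set S <-> forall N, exists2 q, S q & (N <= pickle q)%N.
Proof.
split => [Sinf N|SN].
  apply: contrapT => noq; apply: Sinf.
  apply: (@sub_finite_set _ _ (pickle @^-1` `I_N)).
    move=> q Sq /=; rewrite ltnNge; apply/negP => Nq.
    by apply: noq; exists q.
  apply: finite_preimage; last exact: finite_II.
  by move=> x y _ _; exact: (pcan_inj pickleK).
move=> /finite_seqP[s SE].
have [q + Nq] := SN (\max_(q <- s) pickle q).+1.
rewrite SE /= => qs.
have := leq_trans Nq (@leq_bigmax_seq _ _ xpredT pickle q qs isT).
by rewrite ltnn.
Qed.

Lemma measurable_W0 (R : realType) m n (psi : nat -> R) :
  measurable (@mx_of_tuple R m n @^-1` W0 psi).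
Proof.
set T := (m * n).-tuple (measurableTypeR R).
have mcoord i j : measurable_fun [set: T] (fun t => mx_of_tuple t i j : R).
  under eq_fun do rewrite mx_of_tupleE.
  exact: (measurable_tnth (mxvec_index i j)).
pose A (q : 'rV[int]_m) : set T := [set t |
  mx_norm (map_mx intr q *m mx_of_tuple t) < psi (supnorm_int q)].
have mA q : measurable (A q).
  rewrite (_ : A q = [set _ | 0 < psi (supnorm_int q)] `&`
      \bigcap_(ij in [set: 'I_1 * 'I_n]) [set t |
        `|(map_mx intr q *m mx_of_tuple t) ij.1 ij.2| < psi (supnorm_int q)]).
    apply: measurableI.
      case: (0 < psi _).
        by rewrite (_ : [set _ | _] = setT)//; apply/seteqP; split.
      by rewrite (_ : [set _ | _] = set0)//; apply/seteqP; split.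
    apply: fin_bigcap_measurable => // -[i j] _.
    have mf : measurable_fun [set: T]
        (fun t => `|(map_mx intr q *m mx_of_tuple t) i j| : R).
      apply: measurableT_comp => //.
      under eq_fun do rewrite mxE.
      apply: measurable_sum => k; exact: measurable_funM.
    rewrite -[X in measurable X]setTI.
    have := measurable_fun_ltr mf
      (@measurable_cst _ _ _ _ setT (psi (supnorm_int q))).
    by move=> /(_ measurableT [set true]); apply.
  apply/seteqP; rewrite /A; split => t /=.
    rewrite mx_normrE => /bigmax_ltP[? lt_psi]; split=> // ij _.
    exact: lt_psi.
  move=> [? lt_psi]; rewrite mx_normrE; apply/bigmax_ltP; split => // ij _.
  exact: lt_psi.
rewrite (_ : _ @^-1` _ =
    \bigcap_(ij in [set: 'I_m * 'I_n])
      [set t : T | 0 <= (mx_of_tuple t ij.1 ij.2 : R) <= 1] `&`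
    \bigcap_N \bigcup_(q in [set q | q != 0 /\ (N <= pickle q)%N]) A q).
  apply: measurableI.
    apply: fin_bigcap_measurable => // -[i j] _.
    rewrite -[X in measurable X]setTI.
    have := mcoord i j measurableT _ (measurable_itv `[0, 1]).
    by rewrite (_ : _ @^-1` _ =
      [set t : T | 0 <= (mx_of_tuple t i j : R) <= 1]).
  apply: bigcapT_measurable => N.
  rewrite bigcup_mkcond; apply: countable_bigcupT_measurable => [|q].
    exact: countableP.
  by case: ifP.
apply/seteqP; split => t /=.
  move=> [t01 /infinite_set_countP tq]; split; first by move=> ij _; exact: t01.
  by move=> N _; have [q [q0 At] Nq] := tq N; exists q.
move=> [t01 tq]; split; first by move=> i j; exact: (t01 (i, j)).
by apply/infinite_set_countP => N; have [q [q0 Nq] At] := tq N I; exists q.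
Qed.

(* Main.v *)
(* In the convergence case the strips |qX| < psi(|q|) are covered by small grid
   cells and the Borel-Cantelli lemma applies.

   For the divergence case, write a matrix of rank n, up to the order of its
   rows, as (X1 ; X'X1) with X1 an n x n minor of maximal determinant, so that
   |X'| <= 1. With q = (q1, q2) and s a distinguished entry of q2, it suffices
   that |q1 + q2 X'| < psi(s)/n, where the other entries of q2 are at most
   s/E0: since the row of X' multiplied by s has entries < 1 off a null set,
   s = |q| once E0 is large. This is a Khintchine-Groshev problem for X', in
   which only primitive vectors q are used; a positive proportion of all
   vectors is primitive because m >= 3. The set of X' with no solution s >= Q0
   is shown to have Jordan content 0. Given a cover of it by cells of a grid,
   pass to the grid of mesh 1/p for a large prime p, and count the solutions q
   at the points t/p. Their number N(t) has a large mean over every cell of the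
   cover, and its second moment is of the order of the square of the mean:
   the pairs (q2, q2') that are not parallel are independent modulo p, and for
   parallel ones primitivity forces a nonzero determinant, as in Gallagher's
   argument. Hence N > 0 on a proportion >= c d of a cover of density d, which
   improves the density from d to d - c d^2 + eta for any eta > 0; so the
   infimum of the densities is 0. Locally Lipschitz maps preserve content 0,
   which transports the result from X' back to X. *)

Require Import Defs.
From HB Require Import structures.
From mathcomp Require Import all_boot all_order all_algebra.
From mathcomp Require Import all_classical all_reals all_analysis.
From mathcomp Require Import zify ring lra.

Set Implicit Arguments.
Unset Strict Implicit.
Unset Printing Implicit Defensive.

Import Order.TTheory GRing.Theory Num.Theory.
Import numFieldNormedType.Exports.

Local Open Scope classical_set_scope.
Local Open Scope ring_scope.

(** * Counting residues modulo a prime *)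

Section residue_counting.
Local Open Scope nat_scope.

(** Since [psi] is not monotone, it is never compared at two arguments: a vector is used only with
    [psi] at its largest entry s, and each s contributes its own mass, of order psi(s)^n s^(m-n-1).
    The prime mesh turns integrals over the torus into counts: for p > X^2, where X bounds the
    entries of the vectors in use, a nonzero 2 x 2 minor is invertible modulo p. For parallel forms
    the danger is that a solution is counted again for its multiples; primitivity excludes these and
    keeps the correlation of two parallel forms of the same order as that of independent ones. The
    price is paid in the first moment: the proportion of primitive vectors must be bounded below
    inside every cell of the cover, which needs s large compared with the square of the number of
    cells per side. The step from d to d - c d^2 stands in for a density theorem and a zero-one law.
    It works with content because a hit at a grid point, having a margin of about psi(s)/2, is a
    solution on the whole adjacent cell of mesh 1/p, and because finitely many s suffice at each
    step. *)

Lemma leq_card_inj (T T' : finType) (f : T -> T') (P : pred T) (Q : pred T') :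
  (forall x, P x -> Q (f x)) -> {in P &, injective f} -> #|P| <= #|Q|.
Proof.
move=> PQ finj; rewrite -(card_in_imset finj).
by apply/subset_leq_card/fintype.subsetP => _ /imsetP[x Px ->]; exact: PQ.
Qed.

(** Pinning the coordinates in [D] at a dummy value encodes the functions on the complement of [D]
    without changing the type. The injections below send a grid point to its pinned version together
    with some residues. *)
Lemma card_pinned (T : finType) (p : nat) (z : 'I_p) (D : pred T) :
  #|[pred t : {ffun T -> 'I_p} | [forall i, D i ==> (t i == z)]]| =
  p ^ #|predC D|.
Proof.
rewrite -[in RHS](card_ord p) -(card_pffun_on z (predC D) predT).
apply: eq_card => t; rewrite !inE; apply/forallP/pffun_onP => [tz|[tz _] i].
  split=> // ; apply/fintype.subsetP => i; rewrite !inE; apply: contra => Di.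
  by move: (tz i); rewrite Di.
apply/implyP => Di; apply/negPn/negP => tiz.
by have /fintype.subsetP/(_ i) := tz; rewrite !inE => /(_ tiz); rewrite Di.
Qed.

(** With g the gcd, [s' r - s r'] takes at most 2sB/(pg) + 1 <= 3sB/(pg) values, and each of them
    fixes [r] modulo s/g, which leaves at most Ag/s + 1 <= 2Ag/s choices. The product is 6AB/p; the
    last two hypotheses and [s <= A] bound the range and absorb both terms 1. *)
Lemma card_residue_pairs_aux (p s s' A B : nat) : prime p ->
  0 < s < p -> 0 < s' < p -> s <= A ->
  s' * A <= s * B -> p * gcdn s s' <= s * B ->
  #|[pred r : 'I_A.+1 * 'I_B.+1 | s' * r.1 == s * r.2 %[mod p]]| * p
    <= 6 * (A * B).
Proof.
move=> pp /andP[s0 sp] /andP[s'0 s'p] sA s'AsB pgsB.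
set g := gcdn s s'; have g0 : 0 < g by rewrite gcdn_gt0 s0.
have p0 := prime_gt0 pp.
set sg := s %/ g; set sg' := s' %/ g.
have sE : s = sg * g by rewrite divnK ?dvdn_gcdl.
have s'E : s' = sg' * g by rewrite divnK ?dvdn_gcdr.
have sg0 : 0 < sg by case: sg sE => //; lia.
have cop : coprime sg sg'.
  by rewrite /coprime -(eqn_pmul2r g0) muln_gcdl -sE -s'E mul1n.
(* [s' r - s r'] is a multiple of [p g], and its value determines [r] modulo
   [s / g]; adding [s B] avoids negative numbers. *)
pose h (r : 'I_A.+1 * 'I_B.+1) := s' * r.1 + s * (B - r.2).
have hle r : h r <= 2 * (s * B).
  have r1 : s' * r.1 <= s' * A by rewrite leq_mul2l -ltnS ltn_ord orbT.
  have r2 : s * (B - r.2) <= s * B by rewrite leq_mul2l leq_subr orbT.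
  rewrite /h; lia.
set X := (2 * (s * B)) %/ (p * g); set Y := A %/ sg.
pose phi (r : 'I_A.+1 * 'I_B.+1) : 'I_X.+1 * 'I_Y.+1 :=
  (inord (h r %/ (p * g)), inord (r.1 %/ sg)).
have copg : coprime p g.
  rewrite prime_coprime //; apply/negP => /dvdn_leq; rewrite g0 => /(_ isT).
  have : g <= s by apply: dvdn_leq => //; exact: dvdn_gcdl.
  lia.
have hmod (r : 'I_A.+1 * 'I_B.+1) : s' * r.1 == s * r.2 %[mod p] ->
    h r = s * B %[mod p * g].
  move=> /eqP rE; have r2 : r.2 <= B by rewrite -ltnS.
  have sBE : s * B = s * r.2 + s * (B - r.2).
    by rewrite -mulnDr subnKC.
  have : p * g %| `|s' * r.1 - s * r.2|.
    rewrite Gauss_dvd //; apply/andP; split.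
      move: rE => /eqP; case: (leqP (s * r.2) (s' * r.1)) => le.
        by rewrite eqn_mod_dvd // => ?; rewrite distnEl.
      by rewrite eq_sym eqn_mod_dvd ?(ltnW le)// => ?; rewrite distnEr // ltnW.
    have gs : g %| s * r.2 by rewrite dvdn_mulr // dvdn_gcdl.
    have gs' : g %| s' * r.1 by rewrite dvdn_mulr // dvdn_gcdr.
    case: (leqP (s * r.2) (s' * r.1)) => le.
      by rewrite distnEl // dvdn_sub.
    by rewrite distnEr ?dvdn_sub // ltnW.
  case: (leqP (s * r.2) (s' * r.1)) => le.
    rewrite distnEl // => dv; apply/eqP; rewrite /h sBE eqn_modDr.
    by rewrite eqn_mod_dvd.
  rewrite distnEr ?(ltnW le)// => dv; apply/eqP;
    rewrite /h sBE eqn_modDr eq_sym.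
  by rewrite eqn_mod_dvd // ltnW.
have phi_inj :
    {in [pred r : 'I_A.+1 * 'I_B.+1 | s' * r.1 == s * r.2 %[mod p]] &,
      injective phi}.
  move=> /= r u; rewrite !inE => rE uE [].
  move=> /(congr1 val) /=; rewrite !inordK ?ltnS ?leq_div2r ?hle // => e1.
  move=> /(congr1 val) /=.
  have r1 : r.1 <= A by rewrite -ltnS.
  have r2 : r.2 <= B by rewrite -ltnS.
  have u1 : u.1 <= A by rewrite -ltnS.
  have u2 : u.2 <= B by rewrite -ltnS.
  rewrite !inordK ?ltnS ?leq_div2r // => e2.
  have hE : h r = h u.
    by rewrite (divn_eq (h r) (p * g)) (divn_eq (h u) (p * g)) e1 !hmod.
  have key : sg' * r.1 + sg * u.2 = sg' * u.1 + sg * r.2.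
    have e3 : s' * r.1 + s * u.2 = s' * u.1 + s * r.2.
      have := leq_mul (leqnn s) r2; have := leq_mul (leqnn s) u2.
      move: hE; rewrite /h !mulnBr; clear; lia.
    apply/eqP; rewrite -(eqn_pmul2r g0) !mulnDl ![_ * _ * g]mulnAC -sE -s'E.
    exact/eqP.
  have : r.1 = u.1 %[mod sg].
    have : sg' * r.1 = sg' * u.1 %[mod sg].
      have := congr1 (modn^~ sg) key.
      by rewrite -modnDmr modnMr addn0 -[in RHS]modnDmr modnMr addn0.
    move=> /eqP; case: (leqP u.1 r.1) => le.
      rewrite eqn_mod_dvd ?leq_mul2l ?le ?orbT // -mulnBr Gauss_dvdr //.
      by rewrite -eqn_mod_dvd // => /eqP.
    rewrite eq_sym eqn_mod_dvd ?leq_mul2l ?(ltnW le) ?orbT // -mulnBr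
      Gauss_dvdr //.
    by rewrite -eqn_mod_dvd ?(ltnW le)// => /eqP.
  move=> e3.
  have e4 : r.1 = u.1 :> nat.
    by rewrite (divn_eq r.1 sg) (divn_eq u.1 sg) e2 e3.
  have e5 : r.2 = u.2 :> nat.
    by move: key; rewrite e4 => /eqP; rewrite eqn_add2l eqn_pmul2l // => /eqP.
  case: r u e4 e5 {rE uE e1 e2 e3 r1 r2 u1 u2 hE key} => [? ?] [? ?] /= ? ?.
  by congr pair; exact: val_inj.
have := leq_card_inj (Q := predT) (fun _ _ => isT) phi_inj.
rewrite card_prod !card_ord => cle.
have XE : X.+1 * p <= 3 * (sg * B).
  have Xle : X * (p * g) <= 2 * (s * B) by exact: leq_trunc_div.
  rewrite -(leq_pmul2r g0).
  have -> : 3 * (sg * B) * g = 3 * (s * B).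
    by rewrite -mulnA (mulnAC sg) -sE.
  rewrite -mulnA mulSn; move: pgsB Xle; rewrite -/g; clear; lia.
have YE : Y.+1 * sg <= 2 * A.
  have : Y * sg <= A by exact: leq_trunc_div.
  have : sg <= s by rewrite leq_div.
  move: sA; rewrite mulSn; clear; lia.
rewrite -(leq_pmul2r sg0).
apply: (leq_trans (n := (X.+1 * Y.+1) * p * sg)).
  by rewrite !leq_mul2r cle !orbT.
apply: leq_trans (_ : _ <= 3 * (sg * B) * (2 * A)) _.
  by rewrite (mulnAC _ _ p) -mulnA leq_mul.
by rewrite !mulnA leq_eqVlt; apply/orP; left; apply/eqP; ring.

Qed.

Lemma card_residue_pairs (p s s' A B : nat) : prime p ->
  0 < s < p -> 0 < s' < p -> s <= A -> s' <= B ->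
  p * gcdn s s' <= maxn (s' * A) (s * B) ->
  #|[pred r : 'I_A.+1 * 'I_B.+1 | s' * r.1 == s * r.2 %[mod p]]| * p
    <= 6 * (A * B).
Proof.
move=> pp sp s'p sA s'B; case: (leqP (s' * A) (s * B)) => le pg.
  exact: card_residue_pairs_aux.
rewrite gcdnC in pg; rewrite (mulnC A).
apply: leq_trans (card_residue_pairs_aux pp s'p sp s'B (ltnW le) pg).
rewrite leq_mul2r; apply/orP; right.
pose f (r : 'I_A.+1 * 'I_B.+1) := (r.2, r.1).
apply: (@leq_card_inj _ _ f) => [r|[? ?] [? ?] _ _ [-> ->]] //=.
by rewrite eq_sym.
Qed.

Definition dotn m p (q : 'I_m -> nat) (t : {ffun 'I_m -> 'I_p}) : nat :=
  \sum_i q i * t i.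

Lemma dvdz_dotnB m p (q : 'I_m -> nat) (t u : {ffun 'I_m -> 'I_p}) :
  dotn q t %% p = dotn q u %% p ->
  (p %| (\sum_i (q i)%:Z * ((t i)%:Z - (u i)%:Z))%R)%Z.
Proof.
have dotZ w : (dotn q w)%:Z = (\sum_i (q i)%:Z * (w i)%:Z)%R.
  by rewrite /dotn raddf_sum; apply: eq_bigr => i _; rewrite /= PoszM.
move=> tu; under eq_bigr do rewrite mulrBr.
by rewrite sumrB -!dotZ -eqz_mod_dvd; apply/eqP; rewrite !modz_nat tu.
Qed.

Lemma ord_eq_dvdz p (x y : 'I_p) : (p %| (x%:Z - y%:Z)%R)%Z -> x = y.
Proof.
rewrite -eqz_mod_dvd => /eqP; rewrite !modz_nat !modn_small // => -[xy].
exact: val_inj.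
Qed.

(** Once the coordinates other than [i0] and [i1] are fixed, the two forms are an affine map of
    these two coordinates with invertible determinant modulo [p], so each pair of residues occurs at
    most once. *)
Lemma card_dotn_independent m p (q q' : 'I_m -> nat) (i0 i1 : 'I_m)
    (A B : nat) : prime p -> i0 != i1 ->
  ~~ (p %| ((q i0)%:Z * (q' i1)%:Z - (q i1)%:Z * (q' i0)%:Z)%R)%Z ->
  #|[pred t : {ffun 'I_m -> 'I_p} |
      (dotn q t %% p <= A) && (dotn q' t %% p <= B)]| * p ^ 2
    <= A.+1 * B.+1 * p ^ m.
Proof.
move=> pp i01 det; have p0 := prime_gt0 pp; pose z := Ordinal p0.
pose D := pred2 i0 i1.
have Dm : m = #|predC D| + 2.
  by rewrite -[LHS](card_ord m) -(cardC D) card2 i01 addnC.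
rewrite [X in _ <= _ * p ^ X]Dm expnD mulnA leq_mul2r expn_eq0 gtn_eqF //=
  -(card_pinned z D).
have -> : A.+1 * B.+1 = #|predT : pred ('I_A.+1 * 'I_B.+1)|.
  by rewrite card_prod !card_ord.
rewrite mulnC -cardX.
pose f (t : {ffun 'I_m -> 'I_p}) :=
  ([ffun i => if D i then z else t i],
    (inord (dotn q t %% p) : 'I_A.+1, inord (dotn q' t %% p) : 'I_B.+1)).
apply: (@leq_card_inj _ _ f) => [t _|t u].
  rewrite !inE /= andbT; apply/forallP => i; apply/implyP => Di.
  by rewrite ffunE Di.
rewrite !inE => /andP[tA tB] /andP[uA uB] [/ffunP tu].
move=> /(congr1 val); rewrite /= !inordK // => {tA uA} /dvdz_dotnB d1.
move=> /(congr1 val); rewrite /= !inordK // => {tB uB} /dvdz_dotnB d2.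
have off i : ~~ D i -> t i = u i.
  by move=> Di; have := tu i; rewrite !ffunE !ifN.
have reduce (c : 'I_m -> nat) :
    (\sum_i ((c i)%:Z * ((t i)%:Z - (u i)%:Z)) =
     (c i0)%:Z * ((t i0)%:Z - (u i0)%:Z) +
     (c i1)%:Z * ((t i1)%:Z - (u i1)%:Z))%R.
  rewrite (bigD1 i0) //= (bigD1 i1) 1?eq_sym //= big1 ?addr0 //.
  by move=> i /andP[ii0 ii1]; rewrite off ?subrr ?mulr0 // /= negb_or ii0.
rewrite !reduce in d1 d2.
have pz : coprimez p ((q i0)%:Z * (q' i1)%:Z - (q i1)%:Z * (q' i0)%:Z)%R.
  by rewrite coprimezE /= prime_coprime // -dvdzE.
(* Both coordinates are recovered by Cramer's rule modulo [p]. *)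
have e0 : t i0 = u i0.
  apply: ord_eq_dvdz; rewrite -(Gauss_dvdzr _ pz).
  have -> : (((q i0)%:Z * (q' i1)%:Z - (q i1)%:Z * (q' i0)%:Z) *
       ((t i0)%:Z - (u i0)%:Z) =
     (q' i1)%:Z * ((q i0)%:Z * ((t i0)%:Z - (u i0)%:Z) +
       (q i1)%:Z * ((t i1)%:Z - (u i1)%:Z)) -
     (q i1)%:Z * ((q' i0)%:Z * ((t i0)%:Z - (u i0)%:Z) +
       (q' i1)%:Z * ((t i1)%:Z - (u i1)%:Z)))%R by ring.
  by rewrite rpredB ?dvdz_mull.
have e1 : t i1 = u i1.
  apply: ord_eq_dvdz; rewrite -(Gauss_dvdzr _ pz).
  have -> : (((q i0)%:Z * (q' i1)%:Z - (q i1)%:Z * (q' i0)%:Z) *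
       ((t i1)%:Z - (u i1)%:Z) =
     (q i0)%:Z * ((q' i0)%:Z * ((t i0)%:Z - (u i0)%:Z) +
       (q' i1)%:Z * ((t i1)%:Z - (u i1)%:Z)) -
     (q' i0)%:Z * ((q i0)%:Z * ((t i0)%:Z - (u i0)%:Z) +
       (q i1)%:Z * ((t i1)%:Z - (u i1)%:Z)))%R by ring.
  by rewrite rpredB ?dvdz_mull.
apply/ffunP => i; case: (boolP (D i)) => [|/off//].
by move=> /pred2P[] ->.
Qed.

(** The residues r, r' of proportional forms satisfy [q' i0] r = [q i0] r' modulo [p], and such
    pairs are few by [card_residue_pairs]. The residue r determines [t i0] from the other
    coordinates, as [q i0] is invertible modulo [p]. *)
Lemma card_dotn_parallel m p (q q' : 'I_m -> nat) (i0 : 'I_m) (A B : nat) :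
  prime p -> 0 < q i0 < p -> 0 < q' i0 < p ->
  (forall i, q' i0 * q i = q i0 * q' i) ->
  q i0 <= A -> q' i0 <= B ->
  p * gcdn (q i0) (q' i0) <= maxn (q' i0 * A) (q i0 * B) ->
  #|[pred t : {ffun 'I_m -> 'I_p} |
      (dotn q t %% p <= A) && (dotn q' t %% p <= B)]| * p ^ 2
    <= 6 * (A * B) * p ^ m.
Proof.
move=> pp sp s'p par sA s'B pg; have p0 := prime_gt0 pp; pose z := Ordinal p0.
pose D := pred1 i0.
have Dm : m = #|predC D| + 1.
  by rewrite -[LHS](card_ord m) -(cardC D) card1 addnC.
rewrite [X in _ <= _ * p ^ X]Dm expnD mulnA expnS expn1 !mulnA leq_mul2r
  gtn_eqF //=.
have := card_residue_pairs pp sp s'p sA s'B pg.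
move=> /(leq_mul (leqnn (p ^ #|predC D|))); rewrite [in X in _ -> X]mulnC.
rewrite [X in _ -> _ <= X](_ : _ = p ^ #|predC D| * (6 * (A * B))); last ring.
apply: leq_trans; rewrite mulnA (mulnC p) leq_mul2r gtn_eqF //=.
rewrite -(card_pinned z D) -cardX.
pose f (t : {ffun 'I_m -> 'I_p}) :=
  ([ffun i => if D i then z else t i],
    (inord (dotn q t %% p) : 'I_A.+1, inord (dotn q' t %% p) : 'I_B.+1)).
apply: (@leq_card_inj _ _ f) => [t|t u].
  move=> /andP[tA tB]; rewrite !inE /=; apply/andP; split.
    by apply/forallP => i; apply/implyP => Di; rewrite ffunE Di.
  rewrite !inordK // modnMmr -(modnMmr (q i0)) modn_mod modnMmr.
  rewrite /dotn !big_distrr /=; apply/eqP; congr (_ %% p).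
  by apply: eq_bigr => i _; rewrite !mulnA par.
rewrite !inE => /andP[tA _] /andP[uA _] [/ffunP tu].
move=> /(congr1 val); rewrite /= !inordK // => {tA uA} /dvdz_dotnB d1 _.
have off i : i != i0 -> t i = u i.
  by move=> Di; have := tu i; rewrite !ffunE !ifN.
move: d1; rewrite (bigD1 i0) //= big1 ?addr0; last first.
  by move=> i /off ->; rewrite subrr mulr0.
rewrite Gauss_dvdzr => [/ord_eq_dvdz e|]; last first.
  rewrite coprimezE /= prime_coprime //; apply/negP => /dvdn_leq; lia.
by apply/ffunP => i; case: (eqVneq i i0) => [->|/off].
Qed.

End residue_counting.

(** * Primitive vectors and the correlation of two of them *)

Section primitive_vectors.
Local Open Scope nat_scope.

Lemma leq_expnl (k a b : nat) : a <= b -> a ^ k <= b ^ k.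
Proof. by case: k => // k; rewrite leq_exp2r. Qed.

(* The divisors are tested up to [s] only; in all uses [s] is an entry of the
   vector [(q, Q)]. *)
Definition primitive m n (s : nat) (q : 'I_m -> nat) (Q : 'I_n -> nat) : bool :=
  [forall e : 'I_s.+1,
     (1 < e) ==> ~~ ([forall i, e %| q i] && [forall j, e %| Q j])].

Lemma primitiveP m n s (q : 'I_m -> nat) (Q : 'I_n -> nat) :
  reflect (forall e, 1 < e <= s -> (forall i, e %| q i) ->
             (forall j, e %| Q j) -> False)
          (primitive s q Q).
Proof.
apply: (iffP forallP) => [H e /andP[e1 es] eq eQ|H e].
  have := H (Ordinal (es : e < s.+1)); rewrite /= e1 /=; apply/negP/negPn.
  by apply/andP; split; apply/forallP.
apply/implyP => e1; apply/negP => /andP[/forallP eq /forallP eQ].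
by apply: (H e) => //; rewrite e1 -ltnS ltn_ord.
Qed.

(** Proportionality makes s / gcd(s, s') a common divisor of all entries of (q, Q), so primitivity
    forces it to be 1. *)
Lemma primitive_parallel_divn m n s s' (q q' : 'I_m -> nat)
    (Q Q' : 'I_n -> nat) :
  0 < s -> 0 < s' -> primitive s q Q ->
  (forall i, s' * q i = s * q' i) -> (forall j, s' * Q j = s * Q' j) ->
  s = gcdn s s'.
Proof.
move=> s0 s'0 /primitiveP prim qq' QQ'; set g := gcdn s s'.
have g0 : 0 < g by rewrite gcdn_gt0 s0.
have sE : s = (s %/ g) * g by rewrite divnK ?dvdn_gcdl.
have s'E : s' = (s' %/ g) * g by rewrite divnK ?dvdn_gcdr.
have sg0 : 0 < s %/ g.
  rewrite divn_gt0 //; apply: dvdn_leq s0 _; exact: dvdn_gcdl.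
have cop : coprime (s %/ g) (s' %/ g).
  rewrite /coprime -(eqn_pmul2r g0) muln_gcdl.
  by rewrite -sE -s'E mul1n.
have dv x x' : s' * x = s * x' -> s %/ g %| x.
  rewrite [X in X * x]s'E [X in X * x']sE mulnAC (mulnAC _ g x') => /eqP.
  rewrite eqn_pmul2r // => /eqP e; rewrite -(Gauss_dvdr _ cop) e.
  exact: dvdn_mulr.
case: (leqP (s %/ g) 1) => [le1|gt1].
  have /eqP sg1 : s %/ g == 1 by rewrite eqn_leq le1 sg0.
  by rewrite [LHS]sE sg1 mul1n.
case: (prim (s %/ g)) => [|i|j].
- by rewrite gt1 leq_div.
- exact: dv (qq' i).
- exact: dv (QQ' j).
Qed.

Lemma primitive_parallel_eq m n s s' (q q' : 'I_m -> nat) (Q Q' : 'I_n -> nat) :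
  0 < s -> 0 < s' -> primitive s q Q -> primitive s' q' Q' ->
  (forall i, s' * q i = s * q' i) -> (forall j, s' * Q j = s * Q' j) ->
  q =1 q'.
Proof.
move=> s0 s'0 pq pq' qq' QQ'.
have e1 := primitive_parallel_divn s0 s'0 pq qq' QQ'.
have e2 : s' = gcdn s' s by apply: (primitive_parallel_divn s'0 s0 pq').
have ss' : s = s' by rewrite e1 gcdnC -e2.
by move=> i; have /eqP := qq' i; rewrite ss' eqn_pmul2l // => /eqP.
Qed.

(* The grid point [t / p] satisfies [0 <= q . t_j / p - Q_j <= A / p], where the
   quotients [Q_j] are the opposites of the entries of the vector q1. *)
Definition near_integral m n p (i0 : 'I_m) (A : nat) (q : 'I_m -> nat)
    (t : {ffun 'I_n -> {ffun 'I_m -> 'I_p}}) : bool :=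
  [forall j, dotn q (t j) %% p <= A] &&
  primitive (q i0) q (fun j => dotn q (t j) %/ p).

(** The parallel case is where primitivity acts. Write [dotn] as pQ + r and pQ' + r' in a column
    where s'Q and sQ' differ, which exists since the two primitive vectors are distinct. Their
    difference is a nonzero multiple of g = gcd(s, s'), so pg <= p|s'Q - sQ'| = |s'r - sr'| <=
    max(s'A, sB), as [card_dotn_parallel] demands. *)
Lemma card_near_integral_pair m n p (i0 : 'I_m) (q q' : 'I_m -> nat)
    (A B X : nat) : prime p -> X * X < p ->
  (forall i, q i <= X) -> (forall i, q' i <= X) ->
  0 < q i0 -> 0 < q' i0 -> q i0 <= A -> q' i0 <= B -> ~ q =1 q' ->
  #|[pred t : {ffun 'I_n -> {ffun 'I_m -> 'I_p}} |
      near_integral i0 A q t && near_integral i0 B q' t]| * (p ^ 2) ^ n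
    <= (6 * (A * B) * p ^ m) ^ n.
Proof.
move=> pp Xp qX q'X s0 s'0 sA s'B qq'; have p0 := prime_gt0 pp.
set P := [pred t | _].
(* One common point is enough: the inequality that it yields involves [p], [A], [B] and the vectors
   only, and then bounds the count in every column. *)
have [[t Pt]|noP] := pselect (exists t, P t); last first.
  rewrite (_ : #|P| = 0) ?mul0n //; apply: eq_card0 => t.
  by apply/negP => Pt; apply: noP; exists t.
have sp : 0 < q i0 < p by rewrite s0; have := qX i0; nia.
have s'p : 0 < q' i0 < p by rewrite s'0; have := q'X i0; nia.
suff col : #|[pred t : {ffun 'I_m -> 'I_p} |
    (dotn q t %% p <= A) && (dotn q' t %% p <= B)]| * p ^ 2
    <= 6 * (A * B) * p ^ m.
  apply: leq_trans (leq_expnl n col); rewrite expnMn leq_mul2r.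
  apply/orP; right.
  rewrite -[X in _ ^ X](card_ord n) -card_ffun_on; apply/subset_leq_card.
  apply/fintype.subsetP => u; rewrite !inE.
  move=> /andP[/andP[/forallP uA _] /andP[/forallP uB _]].
  by apply/ffun_onP => j; rewrite inE uA uB.
have [par|] := boolP [forall i, q' i0 * q i == q i0 * q' i]; last first.
  rewrite negb_forall => /existsP[i1 ni1].
  apply: leq_trans (_ : A.+1 * B.+1 * p ^ m <= _); last first.
    rewrite leq_mul2r; apply/orP; right.
    move: (leq_trans s0 sA) (leq_trans s'0 s'B); clear; nia.
  apply: (@card_dotn_independent _ _ _ _ i0 i1) => //.
    by apply: contraNneq ni1 => ->; rewrite mulnC.
  rewrite dvdzE /= -!PoszM.
  (* Both terms of the minor are below [p], so a nonzero minor is nonzero modulo [p]. *)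
  have l1 : q i0 * q' i1 < p by apply: leq_ltn_trans Xp; exact: leq_mul.
  have l2 : q i1 * q' i0 < p by apply: leq_ltn_trans Xp; exact: leq_mul.
  have ne : q i0 * q' i1 <> q i1 * q' i0.
    by move=> e; move: ni1; rewrite mulnC -e eqxx.
  apply/negP => /dvdn_leq; move: l1 l2 ne; clear; lia.
have {}par i : q' i0 * q i = q i0 * q' i by move/forallP: par => /(_ i)/eqP.
apply: (@card_dotn_parallel _ _ _ _ i0) => //.
move: Pt => /andP[/andP[/forallP tA tprim] /andP[/forallP tB t'prim]].
have [j nj] : exists j,
    q' i0 * (dotn q (t j) %/ p) <> q i0 * (dotn q' (t j) %/ p).
  apply: contrapT => noj; apply: qq'.
  apply: (primitive_parallel_eq s0 s'0 tprim t'prim par) => j.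
  by apply: contrapT => nj; apply: noj; exists j.
have dotE : q' i0 * dotn q (t j) = q i0 * dotn q' (t j).
  rewrite /dotn !big_distrr; apply: eq_bigr => i _ /=.
  by rewrite !mulnA par.
move: (tA j) (tB j) nj dotE.
rewrite [in X in _ -> _ -> _ -> X](divn_eq (dotn q (t j)) p).
rewrite [in X in _ -> _ -> _ -> X](divn_eq (dotn q' (t j)) p).
move: (_ %/ _) (_ %% _) (_ %/ _) (_ %% _) => Q' r' Q r rA r'B nQ e.
set g := gcdn _ _; set s := q i0 in e rA nQ g *; set s' := q' i0 in e nQ g *.
have dg : p * g %| p * `|s' * Q - s * Q'|.
  rewrite dvdn_pmul2l //; have [le|lt] := leqP (s * Q') (s' * Q).
    by rewrite distnEl // dvdn_sub // dvdn_mulr // ?dvdn_gcdl ?dvdn_gcdr.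
  by rewrite distnEr ?(ltnW lt) // dvdn_sub // dvdn_mulr // ?dvdn_gcdl
    ?dvdn_gcdr.
apply: leq_trans (_ : p * `|s' * Q - s * Q'| <= _).
  by apply: dvdn_leq => //; rewrite muln_gt0 p0 /=; move: nQ; clear; lia.
have e' : p * `|s' * Q - s * Q'| = `|s' * r - s * r'|.
  rewrite -[X in X * `|_|]/(absz p%:Z) -abszM mulrBr -!PoszM.
  move: e; rewrite !mulnDr !mulnA => e; move: e.
  rewrite -(mulnA p) -[X in _ -> `|_ - Posz X| = _](mulnA p) -!(mulnC p).
  clear; lia.
rewrite e' leq_max.
have /(leq_mul (leqnn s')) := rA; have /(leq_mul (leqnn s)) := r'B.
clear; lia.
Qed.

End primitive_vectors.

(** * First moment on a grid cell *)

Section cell_counting.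
Local Open Scope nat_scope.

Definition ceil_div (a d : nat) := (a + d.-1) %/ d.

Lemma ceil_divP a d : 0 < d -> a <= ceil_div a d * d < a + d.
Proof.
move=> d0; have := divn_eq (a + d.-1) d; rewrite -/(ceil_div a d).
have := ltn_pmod (a + d.-1) d0; move: (_ * _) (_ %% _) => x y; clear -d0; lia.
Qed.

(** Half-open cells, so that a grid point lies in only one of them and the first moments over
    distinct cells add up; the covers use closed cells. *)
Definition in_cell m p (M : nat) (c : 'I_m -> nat)
    (t : {ffun 'I_m -> 'I_p}) : bool :=
  [forall i, c i * p <= t i * M < (c i).+1 * p].

Lemma cell_shift_le p M s Q c0 b sg r : 0 < M ->
  4 * sg <= s -> 2 * (s * c0 + b) + s <= 2 * M * Q ->
  r * M <= b * p + sg * p -> r <= p * Q.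
Proof.
move=> M0 sgs lo rM; rewrite -(leq_pmul2r M0).
have : p * (2 * (s * c0 + b) + s) <=
  p * (2 * M * Q) by rewrite leq_mul2l lo orbT.
have : p * (4 * sg) <= p * s by rewrite leq_mul2l sgs orbT.
move: rM; clear; lia.
Qed.

(** In units of 1/M, [Q] exceeds the value of the form at the lower corner by s/2 to 3s/4. The free
    coordinates use up at most [sg] <= s/4 of this, and the window adds less than s/4. So s (x/p -
    c0/M) ends up in [s/4, s), and [x] stays in the cell. *)
Lemma cell_last_coord p M s A Q c0 b sg r d x :
  0 < s -> 0 < M -> 4 * sg <= s ->
  2 * (s * c0 + b) + s <= 2 * M * Q -> 4 * M * Q <= 4 * (s * c0 + b) + 3 * s ->
  4 * A * M <= p * s -> b * p <= r * M -> r * M <= b * p + sg * p ->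
  d + r = p * Q -> d <= s * x -> s * x < d + A ->
  c0 * p <= x * M < c0.+1 * p.
Proof.
move=> s0 M0 sgs lo hi AM rlo rhi dr dlo dhi.
have : p * (2 * (s * c0 + b) + s) <=
  p * (2 * M * Q) by rewrite leq_mul2l lo orbT.
have : p * (4 * M * Q) <= p * (4 * (s * c0 + b) + 3 * s).
  by rewrite leq_mul2l hi orbT.
have : p * (4 * sg) <= p * s by rewrite leq_mul2l sgs orbT.
have : d * M <= s * x * M by rewrite leq_mul2r dlo orbT.
have : s * x * M < (d + A) * M by rewrite ltn_mul2r dhi M0.
have : (d + r) * M = p * Q * M by rewrite dr.
move: AM rlo rhi => AM rlo rhi e h1 h2 h3 h4 h5; apply/andP; split.
  rewrite -(leq_pmul2l s0); move: AM rlo rhi e h1 h2 h3 h4 h5; clear; lia.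
rewrite -(ltn_pmul2l s0); move: AM rlo rhi e h1 h2 h3 h4 h5; clear; lia.
Qed.

(* The coordinates other than [i0] are free in the cell, and [t i0] is then
   confined to an interval of length [A / q i0]; the bounds on [Q] keep this
   interval inside the cell. *)
Lemma card_cell_dotn m p M A Q (i0 : 'I_m) (q c : 'I_m -> nat) :
  0 < M <= p -> 0 < q i0 -> 4 * (\sum_(i | i != i0) q i) <= q i0 ->
  (forall i, c i < M) ->
  2 * (\sum_i q i * c i) + q i0 <= 2 * M * Q ->
  4 * M * Q <= 4 * (\sum_i q i * c i) + 3 * q i0 ->
  4 * A * M <= p * q i0 ->
  (A %/ q i0) * (p %/ M) ^ m.-1 <=
  #|[pred t : {ffun 'I_m -> 'I_p} | in_cell M c t &&
      (p * Q <= dotn q t <= p * Q + A)]|.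
Proof.
move=> /andP[M0 Mp] s0 sgs cM; rewrite (bigD1 i0) //=.
set s := q i0 in s0 sgs *; set b := \sum_(i | _) q i * c i => lo hi AM.
have p0 : 0 < p by apply: leq_trans Mp.
pose z := Ordinal p0.
have h0 : 0 < p %/ M by rewrite divn_gt0.
pose y := Ordinal h0.
pose w (t : {ffun 'I_m -> 'I_(p %/ M)}) i := ceil_div (c i * p) M + t i.
pose r t := \sum_(i | i != i0) q i * w t i.
pose x t (e : 'I_(A %/ s)) := ceil_div (p * Q - r t) s + e.
pose v t e i := if i == i0 then x t e else w t i.
have wcell t i : c i * p <= w t i * M < (c i).+1 * p.
  have := ceil_divP (c i * p) M0; rewrite /w mulnDl.
  have : (t i).+1 * M <= p.
    apply: leq_trans (leq_trunc_div p M); rewrite leq_mul2r; apply/orP; right.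
    exact: ltn_ord.
  clear; lia.
have rlo t : b * p <= r t * M.
  rewrite /b /r !big_distrl /=; apply: leq_sum => i _.
  by rewrite -!mulnA leq_mul2l; case/andP: (wcell t i) => ->; rewrite orbT.
have rhi t : r t * M <= b * p + (\sum_(i | i != i0) q i) * p.
  rewrite -mulnDl -big_split !big_distrl /=; apply: leq_sum => i _.
  rewrite -[X in _ + X]muln1 -mulnDr addn1 -!mulnA leq_mul2l.
  by case/andP: (wcell t i) => _ /ltnW ->; rewrite orbT.
have rle t : r t <= p * Q.
  by apply: (@cell_shift_le p M s Q (c i0) b) (rhi t).
have xP t e : p * Q - r t <= s * x t e < p * Q - r t + A.
  have := ceil_divP (p * Q - r t) s0.
  have : e.+1 * s <= A.
    apply: leq_trans (leq_trunc_div A s); rewrite leq_mul2r; apply/orP; right.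
    exact: ltn_ord.
  rewrite /x; set y' := ceil_div _ _; set d := p * Q - r t.
  clearbody y' d; clear; lia.
have vcell t e i : c i * p <= v t e i * M < (c i).+1 * p.
  rewrite /v; case: eqP => [->|_]; last exact: wcell.
  have /andP[xlo xhi] := xP t e.
  apply: (cell_last_coord s0 M0 sgs lo hi AM (rlo t) (rhi t) _ xlo xhi).
  by rewrite subnK.
have vp t e i : v t e i < p.
  rewrite -(ltn_pmul2r M0); have /andP[_ h] := vcell t e i.
  by apply: leq_trans h _; rewrite mulnC leq_mul2l cM orbT.
(* By [vp] the default value [z] is never taken. *)
pose f (u : {ffun 'I_m -> 'I_(p %/ M)} * 'I_(A %/ s)) : {ffun 'I_m -> 'I_p} :=
  [ffun i => insubd z (v u.1 u.2 i)].
have fE u i : f u i = v u.1 u.2 i :> nat.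
  by rewrite ffunE val_insubd vp.
have cardD : #|predC (pred1 i0)| = m.-1.
  by have := cardC (pred1 i0); rewrite card1 card_ord add1n => /(congr1 predn).
rewrite mulnC -cardD -(card_pinned y (pred1 i0)) -[X in _ * X]card_ord -cardX.
apply: (@leq_card_inj _ _ f) => [[t e] _|[t e] [t' e']].
  rewrite inE; apply/andP; split.
    by apply/forallP => i; rewrite fE; exact: vcell.
  have -> : dotn q (f (t, e)) = s * x t e + r t.
    rewrite /dotn (bigD1 i0) //= fE /v eqxx; congr (_ + _).
    by apply: eq_bigr => i ii0; rewrite fE /v (negPf ii0).
  move: (xP t e) (rle t); clear; lia.
rewrite !inE /= !andbT => /forallP ty /forallP t'y ff.
have vv i : v t e i = v t' e' i by rewrite -(fE (t, e)) -(fE (t', e')) ff.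
have tt' : t = t'.
  apply/ffunP => i; case: (eqVneq i i0) => [->|ii0].
    have := ty i0; have := t'y i0; rewrite /= eqxx /=.
    by move=> /eqP -> /eqP ->.
  apply: val_inj; have := vv i; rewrite /v (negPf ii0) /w => /eqP.
  by rewrite eqn_add2l => /eqP.
congr pair => //; apply: val_inj; have := vv i0.
by rewrite /v eqxx /x tt' => /eqP; rewrite eqn_add2l => /eqP.
Qed.

Lemma card_forall_family (T T' : finType) (F : T -> pred T') :
  #|[pred t : {ffun T -> T'} | [forall j, F j (t j)]]| = \prod_j #|F j|.
Proof.
have -> : \prod_j #|F j| = #|family F|.
  by rewrite card_family foldrE big_map big_enum.
apply: eq_card => t; apply/idP/idP => [|Ft].
  by rewrite inE => /forallP Ft; apply/(@familyP _ _ (fun=> predPredType T')).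
by rewrite inE; apply/forallP; apply/(@familyP _ _ (fun=> predPredType T') F).
Qed.

Lemma card_cell_forms m n p M A (i0 : 'I_m) (q : 'I_m -> nat)
    (c : 'I_n -> 'I_m -> nat) (Q : 'I_n -> nat) :
  0 < M <= p -> 0 < q i0 -> 4 * (\sum_(i | i != i0) q i) <= q i0 ->
  (forall j i, c j i < M) ->
  (forall j, 2 * (\sum_i q i * c j i) + q i0 <= 2 * M * Q j) ->
  (forall j, 4 * M * Q j <= 4 * (\sum_i q i * c j i) + 3 * q i0) ->
  4 * A * M <= p * q i0 ->
  ((A %/ q i0) * (p %/ M) ^ m.-1) ^ n <=
  #|[pred t : {ffun 'I_n -> {ffun 'I_m -> 'I_p}} |
      [forall j, in_cell M (c j) (t j) &&
        (p * Q j <= dotn q (t j) <= p * Q j + A)]]|.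
Proof.
move=> Mp s0 sgs cM lo hi AM.
rewrite -[X in _ ^ X](card_ord n) -prod_nat_const.
pose F j := [pred t : {ffun 'I_m -> 'I_p} | in_cell M (c j) t &&
   (p * Q j <= dotn q t <= p * Q j + A)].
apply: leq_trans (_ : \prod_(j < n) #|F j| <= _).
  by apply: leq_prod => j _; exact: (@card_cell_dotn _ _ _ _ _ i0).
rewrite -(card_forall_family (fun j => [pred t | F j t])).
exact: leqnn.
Qed.

End cell_counting.

(** * A positive proportion of the vectors is primitive *)

Section primitive_counting.
Local Open Scope nat_scope.

Lemma card_shifted_multiples L e b : 0 < e ->
  #|[pred x : 'I_L | e %| b + x]| <= (L %/ e).+1.
Proof.
move=> e0; rewrite -[X in _ <= X]card_ord.
pose f (x : 'I_L) : 'I_(L %/ e).+1 := inord (x %/ e).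
apply: (@leq_card_inj _ _ f (mem [pred x : 'I_L | e %| b + x]) predT) => // x y.
rewrite !inE => ex ey /(congr1 val).
rewrite /= !inordK ?ltnS ?leq_div2r ?(ltnW (ltn_ord _)) // => xy.
apply: val_inj => /=; rewrite (divn_eq x e) (divn_eq y e) xy; congr (_ + _).
by apply/eqP; rewrite -(eqn_modDl b) /dvdn in ex ey *;
  rewrite (eqP ex) (eqP ey).
Qed.

(** The term e = 2 gives 1/4; the others telescope through e^-2 <= 1/(e-1) - 1/e to less than 1/2.
    What matters is a bound well below 1. *)
Lemma sum_inv_sqr_le (F : realFieldType) s :
  (\sum_(2 <= e < s.+1) (e%:R ^- 2) <= 3 / 4 :> F)%R.
Proof.
have [s1|] := leqP s 1; first by rewrite big_geq //; lra.
case: s => [//|[//|s]] _.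
suff : (\sum_(2 <= e < s.+3) (e%:R ^- 2) <= 3 / 4 - s.+2%:R^-1 :> F)%R.
  by move=> h; apply: le_trans h _; rewrite lerBlDr lerDl invr_ge0.
elim: s => [|s IH]; first by rewrite big_nat1; lra.
rewrite big_nat_recr //=; apply: le_trans (lerD IH (lexx _)) _.
have x0 : (0 < s.+2%:R :> F)%R by rewrite ltr0n.
have -> : s.+3%:R = (s.+2%:R + 1 :> F)%R by rewrite -natr1.
move: (s.+2%:R) x0 => x x0.
rewrite -lerBrDl -subr_ge0.
have -> : (3 / 4 - (x + 1)^-1 - (3 / 4 - x^-1) - (x + 1) ^- 2 =
    (x * (x + 1) ^+ 2)^-1 :> F)%R by field; apply/andP; split; lra.
by rewrite invr_ge0; apply: mulr_ge0; [exact: ltW|exact: sqr_ge0].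
Qed.

(* With [delta = 1 / min E L] the summand is at most [E ^ d * L ^ n] times
   [(1/e + delta)^2 <= 7/6 e^-2 + 7 delta^2], and the sum of [e^-2] over
   [e >= 2] is at most [3/4]. *)
Lemma sum_divn_pow_le (F : realFieldType) s E L d n :
  1 < d + n -> 112 * s <= E ^ 2 -> 112 * s <= L ^ 2 -> 0 < s ->
  16 * \sum_(2 <= e < s.+1) (E %/ e).+1 ^ d * (L %/ e).+1 ^ n
    <= 15 * (E ^ d * L ^ n).
Proof.
move=> dn sE sL s0.
have E0 : 10 < E by rewrite ltnNge; apply/negP => E10; have := leq_mul E10 E10;
  lia.
have L0 : 10 < L by rewrite ltnNge; apply/negP => L10; have := leq_mul L10 L10;
  lia.
pose N := minn E L.
have N0 : 10 < N by rewrite leq_min E0.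
have sN : 112 * s <= N ^ 2 by rewrite /N; case: (leqP E L).
rewrite -(ler_nat F) !natrM natr_sum mulr_sumr.
pose dl : F := (N%:R^-1)%R.
have dl0 : (0 < dl)%R by rewrite invr_gt0 ltr0n; apply: leq_trans N0.
have dlh : (dl <= 1 / 2)%R.
  rewrite /dl ler_pdivlMr ?ltr0n // mulrC ler_pdivrMr ?ltr0n
    ?(leq_trans _ N0) //.
  by rewrite mul1r ler_nat; apply: leq_trans N0.
have fac (a e : nat) : N <= a -> 1 < e ->
    ((a %/ e).+1%:R <= a%:R * (e%:R^-1 + dl) :> F)%R.
  move=> Na e1; have e0 : (0 < e%:R :> F)%R by rewrite ltr0n;
    apply: leq_trans e1.
  rewrite -natr1 mulrDr lerD //.
    by rewrite ler_pdivlMr // -natrM ler_nat leq_trunc_div.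
  by rewrite ler_pdivlMr ?ltr0n ?(leq_trans _ N0)// mul1r ler_nat.
have inv2 (e : nat) : 1 < e -> (0 <= (e%:R^-1 : F) <= 1 / 2)%R.
  move=> e1; rewrite invr_ge0 ler0n /= ler_pdivlMr ?ltr0n // mulrC.
  by rewrite ler_pdivrMr ?ltr0n ?(leq_trans _ e1)// mul1r ler_nat.
have term (e : nat) : 1 < e ->
    (((E %/ e).+1 ^ d * (L %/ e).+1 ^ n)%:R
     <= (E ^ d * L ^ n)%:R * ((7 / 6) * e%:R ^- 2 + 7 * dl ^+ 2) :> F)%R.
  move=> e1; have /andP[i0 i2] := inv2 _ e1.
  apply: (@le_trans _ _ ((E ^ d * L ^ n)%:R * (e%:R^-1 + dl) ^+ (d + n))%R).
    rewrite exprD !natrM !natrX mulrACA -!exprMn.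
    by rewrite ler_pM ?exprn_ge0 ?ler0n // lerXn2r ?nnegrE ?ler0n ?fac
      ?mulr_ge0 ?addr_ge0 ?ler0n ?(ltW dl0) ?geq_minl ?geq_minr.
  rewrite ler_wpM2l ?ler0n //.
  (* Both summands are at most 1/2, so the exponent [d + n] can be lowered to 2; here [1 < d + n]
     enters. *)
  apply: (@le_trans _ _ ((e%:R^-1 + dl) ^+ 2)%R).
    by apply: ler_wiXn2l => //; [lra|lra].
  rewrite -exprVn; move: (e%:R^-1)%R i0 => x x0.
  (* Six times this square is the difference of the two sides. *)
  have : (0 <= (x / 6 - dl) ^+ 2)%R by exact: sqr_ge0.
  nra.
apply: (@le_trans _ _ (\sum_(2 <= e < s.+1) (16 * ((E ^ d * L ^ n)%:R *
    ((7 / 6) * e%:R ^- 2 + 7 * dl ^+ 2)) : F))%R).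
  rewrite !big_nat; apply: ler_sum => e /andP[e1 _].
  by rewrite ler_wpM2l // term.
rewrite -mulr_sumr -mulr_sumr big_split /= -mulr_sumr sumr_const_nat.
rewrite -[in leRHS]natrM; set W := ((E ^ d * L ^ n)%:R)%R.
have W0 : (0 <= W :> F)%R by rewrite ler0n.
have := sum_inv_sqr_le F s; set S := (\sum_(_ <= _ < _) _)%R => S34.
(* 112 = 16 * 7: the terms 7 dl^2 add up to at most 1/16, the others to at most 7/6 * 3/4 = 7/8, in
   total 15/16. *)
have small : (112 * (dl ^+ 2 * (s.+1 - 2)%:R) <= 1)%R.
  rewrite mulrCA -natrM /dl exprVn mulrC ler_pdivrMr; last first.
    by rewrite exprn_gt0 // ltr0n; apply: leq_trans N0.
  rewrite mul1r -natrX ler_nat; apply: leq_trans sN; rewrite leq_mul2l.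
  by rewrite subSS leq_subr orbT.
rewrite -[(7 * dl ^+ 2 *+ _)%R]mulr_natr -[(7 * dl ^+ 2 * _)%R]mulrA.
move: S34 small; move: (dl ^+ 2 * _)%R S => z S S34 small.
have : (W * (16 * (7 / 6 * S + 7 * z)) <= W * 15)%R.
  by rewrite ler_wpM2l //; move: S34 small; clear; lra.
lra.
Qed.

Variables (m n s E L : nat) (X : nat) (i0 : 'I_m) (K : pred 'I_m).

(** The bound 1 makes the entries outside [K] zero: these positions belong to the rows of X1, whose
    coefficients come from the integers [Q]. *)
Definition shell_vector (q : {ffun 'I_m -> 'I_X.+1}) : bool :=
  [forall i, if i == i0 then q i == s :> nat else q i < if K i then E else 1].

Let d := #|[pred i | K i && (i != i0)]|.

Lemma prod_shell (a : nat) :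
  \prod_i (if i == i0 then 1 else if K i then a else 1) = a ^ d.
Proof.
rewrite (eq_bigr (fun i => if K i && (i != i0) then a else 1)).
  by rewrite -big_mkcond prod_nat_const.
by move=> i _; case: eqP; rewrite ?andbF ?andbT.
Qed.

Lemma card_ord_lt (a : nat) : a <= X.+1 -> #|[pred y : 'I_X.+1 | y < a]| = a.
Proof.
move=> aX; have inj : injective (widen_ord aX).
  by move=> x y /(congr1 val) /= xy; exact: val_inj.
rewrite -[RHS]card_ord -(card_codom inj).
apply: eq_card => y; rewrite !inE; apply/idP/codomP => [ya|[z ->]]; last first.
  by rewrite /= ltn_ord.
by exists (Ordinal ya); apply: val_inj.
Qed.

Lemma card_shell_vector : s <= X -> 0 < E <= X -> #|shell_vector| = E ^ d.
Proof.
move=> sX /andP[E0 EX]; rewrite -prod_shell.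
pose F i := [pred y : 'I_X.+1 |
  if i == i0 then y == s :> nat else y < if K i then E else 1].
transitivity (\prod_i #|F i|); first by rewrite -(card_forall_family F).
apply: eq_bigr => i _; rewrite /F; case: (i == i0).
  rewrite -[RHS](card1 (Ordinal (sX : s < X.+1))); exact: eq_card.
by rewrite card_ord_lt //; case: ifP => // _; apply: leqW.
Qed.

Lemma card_shell_vector_dvd (e : nat) : 1 < e -> 0 < E <= X ->
  #|[pred q | shell_vector q && [forall i, e %| q i]]| <= (E %/ e).+1 ^ d.
Proof.
move=> e1 /andP[E0 EX]; rewrite -prod_shell.
pose F i := [pred y : 'I_X.+1 | (if i == i0 then y == s :> nat
  else y < if K i then E else 1) && (e %| y)].
apply: leq_trans (_ : \prod_i #|F i| <= _).
  rewrite -(card_forall_family F); apply/subset_leq_card/fintype.subsetP => q.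
  rewrite !inE => /andP[/forallP qV /forallP eq].
  by apply/forallP => i; rewrite inE qV eq.
apply: leq_prod => i _; rewrite /F; case: (i == i0).
  have [sX|Xs] := leqP s X; last first.
    rewrite eq_card0 // => y; rewrite !inE; apply/negP => /andP[/eqP ys _].
    by have := ltn_ord y; rewrite ys ltnNge Xs.
  rewrite -(card1 (Ordinal (sX : s < X.+1))).
  apply/subset_leq_card/fintype.subsetP => y.
  by rewrite !inE -val_eqE => /andP[].
have bound (a : nat) : a <= X.+1 ->
    #|[pred y : 'I_X.+1 | (y < a) && (e %| y)]| <=
      #|[pred y : 'I_a | e %| 0 + y]|.
  move=> aX; case: a aX => [|a] aX.
    by rewrite eq_card0 // => y; rewrite !inE.
  pose f (y : 'I_X.+1) : 'I_a.+1 := inord y.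
  apply: (@leq_card_inj _ _ f
    (mem [pred y : 'I_X.+1 | (y < a.+1) && (e %| y)])).
    by move=> y /andP[ya ey]; rewrite !inE inordK.
  move=> x y; rewrite !inE => /andP[xa _] /andP[ya _] /(congr1 val).
  by rewrite /= !inordK // => ?; exact: val_inj.
case: ifP => _.
  apply: leq_trans (bound _ (leqW EX)) _.
  by apply: card_shifted_multiples; apply: ltnW.
apply: leq_trans (bound 1 isT) _; apply: leq_trans (max_card _) _.
by rewrite card_ord.
Qed.

(** A vector that is not primitive is divisible by some e with 2 <= e <= s, and the union bound over
    e leaves at least 1/16 of all vectors. The shift [beta] depends on [q] because the integers
    close to q.t for t in a given cell do. *)
Lemma sum_primitive_ge (beta : {ffun 'I_m -> 'I_X.+1} -> 'I_n -> nat) :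
  1 < d + n -> 112 * s <= E ^ 2 -> 112 * s <= L ^ 2 -> 0 < s <= X -> E <= X ->
  E ^ d * L ^ n <=
  16 * \sum_(q | shell_vector q)
    #|[pred x : {ffun 'I_n -> 'I_L} |
        primitive s (fun i => q i : nat) (fun j => beta q j + x j)]|.
Proof.
move=> dn sE sL /andP[s0 sX] EX.
have E0 : 0 < E by case: (E) sE => //; lia.
pose bad e q := [pred x : {ffun 'I_n -> 'I_L} | [forall j,
  e %| beta q j + x j]].
have cbad e q : 0 < e -> #|bad e q| <= (L %/ e).+1 ^ n.
  move=> e0; rewrite -[X in _ ^ X](card_ord n) -prod_nat_const.
  apply: leq_trans (_ : \prod_j #|[pred x : 'I_L | e %| beta q j + x]| <= _).
    by rewrite -card_forall_family.
  by apply: leq_prod => j _; exact: card_shifted_multiples.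
pose prim (q : {ffun 'I_m -> 'I_X.+1}) := [pred x : {ffun 'I_n -> 'I_L} |
        primitive s (fun i => q i : nat) (fun j => beta q j + x j)].
have ub q : L ^ n <= #|prim q| +
    \sum_(2 <= e < s.+1) [forall i, e %| (q : {ffun 'I_m ->
      'I_X.+1}) i] * #|bad e q|.
  have -> : L ^ n = #|prim q| + #|predC (prim q)|.
    by rewrite cardC card_ffun !card_ord.
  rewrite leq_add2l -sum1_card.
  under [leqRHS]eq_bigr do rewrite -sum1_card big_mkcond big_distrr /=.
  rewrite exchange_big /= big_mkcond /=; apply: leq_sum => x _.
  case: ifP => //; rewrite !inE /primitive negb_forall => /existsP[e].
  rewrite negb_imply negbK => /andP[e1 /andP[eq ex]].
  rewrite (bigD1_seq (e : nat)) ?mem_index_iota ?iota_uniq //=; last first.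
    by rewrite e1 /= ltn_ord.
  by rewrite eq inE ex.
have : \sum_(q | shell_vector q) L ^ n <= \sum_(q | shell_vector q) #|prim q| +
    \sum_(2 <= e < s.+1) (E %/ e).+1 ^ d * (L %/ e).+1 ^ n.
  apply: (@leq_trans (\sum_(q | shell_vector q) (#|prim q| +
      \sum_(2 <= e < s.+1) [forall i, e %| q i] * #|bad e q|))).
    by apply: leq_sum => q _; exact: ub.
  rewrite big_split leq_add2l exchange_big /=.
  rewrite !big_nat; apply: leq_sum => e /andP[e1 _].
  apply: leq_trans (_ : \sum_(q | shell_vector q)
      [forall i, e %| q i] * (L %/ e).+1 ^ n <= _).
    apply: leq_sum => q _; rewrite leq_mul2l cbad ?orbT //.
    exact: ltnW.
  rewrite -big_distrl leq_mul2r; apply/orP; right.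
  apply: leq_trans (card_shell_vector_dvd e1 _); last by rewrite E0.
  rewrite -sum1_card [X in X <= _]big_mkcond [X in _ <= X]big_mkcond /=.
  by apply: leq_sum => q _; rewrite !inE; case: (shell_vector q);
    case: [forall i, _].
have := sum_divn_pow_le rat dn sE sL s0.
rewrite sum_nat_const card_shell_vector ?E0 //; move: (\sum_(_ <= _ < _) _).
by rewrite /prim; move: (\sum_(_ | _) _) (E ^ d * L ^ n); clear; lia.
Qed.

End primitive_counting.

(** * First moment over one cell, with primitive vectors only *)

Section first_moment.
Local Open Scope nat_scope.

Lemma sum_card_le (T T' : finType) (P : pred T) (R : T -> pred T')
    (S : pred T') :
  (forall x t, P x -> R x t -> S t) ->
  (forall x x' t, P x -> P x' -> R x t -> R x' t -> x = x') ->
  \sum_(x | P x) #|R x| <= #|S|.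
Proof.
move=> RS Rinj; rewrite -sum1_card.
under eq_bigr do rewrite -sum1_card big_mkcond.
rewrite exchange_big /= [leqRHS]big_mkcond; apply: leq_sum => t _.
have [[x [Px Rxt]]|noX] := pselect (exists x, P x /\ R x t); last first.
  rewrite big1 // => x Px; case: ifP => // Rxt; case: noX; by exists x.
rewrite (bigD1 x) //= big1 ?addn0 => [|y /andP[Py yx]]; last first.
  by case: ifP => // Ryt; move: yx; rewrite (Rinj _ _ _ Py Px Ryt Rxt) eqxx.
have -> : (t \in S) = true by exact: RS Px Rxt.
by case: ifP.
Qed.

Lemma sum_near_integral_cell m n p M A s E X (i0 : 'I_m) (K : pred 'I_m)
    (c : 'I_n -> 'I_m -> nat) (d := #|[pred i | K i && (i != i0)]|)
    (L := s %/ (4 * M)) :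
  1 < d + n -> 112 * s <= E ^ 2 -> 112 * s <= L ^ 2 -> 0 < s <= X ->
  4 * (m * E) <= s -> 0 < M <= p -> (forall j i, c j i < M) -> A < p ->
  4 * A * M <= p * s ->
  E ^ d * L ^ n * ((A %/ s) * (p %/ M) ^ m.-1) ^ n <=
  16 * \sum_(q : {ffun 'I_m -> 'I_X.+1} | shell_vector s E i0 K q)
    #|[pred t : {ffun 'I_n -> {ffun 'I_m -> 'I_p}} |
        [forall j, in_cell M (c j) (t j)] && near_integral i0 A (fun i =>
          q i : nat) t]|.
Proof.
move=> dn sE sL /andP[s0 sX] mE Mp cM Ap AM; have /andP[M0 _] := Mp.
have p0 : 0 < p by case/andP: Mp; lia.
have E0 : 0 < E by case: (E) sE => //; lia.
have m0 : 0 < m by exact: leq_ltn_trans (leq0n i0) (ltn_ord i0).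
have EX : E <= X.
  apply: leq_trans sX; apply: leq_trans mE; rewrite mulnA leq_pmull // muln_gt0.
  by rewrite m0.
pose b (q : {ffun 'I_m -> 'I_X.+1}) j := \sum_i q i * c j i.
pose beta q j := ceil_div (2 * b q j + s) (2 * M).
have M20 : 0 < 2 * M by rewrite muln_gt0.
have sP : 0 < s <= X by rewrite s0.
have := @sum_primitive_ge m n s E L X i0 K beta dn sE sL sP EX.
move=> /(leq_mul (leqnn (((A %/ s) * (p %/ M) ^ m.-1) ^ n))).
rewrite mulnC => /leq_trans; apply; rewrite mulnCA leq_mul2l /=.
rewrite big_distrr /=; apply: leq_sum => q qV.
have qs : q i0 = s :> nat by move/forallP: qV => /(_ i0); rewrite eqxx => /eqP.
have qE i : i != i0 -> q i <= E.
  move=> ii0; move/forallP: qV => /(_ i); rewrite (negPf ii0).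
  by case: ifP => _; [exact: ltnW|rewrite ltnS leqn0 => /eqP ->].
pose qn i : nat := q i.
have qns : qn i0 = s := qs.
set F := [pred t : {ffun 'I_n -> {ffun 'I_m -> 'I_p}} | _ && _].
pose R (x : {ffun 'I_n -> 'I_L}) :=
  [pred t : {ffun 'I_n -> {ffun 'I_m -> 'I_p}} |
    [forall j, in_cell M (c j) (t j) &&
     (p * (beta q j + x j) <= dotn qn (t j) <= p * (beta q j + x j) + A)]].
have Rdiv x t j : R x t ->
    dotn qn (t j) %/ p = beta q j + x j /\ dotn qn (t j) %% p <= A.
  move=> /forallP/(_ j)/andP[_ /andP[lo hi]].
  have e : dotn qn (t j) = (beta q j + x j) * p + (dotn qn (t j) - p * (beta q
    j + x j)).
    by rewrite (mulnC _ p) subnKC.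
  have l : dotn qn (t j) - p * (beta q j + x j) <= A by rewrite leq_subLR.
  rewrite e divnMDl // modnMDl divn_small ?(leq_ltn_trans l) // addn0.
  by rewrite modn_small ?(leq_ltn_trans l).
apply: leq_trans (_ : \sum_(x : {ffun 'I_n -> 'I_L} | primitive s
    qn (fun j => beta q j + x j)) #|R x| <= _); last first.
  apply: sum_card_le => [x t xprim Rxt|x y t _ _ Rx Ry].
    rewrite /F /=; apply/andP; split.
      by apply/forallP => j; move: Rxt => /forallP/(_ j)/andP[].
    apply/andP; split; first by apply/forallP => j; case: (Rdiv _ _ j Rxt).
    rewrite qs (_ : (fun j => _) = (fun j => beta q j + x j)) //.
    by apply/funext => j; case: (Rdiv _ _ j Rxt).
  apply/ffunP => j; apply: val_inj; apply/eqP.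
  have [ex _] := Rdiv _ _ j Rx; have [ey _] := Rdiv _ _ j Ry.
  by rewrite /= -(eqn_add2l (beta q j)) -ex -ey.
set P := [pred x | _]; rewrite mulnC -sum_nat_const.
rewrite [leqRHS](eq_bigl (mem P)) //; apply: leq_sum => x _.
have bP j := ceil_divP (2 * b q j + s) M20.
rewrite -[X in (A %/ X) * _]qns.
apply: (@card_cell_forms _ _ _ _ _ i0 qn c
  (fun j => beta q j + x j)) => //; rewrite ?qns //.
- apply: leq_trans mE; rewrite leq_mul2l /= -[X in _ <= X * _](card_ord m).
  rewrite -sum_nat_const big_mkcond; apply: leq_sum => i _.
  by case: ifP => // /qE.
- move=> j; have := bP j; rewrite -/(b q j) -/(beta q j).
  move: (beta q j) (b q j) (x j : nat); clear; lia.
- move=> j; have := bP j; rewrite -/(b q j) -/(beta q j).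
  have xL : (x j).+1 * (4 * M) <= s.
    apply: leq_trans (leq_trunc_div s (4 * M)).
    by rewrite leq_mul2r; apply/orP; right; exact: ltn_ord.
  move: xL; move: (beta q j) (b q j) (x j : nat); clear; lia.
Qed.

End first_moment.

(** * Second moment *)

Section second_moment.
Local Open Scope nat_scope.

Lemma card_dotn_le m p (q : 'I_m -> nat) (i0 : 'I_m) (A : nat) :
  prime p -> 0 < q i0 < p ->
  #|[pred t : {ffun 'I_m -> 'I_p} | dotn q t %% p <= A]| * p <= A.+1 * p ^ m.
Proof.
move=> pp sp; have p0 := prime_gt0 pp; pose z := Ordinal p0.
pose D := pred1 i0.
have Dm : m = #|predC D| + 1.
  by rewrite -[LHS](card_ord m) -(cardC D) card1 addnC.
rewrite [X in _ <= _ * p ^ X]Dm expnD expn1 mulnA leq_mul2r gtn_eqF //=.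
rewrite mulnC -(card_pinned z D) -[X in _ * X]card_ord -cardX.
pose f (t : {ffun 'I_m -> 'I_p}) :=
  ([ffun i => if D i then z else t i], (inord (dotn q t %% p) : 'I_A.+1)).
apply: (@leq_card_inj _ _ f) => [t tA|t u].
  rewrite !inE /= andbT.
  by apply/forallP => i; apply/implyP => Di; rewrite ffunE Di.
rewrite !inE => tA uA [/ffunP tu].
move=> /(congr1 val); rewrite /= !inordK // => {tA uA} /dvdz_dotnB d1.
have off i : i != i0 -> t i = u i.
  by move=> Di; have := tu i; rewrite !ffunE !ifN.
move: d1; rewrite (bigD1 i0) //= big1 ?addr0; last first.
  by move=> i /off ->; rewrite subrr mulr0.
rewrite Gauss_dvdzr => [/ord_eq_dvdz e|]; last first.
  rewrite coprimezE /= prime_coprime //; apply/negP => /dvdn_leq; lia.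
by apply/ffunP => i; case: (eqVneq i i0) => [->|/off].
Qed.

Lemma card_near_integral m n p (i0 : 'I_m) (q : 'I_m -> nat) (A : nat) :
  prime p -> 0 < q i0 < p -> 0 < A ->
  #|[pred t : {ffun 'I_n -> {ffun 'I_m -> 'I_p}} | near_integral i0 A q t]|
     * p ^ n <= (2 * A * p ^ m) ^ n.
Proof.
move=> pp sp A0.
have col := card_dotn_le A pp sp.
apply: leq_trans (_ : (A.+1 * p ^ m) ^ n <= _); last first.
  by apply: leq_expnl; rewrite leq_mul2r; apply/orP; right; lia.
apply: leq_trans (leq_expnl n col); rewrite expnMn leq_mul2r.
apply/orP; right.
rewrite -[X in _ ^ X](card_ord n) -card_ffun_on; apply/subset_leq_card.
apply/fintype.subsetP => u; rewrite !inE => /andP[/forallP uA _].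
by apply/ffun_onP => j; rewrite inE uA.
Qed.

Variables (m n p M Q0 X : nat) (i0 : 'I_m) (K : pred 'I_m) (A E : nat -> nat).
Let d := #|[pred i | K i && (i != i0)]|.
Let T := {ffun 'I_n -> {ffun 'I_m -> 'I_p}}.

Definition test_vector (q : {ffun 'I_m -> 'I_X.+1}) : bool :=
  (Q0 <= q i0) && shell_vector (q i0) (E (q i0)) i0 K q.

Definition hit (q : {ffun 'I_m -> 'I_X.+1}) (t : T) : bool :=
  near_integral i0 (A (q i0)) (fun i => q i : nat) t.

Definition hits (t : T) : nat := \sum_(q | test_vector q) hit q t.

Lemma sum_test_vector (F : nmodType) (f : {ffun 'I_m -> 'I_X.+1} -> F) :
  (\sum_(q | test_vector q) f q =
   \sum_(s < X.+1 | (Q0 <= s)%N)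
     \sum_(q | shell_vector s (E s) i0 K q) f q)%R.
Proof.
rewrite (partition_big (fun q : {ffun 'I_m -> 'I_X.+1} => q i0)
  (fun s : 'I_X.+1 => Q0 <= s)); last by move=> q /andP[].
apply: eq_bigr => s Qs; apply: eq_bigl => q; rewrite /test_vector.
apply/idP/idP => [/andP[/andP[_ V] /eqP <-]//|V].
have qs : q i0 = s.
  by move/forallP: (V) => /(_ i0); rewrite eqxx => /eqP /val_inj.
by rewrite qs eqxx Qs V.
Qed.

Variable F : realFieldType.

(** The expected number of hits up to constants: for each s there are E(s)^d vectors, and each of
    the [n] columns meets its condition with probability about A(s)/p. Primitivity is
    disregarded. *)
Definition mass : F :=
  (\sum_(s < X.+1 | (Q0 <= s)%N) (E s ^ d * A s ^ n)%:R / p%:R ^+ n)%R.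

Hypotheses (pp : prime p) (Xp : X * X < p) (Mp : 0 < M <= p) (Q00 : 0 < Q0).
Hypothesis dn : 1 < d + n.
Hypothesis sE : forall s, Q0 <= s <= X -> 112 * s <= E s ^ 2.
Hypothesis mE : forall s, Q0 <= s <= X -> 4 * (m * E s) <= s.
Hypothesis sL : forall s, Q0 <= s <= X -> 112 * s <= (s %/ (4 * M)) ^ 2.
Hypothesis sA : forall s, Q0 <= s <= X -> s <= A s < p.
Hypothesis AM : forall s, Q0 <= s <= X -> 4 * A s * M <= p * s.

Let p0 : 0 < p := prime_gt0 pp.

Let EX s : Q0 <= s <= X -> 0 < E s <= X.
Proof.
move=> sQ; have := sE sQ; have := mE sQ; case/andP: sQ => Qs sX mEs sEs.
have E0 : 0 < E s by case: (E s) sEs => //; lia.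
rewrite E0 /=; apply: leq_trans sX; apply: leq_trans mEs.
rewrite mulnA leq_pmull // muln_gt0 /=.
exact: leq_ltn_trans (leq0n i0) (ltn_ord i0).
Qed.

Let test_range q : test_vector q -> Q0 <= q i0 <= X.
Proof. by case/andP=> -> _; rewrite -ltnS ltn_ord. Qed.

Lemma sum_test_mass :
  (\sum_(q | test_vector q) (A (q i0))%:R ^+ n = mass * p%:R ^+ n)%R.
Proof.
rewrite sum_test_vector /mass mulr_suml; apply: eq_bigr => s Qs.
have sX : s <= X by rewrite -ltnS ltn_ord.
have sQ : Q0 <= s <= X by rewrite Qs.
rewrite (eq_bigr (fun=> (A s)%:R ^+ n : F)%R); last first.
  move=> q /forallP/(_ i0); rewrite eqxx => /eqP <- //.
rewrite sumr_const (card_shell_vector _ _ sX (EX sQ)) divfK; last first.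
  by rewrite expf_eq0 pnatr_eq0 gtn_eqF ?andbF.
by rewrite -[LHS]mulr_natl natrM !natrX.
Qed.

(** The square is expanded over pairs of vectors. The diagonal gives the linear term, by
    [card_near_integral]; every other pair costs at most 6^n times the product of its two
    probabilities, by [card_near_integral_pair]. *)
Lemma sum_hits_sqr_le :
  (\sum_t (hits t)%:R ^+ 2 <=
     p%:R ^+ (m * n) * (2 ^+ n * mass + 6 ^+ n * mass ^+ 2) :> F)%R.
Proof.
have pF : (0 < p%:R :> F)%R by rewrite ltr0n.
have pnF k : (0 < p%:R ^+ k :> F)%R by rewrite exprn_gt0.
have pair q q' : test_vector q -> test_vector q' ->
    (\sum_t (hit q t * hit q' t)%:R <=
     (q == q')%:R *
       (p%:R ^+ (m * n) * 2 ^+ n * ((A (q i0))%:R ^+ n / p%:R ^+ n))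
     + p%:R ^+ (m * n) * 6 ^+ n *
       (((A (q i0))%:R ^+ n / p%:R ^+ n) * ((A (q' i0))%:R ^+ n / p%:R ^+ n))
     :> F)%R.
  move=> Vq Vq'; have qQ := test_range Vq; have q'Q := test_range Vq'.
  have qX i : q i <= X by rewrite -ltnS ltn_ord.
  have q'X i : q' i <= X by rewrite -ltnS ltn_ord.
  have sp : 0 < q i0 < p.
    case/andP: qQ => h1 h2; rewrite (leq_trans Q00) //=.
    by apply: leq_ltn_trans Xp; move: h1 h2 Q00; clear; nia.
  have s'p : 0 < q' i0 by case/andP: q'Q => h1 h2; rewrite (leq_trans Q00).
  have /andP[sAq _] := sA qQ; have /andP[sAq' _] := sA q'Q.
  have A0 : 0 < A (q i0) by case/andP: sp => ? _; exact: leq_trans sAq.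
  have [<-{q' Vq' q'Q q'X s'p sAq'}|qq'] := eqVneq q q'.
    rewrite mul1r; apply: (@le_trans _ _ (p%:R ^+ (m * n) * 2 ^+ n *
        ((A (q i0))%:R ^+ n / p%:R ^+ n)))%R; last first.
      by rewrite lerDl ?mulr_ge0 ?divr_ge0 ?exprn_ge0 ?ler0n // ltW.
    rewrite mulrA ler_pdivlMr //.
    have := @card_near_integral m n p i0 (fun i => q i : nat) _ pp sp A0.
    rewrite -(ler_nat F) natrM natrX => h; apply: le_trans (le_trans h _).
      rewrite ler_wpM2r ?exprn_ge0 ?ler0n // -sum1_card natr_sum
        [leRHS]big_mkcond /=.
      apply: ler_sum => t _; rewrite !inE /hit.
      by case: near_integral; rewrite ?muln0 // ?mulr1n.
    by rewrite natrX !natrM natrX !exprMn -exprM [leLHS]mulrC mulrA.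
  rewrite mul0r add0r.
  have qq : ~ (fun i => q i : nat) =1 (fun i => q' i : nat).
    by move=> e; move/eqP: qq'; apply; apply/ffunP => i; apply: val_inj;
      exact: e.
  have s0 : 0 < q i0 by case/andP: sp.
  have := @card_near_integral_pair m n p i0 (fun i => q i : nat)
    (fun i => q' i : nat) _ _ X pp Xp qX q'X s0 s'p sAq sAq' qq.
  rewrite -(ler_nat F) natrM !natrX => h.
  rewrite mulf_div mulrA ler_pdivlMr ?mulr_gt0 //.
  rewrite -exprD addnn -mul2n exprM; apply: le_trans (le_trans h _).
    rewrite ler_wpM2r ?exprn_ge0 ?ler0n // -sum1_card natr_sum
      [leRHS]big_mkcond /=.
    apply: ler_sum => t _; rewrite !inE /hit.
    by do 2!case: near_integral; rewrite ?muln0 // ?mulr1n.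
  by rewrite !natrM natrX !exprMn -exprM [leLHS]mulrC !mulrA.
have -> : (\sum_t (hits t)%:R ^+ 2 = \sum_(q | test_vector q)
    \sum_(q' | test_vector q') \sum_t (hit q t * hit q' t)%:R :> F)%R.
  rewrite (eq_bigr (fun t => \sum_(q | test_vector q) \sum_(q' | test_vector q')
      (hit q t * hit q' t)%:R)%R).
    by rewrite exchange_big; apply: eq_bigr => q _; rewrite exchange_big.
  move=> t _; rewrite expr2 /hits natr_sum mulr_suml; apply: eq_bigr => q _.
  by rewrite mulr_sumr; apply: eq_bigr => q' _; rewrite natrM.
apply: (@le_trans _ _ (\sum_(q | test_vector q) \sum_(q' | test_vector q')
   ((q == q')%:R *
       (p%:R ^+ (m * n) * 2 ^+ n * ((A (q i0))%:R ^+ n / p%:R ^+ n)) +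
     p%:R ^+ (m * n) * 6 ^+ n *
       ((A (q i0))%:R ^+ n / p%:R ^+ n * ((A (q' i0))%:R ^+ n / p%:R ^+ n)))))%R.
  by apply: ler_sum => q Vq; apply: ler_sum => q' Vq'; exact: pair.
have massE :
    (mass = \sum_(q | test_vector q) ((A (q i0))%:R ^+ n / p%:R ^+ n))%R.
  by rewrite -mulr_suml sum_test_mass mulfK // gt_eqF.
rewrite (eq_bigr (fun q : {ffun 'I_m -> 'I_X.+1} =>
  p%:R ^+ (m * n) * 2 ^+ n * ((A (q i0))%:R ^+ n / p%:R ^+ n)
    + p%:R ^+ (m * n) * 6 ^+ n * mass * ((A (q i0))%:R ^+ n / p%:R ^+ n)))%R.
  rewrite big_split /= -!mulr_sumr -massE.
  by rewrite expr2 [leRHS]mulrDr !mulrA.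
move=> q Vq; rewrite big_split /=; congr (_ + _)%R.
  rewrite (bigD1 q) //= eqxx mul1r big1 ?addr0 // => q' /andP[_ /negPf].
  by rewrite eq_sym => ->; rewrite mul0r.
rewrite -mulr_sumr -mulr_sumr -massE -[RHS]mulrA; congr (_ * _)%R.
exact: mulrC.
Qed.

Variable C : pred {ffun 'I_n -> {ffun 'I_m -> 'I_M}}.

Definition in_cells (t : T) : bool :=
  [exists c, C c && [forall j, in_cell M (fun i => c j i : nat) (t j)]].

Lemma in_cell_inj m' (c c' : {ffun 'I_m' -> 'I_M}) (t : {ffun 'I_m' -> 'I_p}) :
  in_cell M (fun i => c i : nat) t -> in_cell M (fun i => c' i : nat) t ->
  c = c'.
Proof.
move=> /forallP ct /forallP c't; apply/ffunP => i; apply: val_inj.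
have /andP[a1 a2] := ct i; have /andP[b1 b2] := c't i.
have := leq_ltn_trans a1 b2; have := leq_ltn_trans b1 a2.
by rewrite !ltn_pmul2r // !ltnS => ? ?; apply/eqP; rewrite eqn_leq; apply/andP.
Qed.

(** The first 16 is the loss by primitivity. Rounding costs a factor 2 for each quotient: 2^(m-1)
    per column for p/M, and 16 per column because A/M = 4 (A/s)(s/(4M)). *)
Lemma sum_hits_cells_ge :
  (#|C|%:R * p%:R ^+ (m * n) / M%:R ^+ (m * n) * mass <=
   16 * (16 ^+ n * 2 ^+ (m.-1 * n)) *
     \sum_(t | in_cells t) (hits t)%:R :> F)%R.
Proof.
have /andP[M0 Mlep] := Mp.
have pnF k : (0 < p%:R ^+ k :> F)%R by rewrite exprn_gt0 ?ltr0n.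
have MnF k : (0 < M%:R ^+ k :> F)%R by rewrite exprn_gt0 ?ltr0n.
have m0 : 0 < m by exact: leq_ltn_trans (leq0n i0) (ltn_ord i0).
pose U c : pred T := fun t => [forall j, in_cell M (fun i =>
  (c j : {ffun 'I_m -> 'I_M}) i : nat) (t j)].
have cell (c : {ffun 'I_n -> {ffun 'I_m -> 'I_M}}) :
    (p%:R ^+ (m * n) / M%:R ^+ (m * n) * mass <=
     16 * (16 ^+ n * 2 ^+ (m.-1 * n)) * \sum_(t | U c t) (hits t)%:R :> F)%R.
  have -> : (\sum_(t | U c t) (hits t)%:R =
      \sum_(s < X.+1 | (Q0 <= s)%N) \sum_(q | shell_vector s (E s) i0 K q)
        #|[pred t | U c t && hit q t]|%:R :> F)%R.
    rewrite -sum_test_vector /hits; under eq_bigr do rewrite natr_sum.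
    rewrite exchange_big; apply: eq_bigr => q Vq.
    rewrite -sum1_card natr_sum big_mkcond [RHS]big_mkcond /=.
    by apply: eq_bigr => t _; rewrite inE; case: (U c t); case: (hit q t).
  rewrite /mass !mulr_sumr; apply: ler_sum => s Qs.
  have sX : s <= X by rewrite -ltnS ltn_ord.
  have sQ : Q0 <= s <= X by rewrite Qs.
  have s0 : 0 < s <= X by rewrite sX (leq_trans Q00).
  have /andP[sAs Asp] := sA sQ.
  have := @sum_near_integral_cell m n p M (A s) s (E s) X i0 K
    (fun j i => c j i : nat) dn (sE sQ) (sL sQ) s0 (mE sQ) Mp
    (fun j i => ltn_ord (c j i)) Asp (AM sQ).
  move=> h.
  have {h} :
    ((E s ^ d * (s %/ (4 * M)) ^ n * (A s %/ s * (p %/ M) ^ m.-1) ^ n)%:R <=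
     16 * \sum_(q | shell_vector s (E s) i0 K q)
       #|[pred t | U c t && hit q t]|%:R :> F)%R.
    rewrite -natr_sum -(natrM F 16) ler_nat; apply: leq_trans h _.
    rewrite leq_mul2l /=; apply: leq_sum => q Vq.
    apply/subset_leq_card/fintype.subsetP => t; rewrite !inE.
    move=> /andP[Ut nt]; apply/andP; split; first exact: Ut.
    move: nt; rewrite /hit.
    by move/forallP: Vq => /(_ i0); rewrite eqxx => /eqP ->.
  move=> h; apply: (@le_trans _ _ (16 ^+ n * 2 ^+ (m.-1 * n) *
    (E s ^ d * (s %/ (4 * M)) ^ n * (A s %/ s * (p %/ M) ^ m.-1) ^ n)%:R))%R;
    last first.
    rewrite (mulrC 16%R) -[leRHS]mulrA; apply: ler_wpM2l; last exact: h.
    by rewrite -natrX -natrX -natrM ler0n.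
  have half (x y : nat) : 0 < y -> y <= x -> (x%:R / y%:R <=
    2 * (x %/ y)%:R :> F)%R.
    move=> y0 yx; rewrite ler_pdivrMr ?ltr0n // -!natrM ler_nat.
    have := divn_eq x y; have := ltn_pmod x y0.
    have : 0 < x %/ y by rewrite divn_gt0.
    by move: (x %/ y) (x %% y); clear; nia.
  have h1 : (p%:R / M%:R <= 2 * (p %/ M)%:R :> F)%R by exact: half.
  have h2 : ((A s)%:R / s%:R <= 2 * (A s %/ s)%:R :> F)%R.
    by apply: half; case/andP: s0.
  have h3 : (s%:R / (4 * M)%:R <= 2 * (s %/ (4 * M))%:R :> F)%R.
    apply: half; first by rewrite muln_gt0.
    have := sL sQ; case: (leqP (4 * M) s) => // /divn_small ->.
    by case/andP: s0; clear; case: (s : nat) => // k; lia.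
  have key : (p%:R ^+ m.-1 / M%:R ^+ m.-1 * ((A s)%:R / M%:R) <=
      16 * 2 ^+ m.-1 * ((s %/ (4 * M))%:R * ((A s %/ s)%:R * (p %/ M)%:R ^+
        m.-1))
      :> F)%R.
    have e1 : (p%:R ^+ m.-1 / M%:R ^+ m.-1 <=
      2 ^+ m.-1 * (p %/ M)%:R ^+ m.-1 :> F)%R.
      by rewrite -expr_div_n -exprMn lerXn2r // nnegrE ?mulr_ge0 ?divr_ge0
        ?ler0n.
    have e2 : ((A s)%:R / M%:R <=
      16 * ((s %/ (4 * M))%:R * (A s %/ s)%:R) :> F)%R.
      have -> : ((A s)%:R / M%:R = 4 * (((A s)%:R / s%:R) * (s%:R / (4 *
        M)%:R)) :> F)%R.
        rewrite natrM; field.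
        by rewrite !pnatr_eq0 -!lt0n M0; case/andP: s0 => ->.
      have := ler_pM (divr_ge0 (ler0n _ _) (ler0n _ _))
        (divr_ge0 (ler0n _ _) (ler0n _ _)) h2 h3.
      move: (_ / _ * (_ / _))%R (s %/ _)%:R%R (A s %/ _)%:R%R => x y z; lra.
    have := ler_pM
      (divr_ge0 (exprn_ge0 _ (ler0n _ _)) (exprn_ge0 _ (ler0n _ _)))
      (divr_ge0 (ler0n _ _) (ler0n _ _)) e1 e2.
    move=> /le_trans; apply; rewrite le_eqVlt; apply/orP; left; apply/eqP.
    move: (2 ^+ _)%R ((p %/ M)%:R ^+ _)%R => x y; ring.
  have -> : (p%:R ^+ (m * n) / M%:R ^+ (m * n) * ((E s ^ d * A s ^ n)%:R /
    p%:R ^+ n)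
     = (E s ^ d)%:R * (p%:R ^+ m.-1 / M%:R ^+ m.-1 * ((A s)%:R / M%:R)) ^+ n
       :> F)%R.
    rewrite !exprM -(prednK m0) /= !exprSr !exprMn natrM natrX.
    rewrite !exprVn (natrX _ (A s)); field.
    have pnz : (p%:R != 0 :> F)%R by rewrite pnatr_eq0 -lt0n.
    have Mnz : (M%:R != 0 :> F)%R by rewrite pnatr_eq0 -lt0n.
    by rewrite !expf_neq0.
  rewrite -mulnA natrM [leRHS]mulrCA ler_wpM2l ?ler0n // exprM -exprMn.
  rewrite -expnMn natrX -exprMn natrM natrM natrX; apply: lerXn2r => //.
  - by rewrite nnegrE mulr_ge0 ?divr_ge0 ?exprn_ge0 ?ler0n.
  - by rewrite nnegrE !mulr_ge0 ?exprn_ge0 ?ler0n.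
have -> : (\sum_(t | in_cells t) (hits t)%:R =
    \sum_(c | C c) \sum_(t | U c t) (hits t)%:R :> F)%R.
  rewrite (exchange_big_dep in_cells) /=; last first.
    by move=> c t Cc Ut; apply/existsP; exists c; rewrite Cc.
  apply: eq_bigr => t /existsP[c /andP[Cc Ut]].
  rewrite (big_pred1 c) // => c'; apply/idP/eqP => [/andP[_ Ut']|->];
    last first.
    by rewrite Cc.
  apply/ffunP => j; move/forallP: Ut' => /(_ j)/in_cell_inj; apply.
  by move/forallP: Ut.
have -> : (#|C|%:R = \sum_(c | C c) 1 :> F)%R.
  by rewrite -sum1_card natr_sum; exact: eq_bigl.
move: mass cell => ms cell; rewrite !mulr_suml mulr_sumr.
by apply: ler_sum => c _; rewrite mul1r; exact: cell.
Qed.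

(** Second moment method. With [1 <= mass] the linear term of the second moment is absorbed by the
    quadratic one, so the mass cancels and the constant depends on [m] and [n] only. The second
    moment is taken over the whole grid and not over the cover, whence the square of the density. *)
Lemma card_hit_ge : (1 <= mass)%R ->
  ((#|C|%:R / M%:R ^+ (m * n)) ^+ 2 * p%:R ^+ (m * n) <=
   (16 * (16 ^+ n * 2 ^+ (m.-1 * n))) ^+ 2 * (2 ^+ n + 6 ^+ n) *
   #|[pred t | in_cells t && (0 < hits t)%N]|%:R :> F)%R.
Proof.
move: mass sum_hits_cells_ge sum_hits_sqr_le => ms cells_ge sqr_le mass1.
set W := (16 * (16 ^+ n * 2 ^+ (m.-1 * n)) : F)%R.
set P := (p%:R ^+ (m * n))%R.
set dens := (#|C|%:R / M%:R ^+ (m * n))%R.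
have W0 : (0 < W)%R by rewrite !mulr_gt0 ?exprn_gt0.
have P0 : (0 < P)%R by rewrite exprn_gt0 // ltr0n.
have k0 : (0 < 2 ^+ n + 6 ^+ n :> F)%R by rewrite addr_gt0 ?exprn_gt0.
have dens0 : (0 <= dens)%R by rewrite divr_ge0 ?exprn_ge0 ?ler0n.
set H := (#|_|%:R)%R.
pose a := (dens * P * ms)%R.
pose b := (P * (2 ^+ n + 6 ^+ n) * ms ^+ 2)%R.
have ms0 : (0 < ms)%R by exact: lt_le_trans ltr01 mass1.
have b0 : (0 < b)%R.
  by apply: mulr_gt0; [exact: mulr_gt0|exact: exprn_gt0].
have first : (a <= W * \sum_(t | in_cells t) (hits t)%:R)%R.
  by apply: le_trans cells_ge; rewrite /a /dens (mulrAC #|C|%:R).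
have second : (\sum_(t | in_cells t) (hits t)%:R ^+ 2 <= b :> F)%R.
  apply: (@le_trans _ _ (\sum_t (hits t)%:R ^+ 2)%R).
    rewrite big_mkcond; apply: ler_sum => t _.
    by case: ifP => _; [exact: lexx|exact: sqr_ge0].
  apply: le_trans sqr_le _; rewrite /b -mulrA ler_wpM2l ?(ltW P0) //.
  rewrite mulrDl lerD2r ler_wpM2l ?exprn_ge0 // expr2 ler_peMr //.
  exact: le_trans ler01 mass1.
have a0 : (0 <= a)%R.
  by apply: mulr_ge0 (ltW ms0); apply: mulr_ge0 (ltW P0).
(* Cauchy-Schwarz, in the form [2 x y N <= x^2 1_(N > 0) + y^2 N^2]. *)
have : (\sum_(t | in_cells t) (2 * (a * (W * b)) * (hits t)%:R) <=
    \sum_(t | in_cells t) ((W * b) ^+ 2 * (0 < hits t)%N%:R +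
       a ^+ 2 * (hits t)%:R ^+ 2) :> F)%R.
  apply: ler_sum => t _; case: (hits t) => [|h];
    first by rewrite !mulr0 expr0n mulr0 addr0.
  rewrite mulr1; have := sqr_ge0 (W * b - a * h.+1%:R)%R.
  by move: (W * b)%R (h.+1%:R)%R => x y; lra.
rewrite -mulr_sumr big_split /= -!mulr_sumr.
have -> : (\sum_(t | in_cells t) (0 < hits t)%N%:R = H :> F)%R.
  rewrite /H -sum1_card natr_sum big_mkcond [RHS]big_mkcond /=.
  by apply: eq_bigr => t _; rewrite inE; case: in_cells; case: (0 < _)%N.
move=> le.
have lo : (2 * (a * b) * a <= 2 * (a * (W * b)) *
    \sum_(t | in_cells t) (hits t)%:R)%R.
  have ab0 : (0 <= 2 * (a * b))%R.
    by apply: mulr_ge0 => //; apply: mulr_ge0 (ltW b0).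
  apply: le_trans (ler_wpM2l ab0 first) _.
  rewrite le_eqVlt; apply/orP; left; apply/eqP.
  by move: (\sum_(t | _) _)%R => z; ring.
have hi : (a ^+ 2 * \sum_(t | in_cells t) (hits t)%:R ^+ 2 <= a ^+ 2 * b)%R.
  by rewrite ler_wpM2l // sqr_ge0.
have ab : (a ^+ 2 <= W ^+ 2 * b * H)%R.
  rewrite -(ler_pM2l b0).
  move: le lo hi; move: (\sum_(t | _) (hits t)%:R ^+ 2)%R => z.
  move: (\sum_(t | _) (hits t)%:R)%R => z'.
  move=> h1 h2 h3; have := le_trans h2 (le_trans h1 (lerD (lexx _) h3)).
  lra.
have m2 : (0 < P * ms ^+ 2)%R by apply: mulr_gt0 P0 _; exact: exprn_gt0.
rewrite -(ler_pM2l m2); move: ab; rewrite /a /b.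
by rewrite !exprMn; move: (2 ^+ n + 6 ^+ n)%R => z h; lra.
Qed.

End second_moment.

(** * Improving a cover *)

Section refinement.
Context (R : realType) (m n : nat).
Implicit Types (M p : nat).

(** Column index first: the [n] columns meet separate conditions, so the counts are [n]-fold
    products. *)
Definition grid M := {ffun 'I_n -> {ffun 'I_m -> 'I_M}}.

Definition grid_cell M (c : grid M) : set 'M[R]_(m, n) :=
  [set Z | forall i j, (c j i)%:R <= Z i j * M%:R <= (c j i).+1%:R].

Definition covers (F : set 'M[R]_(m, n)) M (C : pred (grid M)) :=
  forall Z, F Z -> exists2 c, C c & grid_cell c Z.

Definition density M (C : pred (grid M)) : R := #|C|%:R / M%:R ^+ (m * n).

Definition touches M p (c : grid M) (t : grid p) : bool :=
  [forall j, [forall i, ((c j i * p <= (t j i).+1 * M) &&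
                         (t j i * M <= (c j i).+1 * p))%N]].

(** In one coordinate, [t.+1] runs from the ceiling u of cp/M to at most u + p/M + 1. The excess
    over p/M comes from cells at the boundary; it costs a factor at most (1 + 2M/p)^(mn), which
    tends to 1 as p grows. *)
Lemma card_touches M p (c : grid M) : (0 < M)%N ->
  (#|[pred t : grid p | touches c t]| <= (p %/ M + 2) ^ (m * n))%N.
Proof.
move=> M0.
pose F j i := [pred t : 'I_p | ((c j i * p <= t.+1 * M) &&
                         (t * M <= (c j i).+1 * p))%N].
have cF j i : (#|F j i| <= p %/ M + 2)%N.
  pose u := ceil_div (c j i * p) M; have /andP[ulo uhi] :=
    ceil_divP (c j i * p) M0.
  rewrite -[leqRHS]card_ord addn2.
  pose f (t : 'I_p) : 'I_(p %/ M).+2 := inord (t.+1 - u).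
  have lo (t : 'I_p) : F j i t -> (u <= t.+1)%N.
    move=> /andP[h _]; rewrite -ltnS -(ltn_pmul2r M0).
    by apply: leq_trans uhi _; rewrite [leqRHS]mulSn addnC leq_add2l.
  have hi (t : 'I_p) : F j i t -> (t.+1 - u < (p %/ M).+2)%N.
    move=> Ft; have lt := lo _ Ft; move: Ft => /andP[_ h].
    suff : ((t.+1 - u).-1 <= p %/ M)%N by case: (_ - _)%N.
    rewrite leq_divRL // -subn1 mulnBl mulnBl mul1n.
    move: h ulo; rewrite !mulSn; clear; lia.
  apply: (@leq_card_inj _ _ f (mem (F j i)) predT) => // t t'.
  move=> /= Ft Ft' /(congr1 val); rewrite /= !inordK ?hi // => e.
  apply: val_inj; apply: succn_inj.
  by rewrite -(subnK (lo _ Ft)) e subnK ?lo.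
have -> : ((p %/ M + 2) ^ (m * n) =
    \prod_(j < n) \prod_(i < m) (p %/ M + 2))%N.
  by rewrite !prod_nat_const !card_ord expnM.
apply: leq_trans (_ : (\prod_(j < n) \prod_(i < m) #|F j i| <= _)%N);
  last first.
  by apply: leq_prod => j _; apply: leq_prod => i _.
rewrite (eq_bigr (fun j => #|[pred t : {ffun 'I_m -> 'I_p} |
    [forall i, F j i (t i)]]|)); last by move=> j _;
      rewrite (card_forall_family (F j)).
rewrite -(card_forall_family (fun j => [pred t : {ffun 'I_m -> 'I_p} |
    [forall i, F j i (t i)]])).
exact: leqnn.
Qed.

(** By convexity the power lies below its chord on [0, 1]. *)
Lemma one_add_expr_le (x : R) N : 0 <= x <= 1 ->
  (1 + x) ^+ N <= 1 + (2 ^+ N - 1) * x.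
Proof.
move=> /andP[x0 x1]; elim: N => [|N IH];
  first by rewrite !expr0 subrr mul0r addr0.
rewrite exprSr; have h : 0 <= 1 + x by lra.
apply: le_trans (ler_wpM2r h IH) _; rewrite exprS.
have : 1 <= 2 ^+ N :> R by rewrite exprn_ege1 // ler1n.
move: (2 ^+ N) => y y1; have : 0 <= (y - 1) * (x * (1 - x)).
  by rewrite !mulr_ge0 // subr_ge0.
lra.
Qed.

Definition unit_cube : set 'M[R]_(m, n) :=
  [set Z | forall i j, 0 <= Z i j <= 1].

(** The minimum with [p.-1] sends an entry equal to 1 to the last closed cell. *)
Definition grid_floor p (p0 : (0 < p)%N) (Z : 'M[R]_(m, n)) : grid p :=
  [ffun j => [ffun i => insubd (Ordinal p0)
     (minn (Num.truncn (Z i j * p%:R)) p.-1)]].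

Lemma grid_floorP p (p0 : (0 < p)%N) Z : unit_cube Z ->
  grid_cell (grid_floor p0 Z) Z.
Proof.
move=> Z01 i j; rewrite !ffunE val_insubd.
have pp : (p.-1 < p)%N by rewrite prednK.
have -> : (minn (Num.truncn (Z i j * p%:R)) p.-1 < p)%N.
  by apply: leq_ltn_trans pp; exact: geq_minr.
have /andP[z0 z1] := Z01 i j.
have zp : 0 <= Z i j * p%:R by rewrite mulr_ge0.
have /andP[t1 t2] := truncn_itv zp.
have zle : Z i j * p%:R <= p%:R by rewrite ler_piMl.
rewrite /minn; case: ltnP => h; first by rewrite t1 ltW.
rewrite prednK // zle andbT; apply: le_trans t1; rewrite ler_nat.
exact: h.
Qed.

(* The rows of [Z] in [K] are those of X'; the other rows are irrelevant. The
   row [i0] is multiplied by the distinguished entry [s = q i0]. *)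
Definition misses (K : pred 'I_m) (i0 : 'I_m) (E0 : nat) (psi : nat -> R)
    (Q0 : nat) : set 'M[R]_(m, n) :=
  [set Z | unit_cube Z /\
    forall (q : 'I_m -> nat) (Q : 'I_n -> nat), (Q0 <= q i0)%N ->
      (forall i, i != i0 -> if K i then (q i * E0 <= q i0)%N else q i == 0%N) ->
      exists j, psi (q i0) <= `|\sum_i (q i)%:R * Z i j - (Q j)%:R| ].

Variables (K : pred 'I_m) (i0 : 'I_m) (E0 : nat) (psi : nat -> R) (Q0 : nat).
Let F := misses K i0 E0 psi Q0.
Let d := #|[pred i | K i && (i != i0)]|.

(** A hit at the corner t/p persists on the cell: moving inside it changes each form by at most
    mX/p, and A(s) + mX < psi(s) p leaves room for this. *)
Lemma misses_not_hit p X Q1 (A : nat -> nat) Z (t : grid p) :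
  (0 < p)%N -> (Q0 <= Q1)%N ->
  (forall s, (Q1 <= s <= X)%N -> (A s + m * X)%:R < psi s * p%:R) ->
  F Z -> grid_cell t Z -> hits Q1 X i0 K A (fun s => s %/ E0)%N t = 0%N.
Proof.
move=> p0 Q01 Apsi [_ FZ] tZ; apply/eqP; rewrite sum_nat_eq0.
apply/forallP => q; apply/implyP => /andP[Qq /forallP qV].
rewrite eqb0; apply/negP => /andP[/forallP qA _].
have qX i : (q i <= X)%N by rewrite -ltnS ltn_ord.
have := FZ (fun i => q i : nat) (fun j => dotn (fun i =>
  q i : nat) (t j) %/ p)%N.
move=> /(_ (leq_trans Q01 Qq)) []; last first.
  move=> j; set y := (_ %/ _)%N; apply/negP; rewrite -ltNge.
  have p0R : (0 < p%:R :> R) by rewrite ltr0n.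
  rewrite -(ltr_pM2r p0R) -[X in `|_| * X]gtr0_norm // -normrM mulrBl.
  apply: le_lt_trans (Apsi _ _); last by rewrite Qq qX.
  have -> : (\sum_i (q i)%:R * Z i j) * p%:R - y%:R * p%:R =
      (dotn (fun i => q i : nat) (t j) %% p)%:R +
      \sum_i (q i)%:R * (Z i j * p%:R - (t j i)%:R) :> R.
    rewrite -natrM; under [in RHS]eq_bigr do rewrite mulrBr mulrA.
    rewrite sumrB -mulr_suml.
    have -> : \sum_i (q i)%:R * (t j i)%:R =
        (dotn (fun i => q i : nat) (t j))%:R :> R.
      by rewrite /dotn natr_sum; apply: eq_bigr => i _; rewrite natrM.
    rewrite [in RHS](divn_eq (dotn _ (t j)) p) natrD -/y.
    by rewrite modnMDl modn_mod; ring.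
  have s0 i : 0 <= (q i)%:R * (Z i j * p%:R - (t j i)%:R) <= X%:R.
    have /andP[z1 z2] := tZ i j; rewrite mulr_ge0 ?subr_ge0 //=.
    rewrite -[leRHS]mulr1 ler_pM ?subr_ge0 ?ler_nat //.
    by rewrite lerBlDr nat1r.
  rewrite ger0_norm; last first.
    by rewrite addr_ge0 //; apply: sumr_ge0 => i _; case/andP: (s0 i).
  rewrite natrD lerD //; first by rewrite ler_nat; exact: qA.
  have -> : (m * X)%:R = \sum_(i < m) X%:R :> R.
    by rewrite sumr_const card_ord natrM mulr_natl.
  by apply: ler_sum => i _; case/andP: (s0 i).
move=> i ii0; have := qV i; rewrite (negPf ii0); case: (K i) => h.
  apply: leq_trans (leq_trunc_div (q i0) E0); rewrite leq_mul2r ltnW ?orbT //.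
by move: h; rewrite ltnS leqn0.
Qed.

Definition refined M p X Q1 (A : nat ->
  nat) (C : pred (grid M)) : pred (grid p) :=
  [pred t | [exists c, C c && touches c t] &&
    ~~ (in_cells C t &&
        (0 < hits Q1 X i0 K A (fun s => s %/ E0) t)%N)].

Lemma covers_refined M p X Q1 (A : nat -> nat) (C : pred (grid M)) :
  (0 < p)%N -> (0 < M)%N -> (Q0 <= Q1)%N ->
  (forall s, (Q1 <= s <= X)%N -> (A s + m * X)%:R < psi s * p%:R) ->
  covers F C -> covers F (refined (p := p) X Q1 A C).
Proof.
move=> p0 M0 Q01 Apsi cov Z FZ; have Z01 : unit_cube Z by case: FZ.
have gZ := grid_floorP p0 Z01; exists (grid_floor p0 Z) => //.
rewrite /refined /= (misses_not_hit p0 Q01 Apsi FZ gZ) ltnn andbF andbT.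
have [c Cc cZ] := cov _ FZ; apply/existsP; exists c; rewrite Cc /=.
apply/forallP => j; apply/forallP => i.
have /andP[a1 a2] := gZ i j; have /andP[b1 b2] := cZ i j.
rewrite -!(ler_nat R) !natrM; apply/andP; split.
  apply: le_trans (ler_wpM2r (ler0n _ p) b1) _.
  by rewrite mulrAC ler_wpM2r.
apply: le_trans (ler_wpM2r (ler0n _ M) a1) _.
by rewrite mulrAC ler_wpM2r.
Qed.

Lemma card_refined M p X Q1 (A : nat -> nat) (C : pred (grid M)) :
  (0 < M)%N ->
  (#|refined (p := p) X Q1 A C| + #|[pred t : grid p | in_cells C t &&
     (0 < hits Q1 X i0 K A (fun s => s %/ E0) t)%N]|
   <= #|C| * (p %/ M + 2) ^ (m * n))%N.
Proof.
move=> M0; set H := [pred t : grid p | in_cells C t && _]; rewrite -cardUI.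
rewrite [X in (_ + X)%N]eq_card0 ?addn0; last first.
  move=> t; apply/negP => /andP[/andP[_ nH] Ht].
  by move: nH; apply/negP/negPn; exact: Ht.
apply: leq_trans
  (_ : (\sum_(c | C c) #|[pred t : grid p | touches c t]| <= _)%N).
  rewrite -sum1_card.
  under [leqRHS]eq_bigr do rewrite -sum1_card big_mkcond.
  rewrite exchange_big /= [leqLHS]big_mkcond; apply: leq_sum => t _.
  case: ifP => // Ut.
  have /existsP[c /andP[Cc ct]] : [exists c, C c && touches c t].
    case/orP: Ut => [/andP[] //|/andP[/existsP[c /andP[Cc /forallP ct]] _]].
    apply/existsP; exists c; rewrite Cc; apply/forallP => j; apply/forallP => i.
    have /forallP/(_ i)/andP[lo hi] := ct j; rewrite (ltnW hi) andbT.
    by apply: leq_trans lo _; rewrite leq_mul2r leqnSn orbT.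
  by rewrite (bigD1 c) //= inE ct.
apply: leq_trans (_ : (\sum_(c | C c) (p %/ M + 2) ^ (m * n) <= _)%N).
  by apply: leq_sum => c _; exact: card_touches.
by rewrite sum_nat_const.
Qed.

End refinement.

(** * The infimum of the densities is 0 *)

Section content_of_misses.
Context (R : realType) (m n : nat).

(** With a = s %/ k one has s <= 2ak, hence s^2 <= 4 k^2 a^2; and 448 = 4 * 112. *)
Lemma divn_sqr_ge k s : (0 < k)%N -> (448 * k ^ 2 <= s)%N ->
  (112 * s <= (s %/ k) ^ 2)%N.
Proof.
move=> k0 ks; set a := (s %/ k)%N.
have a1 : (1 <= a)%N.
  rewrite divn_gt0 //; apply: leq_trans ks; rewrite -mulnn mulnA leq_pmull //.
  by rewrite muln_gt0.
have sa : (s <= 2 * (a * k))%N.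
  have /ltnW := ltn_ceil s k0; rewrite -/a mulSn => /leq_trans; apply.
  by rewrite mul2n -addnn leq_add2r leq_pmull.
have k4 : (0 < 4 * k ^ 2)%N by rewrite muln_gt0 expn_gt0 k0.
rewrite -(leq_pmul2l k4).
apply: leq_trans (_ : (s * s <= _)%N).
  apply: leq_trans (leq_mul ks (leqnn s)).
  by rewrite leq_eqVlt; apply/orP; left; apply/eqP; clear; ring.
apply: leq_trans (leq_mul sa sa) _.
by rewrite leq_eqVlt; apply/orP; left; apply/eqP; clear; ring.
Qed.

Lemma density_le1 M (C : pred (grid m n M)) : (0 < M)%N -> density R C <= 1.
Proof.
move=> M0; rewrite /density ler_pdivrMr ?exprn_gt0 ?ltr0n // mul1r.
rewrite -natrX ler_nat.
by apply: leq_trans (max_card _) _; rewrite !card_ffun !card_ord expnM.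
Qed.

Lemma density_ge0 M (C : pred (grid m n M)) : 0 <= density R C.
Proof. by rewrite divr_ge0 ?exprn_ge0. Qed.

Variables (K : pred 'I_m) (i0 : 'I_m) (E0 : nat) (psi : nat -> R) (Q0 : nat).
Let F := @misses R m n K i0 E0 psi Q0.
Let d := #|[pred i | K i && (i != i0)]|.

(** The reciprocal of the constant in [card_hit_ge]. It does not depend on the cover, so the
    refinements never lose strength. *)
Definition gain : R :=
  ((16 * (16 ^+ n * 2 ^+ (m.-1 * n))) ^+ 2 * (2 ^+ n + 6 ^+ n))^-1.

Lemma gain_gt0 : 0 < gain.
Proof.
by rewrite invr_gt0 mulr_gt0 ?exprn_gt0 ?addr_gt0 ?mulr_gt0 ?exprn_gt0.
Qed.

Hypothesis E0_ge : (4 * m <= E0)%N.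
Hypothesis dn : (1 < d + n)%N.
Hypothesis psi_gt0 : forall r, (1 <= r)%N -> 0 < psi r.
Hypothesis psi_le1 : exists Q, forall s, (Q <= s)%N -> psi s <= 1.
Hypothesis psi_div : forall (x : R) Q, (0 < Q)%N -> exists X,
  x <= \sum_(s < X.+1 | (Q <= s)%N) ((s %/ E0)%:R ^+ d * psi s ^+ n).

(** The order of the choices matters: [Q1] is large in terms of [M], then [X] provides mass in the
    range from [Q1] to [X], and [p] is large in terms of all of these and of [eta]. *)
Lemma refine_cover M (C : pred (grid m n M)) (eta : R) :
  (0 < M)%N -> 0 < eta -> covers F C ->
  exists p (C' : pred (grid m n p)), [/\ (0 < p)%N, covers F C' &
    density R C' <= density R C + eta - gain * density R C ^+ 2].
Proof.
move=> M0 eta0 cov; have [Qpsi psi1] := psi_le1.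
have E00 : (0 < E0)%N.
  apply: leq_trans E0_ge; rewrite muln_gt0 /=.
  exact: leq_ltn_trans (leq0n i0) (ltn_ord i0).
(* The summands serve, in this order, the definition of [misses], [psi s <= 1], the bounds [sE],
   [sL] and [AM] below, and positivity. *)
pose Q1 := (Q0 + Qpsi + 448 * E0 ^ 2 + 448 * (4 * M) ^ 2 + 2 * M + 1)%N.
have Q1_gt0 : (0 < Q1)%N by rewrite /Q1 addn1.
have Q1_Q0 : (Q0 <= Q1)%N by rewrite /Q1; clear; lia.
have Q1_psi : (Qpsi <= Q1)%N by rewrite /Q1; clear; lia.
have Q1_E0 : (448 * E0 ^ 2 <= Q1)%N by rewrite /Q1; clear; lia.
have Q1_4M : (448 * (4 * M) ^ 2 <= Q1)%N by rewrite /Q1; clear; lia.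
have Q1_2M : (2 * M <= Q1)%N by rewrite /Q1; clear; lia.
move: Q1 Q1_gt0 Q1_Q0 Q1_psi Q1_E0 Q1_4M Q1_2M
  => Q1 Q1_gt0 Q1_Q0 Q1_psi Q1_E0 Q1_4M Q1_2M.
(* The factor 4^n makes up for the inequality A(s) >= psi(s) p / 4, which is all that remains after
   halving and truncation. *)
have [X massX] := psi_div (4 ^+ n) Q1_gt0.
pose b s : R := 8 * (s + 1 + m * X)%:R / psi s.
(* [N1] makes the truncation and the displacement mX small against psi(s) p for all s in the range;
   [N2] makes the growth caused by boundary cells at most [eta]. *)
pose N1 := (\sum_(s < X.+1) (Num.truncn (b s)).+1)%N.
pose N2 := (Num.truncn (2 ^+ (m * n) * (2 * M)%:R / eta)).+1.
have [p pN pp] := prime_above (X * X + M + 2 * M + N1 + N2).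
have p0 : (0 < p)%N := prime_gt0 pp.
have p0R : 0 < p%:R :> R by rewrite ltr0n.
have pM : (M <= p)%N by move: pN; clear; lia.
have Xp : (X * X < p)%N by move: pN; clear; lia.
have p2M : (2 * M <= p)%N by move: pN; clear; lia.
have big s : (Q1 <= s <= X)%N -> 8 * (s + 1 + m * X)%:R <= psi s * p%:R.
  move=> /andP[Qs sX]; have ps : 0 < psi s by apply: psi_gt0;
    apply: leq_trans Qs.
  rewrite [leRHS]mulrC -ler_pdivrMr //; apply: le_trans (ltW (truncnS_gt _)) _.
  rewrite ler_nat; apply: leq_trans (ltnW pN).
  apply: leq_trans (_ : (N1 <= _)%N); last by clear; lia.
  by rewrite /N1 (bigD1 (Ordinal (sX : (s < X.+1)%N))) //= leq_addr.
pose A s := Num.truncn (psi s * p%:R / 2).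
have AP s : (Q1 <= s <= X)%N -> (A s)%:R <= psi s * p%:R / 2 < (A s).+1%:R.
  move=> sQ; apply: truncn_itv; rewrite divr_ge0 //.
  by apply: le_trans (big _ sQ); rewrite mulr_ge0.
have psi1' s : (Q1 <= s <= X)%N -> psi s <= 1.
  by move=> /andP[Qs _]; apply: psi1; apply: leq_trans Qs.
have sA s : (Q1 <= s <= X)%N -> (s <= A s < p)%N.
  move=> sQ; have /andP[A1 A2] := AP _ sQ; have b1 := big _ sQ.
  have := psi1' _ sQ => p1; apply/andP; split.
    rewrite -ltnS -(ltr_nat R); apply: le_lt_trans A2.
    rewrite ler_pdivlMr // -natrM; apply: le_trans b1; rewrite -natrM ler_nat.
    by clear; lia.
  rewrite -(ltr_nat R); apply: le_lt_trans A1 _.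
  have : psi s * p%:R <= 1 * p%:R by rewrite ler_wpM2r.
  by move: (psi s * _) p0R => x; lra.
have AM s : (Q1 <= s <= X)%N -> (4 * A s * M <= p * s)%N.
  move=> sQ; have /andP[A1 _] := AP _ sQ; have p1 := psi1' _ sQ.
  have /andP[Qs _] := sQ; have A2 : (2 * A s <= p)%N.
    rewrite -(ler_nat R) natrM.
    have : psi s * p%:R <= 1 * p%:R by rewrite ler_wpM2r.
    by move: (psi s * _) A1 => x; lra.
  apply: leq_trans (_ : (p * (2 * M) <= _)%N).
    by rewrite (_ : (4 * A s * M = 2 * A s * (2 * M))%N) ?leq_mul2r ?A2 ?orbT
      //; ring.
  by rewrite leq_mul2l (leq_trans Q1_2M Qs) orbT.
have Apsi s : (Q1 <= s <= X)%N -> (A s + m * X)%:R < psi s * p%:R.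
  move=> sQ; have /andP[A1 _] := AP _ sQ; have := big _ sQ.
  rewrite !natrD; have : 0 <= s%:R :> R by [].
  by have : 0 <= (m * X)%:R :> R by []; move: (psi s * _) A1 => x; lra.
have mass1 : 1 <= mass n p Q1 X i0 K A (fun s => s %/ E0)%N R.
  have four : 0 < 4 ^+ n :> R by rewrite exprn_gt0.
  rewrite -(ler_pM2l four) mulr1; apply: le_trans massX _.
  rewrite /mass mulr_sumr; apply: ler_sum => s Qs.
  have sQ : (Q1 <= s <= X)%N by rewrite Qs -ltnS ltn_ord.
  rewrite natrM !natrX mulrCA -mulrA ler_wpM2l ?exprn_ge0 //.
  rewrite -expr_div_n -exprMn lerXn2r ?nnegrE ?mulr_ge0 ?divr_ge0 //.
    by rewrite ltW // psi_gt0 // (leq_trans Q1_gt0).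
  rewrite mulrA ler_pdivlMr //; have /andP[_ A2] := AP _ sQ; have := big _ sQ.
  rewrite -[X in _ < X]natr1 in A2; rewrite !natrD; have : 0 <= s%:R :> R by [].
  by have : 0 <= (m * X)%:R :> R by []; move: (psi s * _) A2 => x; lra.
exists p, (refined K i0 E0 (p := p) X Q1 A C); split => //.
  exact: covers_refined.
have hitge := @card_hit_ge m n p M Q1 X i0 K A (fun s => s %/ E0)%N R pp Xp.
have Mp : (0 < M <= p)%N by rewrite M0.
have sE s : (Q1 <= s <= X)%N -> (112 * s <= (s %/ E0) ^ 2)%N.
  by move=> /andP[Qs _]; apply: divn_sqr_ge => //; apply: leq_trans Qs.
have mE s : (Q1 <= s <= X)%N -> (4 * (m * (s %/ E0)) <= s)%N.
  move=> _; rewrite mulnA; apply: leq_trans (leq_mul E0_ge (leqnn _)) _.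
  by rewrite mulnC leq_trunc_div.
have sL s : (Q1 <= s <= X)%N -> (112 * s <= (s %/ (4 * M)) ^ 2)%N.
  move=> /andP[Qs _]; apply: divn_sqr_ge; last exact: leq_trans Qs.
  by rewrite muln_gt0.
have {}hitge := hitge Mp Q1_gt0 dn sE mE sL sA AM C mass1.
have cardge := card_refined K i0 E0 p X Q1 A C M0.
rewrite {1}/density; set C' := refined _ _ _ _ _ _ _ in cardge *.
set H := #|[pred t : grid m n p | _]| in hitge cardge.
have P0 : 0 < p%:R ^+ (m * n) :> R by rewrite exprn_gt0.
have MN0 : 0 < M%:R ^+ (m * n) :> R by rewrite exprn_gt0 // ltr0n.
rewrite ler_pdivrMr //.
have {}hitge : gain * density R C ^+ 2 * p%:R ^+ (m * n) <= H%:R.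
  rewrite -mulrA /gain mulrC ler_pdivrMr; first by rewrite [leRHS]mulrC;
    exact: hitge.
  by rewrite mulr_gt0 ?exprn_gt0 ?addr_gt0 ?mulr_gt0 ?exprn_gt0.
have grow : (#|C| * (p %/ M + 2) ^ (m * n))%:R <=
    (density R C + eta) * p%:R ^+ (m * n).
  pose x : R := (2 * M)%:R / p%:R.
  have x0 : 0 <= x by rewrite divr_ge0.
  have x1 : x <= 1 by rewrite ler_pdivrMr // mul1r ler_nat.
  have xeta : (2 ^+ (m * n)) * x <= eta.
    rewrite /x mulrA ler_pdivrMr // [leRHS]mulrC -ler_pdivrMr //.
    apply: le_trans (ltW (truncnS_gt _)) _; rewrite ler_nat.
    apply: leq_trans (ltnW pN); apply: leq_trans (_ : (N2 <= _)%N) => //.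
    by clear; lia.
  have fl : (p %/ M + 2)%:R <= p%:R / M%:R * (1 + x).
    rewrite natrD mulrDr mulr1 lerD //.
      by rewrite ler_pdivlMr ?ltr0n // -natrM ler_nat leq_trunc_div.
    rewrite /x natrM le_eqVlt; apply/orP; left; apply/eqP; field.
    by rewrite !pnatr_eq0 -!lt0n M0 p0.
  rewrite natrM natrX.
  apply: (@le_trans _ _ (#|C|%:R * ((p%:R / M%:R) ^+ (m * n) * (1 + (2 ^+ (m *
    n) - 1) * x)))).
    rewrite ler_wpM2l //.
    apply: (@le_trans _ _ ((p%:R / M%:R * (1 + x)) ^+ (m * n))).
      by rewrite lerXn2r // nnegrE ?mulr_ge0 ?divr_ge0 ?addr_ge0.
    rewrite exprMn ler_wpM2l ?exprn_ge0 ?divr_ge0 //.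
    by apply: one_add_expr_le; rewrite x0.
  have -> : #|C|%:R *
      ((p%:R / M%:R) ^+ (m * n) * (1 + (2 ^+ (m * n) - 1) * x)) =
      density R C * (1 + (2 ^+ (m * n) - 1) * x) * p%:R ^+ (m * n).
    by rewrite /density expr_div_n; move: (_ ^- _) => y; ring.
  rewrite ler_pM2r // mulrDr mulr1 lerD2l.
  apply: le_trans xeta; rewrite mulrA; apply: ler_wpM2r => //.
  have d1 := density_le1 C M0; have d0 := density_ge0 C.
  have : 1 <= 2 ^+ (m * n) :> R by rewrite exprn_ege1 // ler1n.
  by move: (2 ^+ _) => y; nra.
rewrite mulrBl; move: cardge; rewrite -(ler_nat R) natrD => cardge.
have := le_trans cardge grow; move: hitge; lra.
Qed.

(** No sequence of refinements is built: were the infimum positive, one refinement of a cover with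
    density close to it would fall below it. *)
Lemma covers_arbitrarily_small (eps : R) : 0 < eps ->
  exists M (C : pred (grid m n M)),
    [/\ (0 < M)%N, covers F C & density R C <= eps].
Proof.
move=> eps0.
pose D := [set x : R | exists M (C : pred (grid m n M)),
  [/\ (0 < M)%N, covers F C & x = density R C]].
have Dlb : lbound D 0.
  by move=> _ [M [C [M0 cov ->]]]; exact: density_ge0.
have Dne : D !=set0.
  exists (density R (predT : pred (grid m n 1))), 1%N, predT; split=> //.
  move=> Z [Z01 _]; exists (grid_floor (ltn0Sn 0) Z) => //.
  exact: grid_floorP.
have hinf : has_inf D by split => //; exists 0.
have inf0 : 0 <= inf D by apply: lb_le_inf.
have step x eta : D x -> 0 < eta -> inf D <= x + eta - gain * x ^+ 2.
  move=> [M [C [M0 cov ->]]] eta0.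
  have [p [C' [p0 cov' le]]] := refine_cover M0 eta0 cov.
  apply: le_trans le; apply: ge_inf; first by exists 0.
  by exists p, C'.
have infE : inf D = 0.
  apply/eqP; rewrite eq_le inf0 andbT leNgt; apply/negP => pos.
  (* With x < inf + [eta], the refined density is at most x + [eta] - 4 [eta] < inf - 2 [eta]. *)
  have k0 := gain_gt0; pose eta := gain * inf D ^+ 2 / 4.
  have eta0 : 0 < eta by rewrite divr_gt0 // mulr_gt0 // exprn_gt0.
  have [x Dx xlt] := inf_adherent eta0 hinf.
  have xge : inf D <= x by apply: ge_inf => //; exists 0.
  have := step _ _ Dx eta0.
  have : gain * inf D ^+ 2 <= gain * x ^+ 2.
    by rewrite ler_pM2l // lerXn2r ?nnegrE // (le_trans inf0).
  by move: eta0 xlt; rewrite /eta; lra.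
have [x [M [C [M0 cov ->]]] lt] := inf_adherent eps0 hinf.
by exists M, C; split => //; move: lt; rewrite infE add0r => /ltW.
Qed.

End content_of_misses.

(** * Jordan content and Lebesgue measure *)

Section null_content.
Context (R : realType) (m n : nat).
Implicit Types (A : set 'M[R]_(m, n)) (M : nat) (c : 'M[int]_(m, n)).

(** Unlike in [grid], the indices are integers, since the images under the charts leave the unit
    cube. *)
Definition int_cell M c : set 'M[R]_(m, n) :=
  [set Z | forall i j, (c i j)%:~R <= Z i j * M%:R <= (c i j + 1)%:~R].

Definition null_content A := forall eps : R, 0 < eps ->
  exists M (s : seq 'M[int]_(m, n)), [/\ (0 < M)%N,
    forall Z, A Z -> exists2 c, c \in s & int_cell M c Z &
    (size s)%:R <= eps * M%:R ^+ (m * n)].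

(** The part of A in a cell of mesh 1/M has an image within L/M of the image of one sample point, so
    (2L+2)^(mn) cells of the same mesh cover it. *)
Lemma null_content_lipschitz A (G : 'M[R]_(m, n) -> 'M[R]_(m, n)) (L : nat) :
  (forall Z Z' e, A Z -> A Z' -> (forall i j, `|Z i j - Z' i j| <= e) ->
     forall i j, `|G Z i j - G Z' i j| <= L%:R * e) ->
  null_content A -> null_content (G @` A).
Proof.
move=> lip nA eps e0.
pose k := ((2 * L).+2 ^ (m * n))%N.
have k0 : 0 < k%:R :> R by rewrite ltr0n expn_gt0.
have [M [s [M0 cov sz]]] := nA _ (divr_gt0 e0 k0).
have M0R : 0 < M%:R :> R by rewrite ltr0n.
pose base c : 'M[int]_(m, n) :=
  if pselect (exists Z, A Z /\ int_cell M c Z) is left h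
  then map_mx (fun x => Num.floor (x * M%:R)) (G (projT1 (cid h))) else 0.
pose shift (b : 'M[int]_(m, n)) (o : 'M['I_(2 * L).+2]_(m, n)) :
    'M[int]_(m, n) :=
  \matrix_(i, j) (b i j + (o i j)%:Z - L%:Z).
exists M, [seq shift (base c) o | c <- s,
  o <- enum {: 'M['I_(2 * L).+2]_(m, n)}].
split => //; last first.
  rewrite size_allpairs -cardE card_mx card_ord natrM.
  by rewrite -ler_pdivlMr // mulrAC.
move=> _ [Z AZ <-]; have [c cs cZ] := cov _ AZ.
have [Z0 [AZ0 [cZ0 bE]]] : exists Z0, A Z0 /\ (int_cell M c Z0 /\
    base c = map_mx (fun x => Num.floor (x * M%:R)) (G Z0)).
  rewrite /base; case: pselect => [h|noh]; last first.
    by case: noh; exists Z.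
  by case: (cid h) => Z0 [] /=; exists Z0.
have close i j : `|Z i j - Z0 i j| <= M%:R^-1.
  rewrite -[leRHS]mul1r ler_pdivlMr // -[X in _ * X]gtr0_norm // -normrM mulrBl.
  have := cZ i j; have := cZ0 i j; rewrite !intrD !mulr1z.
  by move=> /andP[a1 a2] /andP[b1 b2]; rewrite ler_norml; apply/andP; split;
    lra.
have Gclose i j : `|G Z i j * M%:R - G Z0 i j * M%:R| <= L%:R.
  rewrite -mulrBl normrM [X in _ * X]gtr0_norm // -ler_pdivlMr //.
  exact: lip close i j.
pose off i j : int :=
  Num.floor (G Z i j * M%:R) - Num.floor (G Z0 i j * M%:R) + L%:Z.
have offP i j : 0 <= off i j < (2 * L).+2%:Z.
  have := Gclose i j; rewrite ler_norml => /andP[h1 h2].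
  have /andP[f1 f2] := floor_itv (G Z i j * M%:R).
  have /andP[g1 g2] := floor_itv (G Z0 i j * M%:R).
  rewrite /off; apply/andP; split.
    rewrite -ltzD1 -(ltr_int R) !intrD intrN; move: f2 g1; rewrite !intrD.
    by move: (_ * M%:R) (G Z0 i j * _) h1 h2 => x y; lra.
  rewrite -(ltr_int R) !intrD intrN; move: f1 g2; rewrite !intrD.
  rewrite -[(2 * L).+2]addn2 mul2n -addnn !PoszD !intrD.
  by move: (_ * M%:R) (G Z0 i j * _) h1 h2 => x y; lra.
pose o : 'M['I_(2 * L).+2]_(m, n) := \matrix_(i, j) inord `|off i j|%N.
exists (shift (base c) o).
  by apply/allpairsP; exists (c, o); rewrite mem_enum.
move=> i j; rewrite /shift !mxE inordK; last first.
  by have := offP i j; clear; lia.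
have -> : base c i j + `|off i j|%N%:Z - L%:Z = Num.floor (G Z i j * M%:R).
  have /andP[off0 _] := offP i j.
  by rewrite gez0_abs // bE mxE /off; ring.
have /andP[f1 f2] := floor_itv (G Z i j * M%:R).
by rewrite f1 ltW.
Qed.

Local Notation T := (measurableTypeR R).

Lemma int_cell_preimage M c : (0 < M)%N ->
  @mx_of_tuple R m n @^-1` int_cell M c =
  [set t : (m * n).-tuple T | forall k, [set` `[(mxvec c 0 k)%:~R / M%:R,
     (mxvec c 0 k + 1)%:~R / M%:R]] (tnth t k)].
Proof.
move=> M0; have M0R : 0 < M%:R :> R by rewrite ltr0n.
apply/seteqP; split => t /= ct => [k|i j].
  case/mxvec_indexP: k => i j; have := ct i j; rewrite mx_of_tupleE mxvecE.
  by rewrite in_itv /= ler_pdivrMr // ler_pdivlMr.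
have := ct (mxvec_index i j); rewrite mx_of_tupleE mxvecE.
by rewrite in_itv /= ler_pdivrMr // ler_pdivlMr.
Qed.

Lemma measurable_int_cell M c : (0 < M)%N ->
  measurable (@mx_of_tuple R m n @^-1` int_cell M c).
Proof.
move=> M0; rewrite int_cell_preimage //.
rewrite (_ : [set t | _] = \bigcap_(k in setT) ((@tnth (m * n) T)^~ k @^-1`
  [set` `[(mxvec c 0 k)%:~R / M%:R, (mxvec c 0 k + 1)%:~R / M%:R]])).
  apply: fin_bigcap_measurable => // k _; rewrite -[X in measurable X]setTI.
  by apply: measurable_tnth => //; exact: measurable_itv.
by apply/seteqP; split => t /= ct k; [move=> _|]; exact: ct.
Qed.

Lemma lebesgue_mx_int_cell M c : (0 < M)%N ->
  lebesgue_mx (int_cell M c) = ((M%:R ^+ (m * n))^-1)%:E.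
Proof.
move=> M0; have M0R : 0 < M%:R :> R by rewrite ltr0n.
pose B k : set T := [set` `[(mxvec c 0 k)%:~R / M%:R,
  (mxvec c 0 k + 1)%:~R / M%:R]].
rewrite /lebesgue_mx int_cell_preimage // (lebesgue_tuple_box (B := B));
  last first.
  by move=> k; exact: measurable_itv.
rewrite /B.
rewrite (eq_bigr (fun=> (M%:R^-1)%:E)) => [|k _].
  rewrite prodEFin prodr_const card_ord exprVn //.
rewrite lebesgue_measure_itv /= lte_fin ltr_pM2r ?invr_gt0 // ltr_int.
rewrite ltzD1 lexx -EFinB; congr EFin.
by rewrite intrD mulr1z mulrDl addrAC subrr add0r mul1r.
Qed.

Definition int_cells M (s : seq 'M[int]_(m, n)) : set 'M[R]_(m, n) :=
  [set Z | exists2 c, c \in s & int_cell M c Z].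

Lemma int_cells_cons M c s :
  int_cells M (c :: s) = int_cell M c `|` int_cells M s.
Proof.
apply/seteqP; split => Z /=.
  by move=> [c']; rewrite inE => /predU1P[->|c's] Zc; [left|right; exists c'].
move=> [Zc|[c' c's Zc']]; first by exists c; rewrite ?mem_head.
by exists c' => //; rewrite inE c's orbT.
Qed.

Lemma measurable_int_cells M s : (0 < M)%N ->
  measurable (@mx_of_tuple R m n @^-1` int_cells M s).
Proof.
move=> M0; elim: s => [|c s IH].
  rewrite (_ : int_cells M [::] = set0) ?preimage_set0 //.
  by apply/seteqP; split => // Z [].
by rewrite int_cells_cons preimage_setU; apply: measurableU => //;
  exact: measurable_int_cell.
Qed.

Lemma lebesgue_mx_int_cells_le M s : (0 < M)%N ->
  (lebesgue_mx (int_cells M s) <= ((size s)%:R / M%:R ^+ (m * n))%:E)%E.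
Proof.
have [mu muE] := lebesgue_tuple_measure R (m * n).
move=> M0; elim: s => [|c s IH].
  rewrite (_ : int_cells M [::] = set0); last by apply/seteqP; split => // Z [].
  by rewrite /lebesgue_mx preimage_set0 muE measure0 mul0r.
rewrite int_cells_cons /lebesgue_mx preimage_setU muE.
apply: le_trans (measureU2 mu _ _) _.
- exact: measurable_int_cell.
- exact: measurable_int_cells.
have cE := lebesgue_mx_int_cell c M0; rewrite /lebesgue_mx muE in IH cE.
have c_le : (mu (@mx_of_tuple R m n @^-1` int_cell M c) <=
    ((M%:R ^+ (m * n))^-1)%:E)%E by rewrite cE.
by rewrite -nat1r mulrDl mul1r EFinD; apply: leeD; [exact: c_le|exact: IH].
Qed.

Lemma null_content0 : null_content set0.
Proof.
move=> eps e0; exists 1%N, [::]; split => //=.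
by rewrite expr1n mulr1 ltW.
Qed.

(** The sets A_i may fail to be measurable, so each is first enclosed in a finite union of cells of
    measure at most e/2^(k+1); countable subadditivity is applied to these unions. *)
Lemma lebesgue_mx_null (I : countType) (B : set 'M[R]_(m, n))
    (A : I -> set 'M[R]_(m, n)) :
  measurable (@mx_of_tuple R m n @^-1` B) ->
  B `<=` \bigcup_i A i -> (forall i, null_content (A i)) ->
  lebesgue_mx B = 0%E.
Proof.
move=> mB BA nA; have [mu muE] := lebesgue_tuple_measure R (m * n).
pose A' k := if unpickle k is Some i then A i else set0.
have nA' k : null_content (A' k).
  by rewrite /A'; case: unpickle => [i|]; [exact: nA|exact: null_content0].
have BA' : B `<=` \bigcup_k A' k.
  by move=> Z /BA[i _ Ai]; exists (pickle i); rewrite // /A' pickleK.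
apply/eqP; rewrite eq_le {2}/lebesgue_mx muE measure_ge0 andbT.
apply/lee_addgt0Pr => e e0; rewrite add0e.
have /choice[U UP] : forall k, exists U : set 'M[R]_(m, n), [/\ A' k `<=` U,
    measurable (@mx_of_tuple R m n @^-1` U) &
    (lebesgue_mx U <= (e / (2 ^ k.+1)%:R)%:E)%E].
  move=> k; have ek0 : 0 < e / (2 ^ k.+1)%:R.
    by rewrite divr_gt0 // ltr0n expn_gt0.
  have [M [s [M0 cov sz]]] := nA' k _ ek0.
  exists (int_cells M s); split => //.
    exact: measurable_int_cells.
  apply: le_trans (lebesgue_mx_int_cells_le s M0) _.
  by rewrite lee_fin ler_pdivrMr // exprn_gt0 // ltr0n.
apply: (@le_trans _ _ (\sum_(0 <= k <oo) lebesgue_mx (U k))%E).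
  rewrite /lebesgue_mx muE; apply: measure_sigma_subadditive => //.
    by move=> k; case: (UP k).
  move=> t /BA'[k _ Ak]; exists k => //; case: (UP k) => AU _ _; exact: AU.
apply: le_trans (epsilon_trick0 xpredT (ltW e0)).
apply: lee_nneseries => k _; last by case: (UP k).
by rewrite /lebesgue_mx muE measure_ge0.
Qed.

Lemma covers_int_cells (A : set 'M[R]_(m, n)) M (C : pred (grid m n M)) :
  covers A C -> exists2 s, A `<=` int_cells M s & size s = #|C|.
Proof.
move=> AC; pose f (g : grid m n M) : 'M[int]_(m, n) := \matrix_(i,
  j) (g j i)%:Z.
exists (map f (enum C)); last by rewrite size_map -cardE.
move=> Z /AC[c Cc cZ]; exists (f c); first by apply: map_f; rewrite mem_enum.
by move=> i j; rewrite mxE intrD; have := cZ i j; rewrite -natr1.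
Qed.

Lemma null_content_covers (A : set 'M[R]_(m, n)) :
  (forall eps, 0 < eps -> exists M (C : pred (grid m n M)),
    [/\ (0 < M)%N, covers A C & density R C <= eps]) ->
  null_content A.
Proof.
move=> cov eps /cov[M [C [M0 AC dC]]].
have [s As sC] := covers_int_cells AC; exists M, s; split => //.
rewrite sC; move: dC; rewrite /density ler_pdivrMr //.
by rewrite exprn_gt0 // ltr0n.
Qed.

End null_content.

(** * Charts and exceptional matrices *)

Section null_sets.
Context (R : realType) (m n : nat).
Implicit Types (Z X : 'M[R]_(m, n)).

Definition hyperplane (i0 : 'I_m) (j0 : 'I_n) (a : int) : set 'M[R]_(m, n) :=
  [set Z | (forall i j, `|Z i j| <= 1) /\ Z i0 j0 = a%:~R].

(** An integral level lies on faces of the cells for every mesh, so one layer of (2M+1)^N <= (3M)^N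
    cells is enough, where N = mn - 1. *)
Lemma null_content_hyperplane i0 j0 a : null_content (hyperplane i0 j0 a).
Proof.
move=> eps e0.
pose N := #|predC (pred1 (i0, j0))|.
have NE : (m * n = N + 1)%N.
  have := cardC (pred1 (i0, j0)); rewrite card1 card_prod !card_ord add1n addn1.
  by move=> <-.
pose M := (Num.truncn (3 ^+ N / eps)).+1.
have M0 : (0 < M)%N by [].
have M0R : 0 < M%:R :> R by rewrite ltr0n.
pose z : 'I_(2 * M).+1 := ord0.
pose f (o : {ffun 'I_m * 'I_n -> 'I_(2 * M).+1}) : 'M[int]_(m, n) :=
  \matrix_(i, j) if (i, j) == (i0, j0) then a * M%:Z else (o (i, j))%:Z - M%:Z.
exists M, [seq f o | o <- enum [pred t : {ffun 'I_m * 'I_n -> 'I_(2 * M).+1} |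
  [forall i, pred1 (i0, j0) i ==> (t i == z)]]]; split => //; last first.
  rewrite size_map -cardE card_pinned -/N NE addn1 exprS mulrA natrX.
  apply: (@le_trans _ _ ((3 * M%:R) ^+ N)).
    by rewrite lerXn2r ?nnegrE ?mulr_ge0 // -natrM ler_nat -addn1; lia.
  rewrite exprMn ler_wpM2r ?exprn_ge0 // [leRHS]mulrC -ler_pdivrMr //.
  by rewrite ltW // truncnS_gt.
move=> Z [Z1 Za].
pose o := [ffun ij : 'I_m * 'I_n => if ij == (i0, j0) then z
  else inord (absz (Num.floor (Z ij.1 ij.2 * M%:R) + M%:Z))].
exists (f o).
  apply: map_f; rewrite mem_enum inE; apply/forallP => ij; apply/implyP => /= e.
  by rewrite ffunE e.
move=> i j; rewrite !mxE; case: eqP => [[-> ->]|ne].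
  by rewrite Za intrD intrM mulr1z lexx /= lerDl ler01.
have Zb := Z1 i j; rewrite ler_norml in Zb; have /andP[z1 z2] := Zb.
have /andP[f1 f2] := floor_itv (Z i j * M%:R).
have zM1 : - M%:R <= Z i j * M%:R by rewrite -mulN1r ler_wpM2r.
have zM2 : Z i j * M%:R <= M%:R by rewrite ler_piMl.
have fl0 : - M%:Z <= Num.floor (Z i j * M%:R).
  by rewrite floor_ge_int intrN.
have fl1 : Num.floor (Z i j * M%:R) <= M%:Z.
  by rewrite -(ler_int R); apply: le_trans f1 zM2.
rewrite ffunE /= (introF eqP ne) inordK; last by move: fl0 fl1; clear; lia.
rewrite (_ : (_ - _ = Num.floor (Z i j * M%:R))%R); first by rewrite f1 ltW.
by rewrite gez0_abs; [ring|move: fl0; clear; lia].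
Qed.

Lemma mulr_lipschitz (b e x y x' y' : R) : `|x| <= b -> `|y'| <= b ->
  `|x - x'| <= e -> `|y - y'| <= e -> `|x * y - x' * y'| <= 2 * b * e.
Proof.
move=> xb yb xe ye.
have -> : x * y - x' * y' = x * (y - y') + (x - x') * y' by ring.
apply: le_trans (ler_normD _ _) _; rewrite !normrM.
have -> : 2 * b * e = b * e + e * b by ring.
by apply: lerD; apply: ler_pM.
Qed.

Lemma sum_lipschitz (P : pred 'I_n) (b e : R) (x y x' y' : 'I_n -> R) :
  0 <= b -> 0 <= e ->
  (forall l, P l -> `|x l * y l - x' l * y' l| <= 2 * b * e) ->
  `|\sum_(l | P l) x l * y l - \sum_(l | P l) x' l * y' l| <=
    n%:R * (2 * b * e).
Proof.
move=> b0 e0 H; rewrite -sumrB; apply: le_trans (ler_norm_sum _ _ _) _.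
apply: (@le_trans _ _ (\sum_(l < n) (2 * b * e))).
  rewrite big_mkcond; apply: ler_sum => l _; case: ifP => [/H//|_].
  by rewrite !mulr_ge0.
by rewrite sumr_const card_ord [leRHS]mulr_natl.
Qed.

(* The rows of [Z] in the image of [f] form X1, the other ones form
   [X' - kappa]. *)
Definition chart (f : {ffun 'I_n -> 'I_m}) (kappa : 'I_m -> 'I_n -> R) Z :
    'M[R]_(m, n) :=
  \matrix_(i, j) if i \in codom f then Z i j
    else \sum_l (Z i l + kappa i l) * Z (f l) j.

(** The factors are bounded by 2 and 1, so a sum of [n] products is Lipschitz with constant at most
    n * (2 * 2); the successor also covers the rows that are copied. *)
Lemma null_content_chart f kappa (A : set 'M[R]_(m, n)) :
  (forall i j, `|kappa i j| <= 1) ->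
  (forall Z i j, A Z -> `|Z i j| <= 1) ->
  null_content A -> null_content (chart f kappa @` A).
Proof.
move=> k1 A1; apply: (@null_content_lipschitz _ _ _ _ _ (4 * n).+1).
move=> Z Z' e AZ AZ' ZZ' i j; rewrite !mxE.
have e0 : 0 <= e by apply: le_trans (ZZ' i j).
have eL : e <= (4 * n).+1%:R * e by rewrite ler_peMl // ler1n.
case: ifP => _; first exact: le_trans (ZZ' i j) eL.
apply: le_trans (sum_lipschitz (b := 2) _ e0 _) _ => //.
  move=> l _; apply: mulr_lipschitz.
  - by apply: le_trans (ler_normD _ _) _; have := k1 i l; have := A1 _ i l AZ;
    lra.
  - by have := A1 _ (f l) j AZ'; lra.
  - by rewrite opprD addrACA subrr addr0.
  - exact: ZZ'.
rewrite mulrA ler_wpM2r // (_ : n%:R * (2 * 2) = (4 * n)%:R).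
  by rewrite ler_nat.
by rewrite natrM mulrC -natrM.
Qed.

Hypothesis nm : (n < m)%N.

(* The column [j0] is a combination of the other ones, whose coefficients are
   read off the first [n] entries of the column [j0] of [Z]. *)
Definition degenerate (j0 : 'I_n) Z : 'M[R]_(m, n) :=
  \matrix_(i, j) if j == j0
    then \sum_(l | l != j0) Z (widen_ord (ltnW nm) l) j0 * Z i l
    else Z i j.

Lemma null_content_degenerate j0 (A : set 'M[R]_(m, n)) :
  (forall Z i j, A Z -> `|Z i j| <= 1) ->
  null_content A -> null_content (degenerate j0 @` A).
Proof.
move=> A1; apply: (@null_content_lipschitz _ _ _ _ _ (2 * n).+1).
move=> Z Z' e AZ AZ' ZZ' i j; rewrite !mxE.
have e0 : 0 <= e by apply: le_trans (ZZ' i j).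
have eL : e <= (2 * n).+1%:R * e by rewrite ler_peMl // ler1n.
case: ifP => _; last exact: le_trans (ZZ' i j) eL.
apply: le_trans (sum_lipschitz (b := 1) _ e0 _) _ => //.
  move=> l _; apply: mulr_lipschitz => //; exact: A1.
rewrite mulrA ler_wpM2r // (_ : n%:R * (2 * 1) = (2 * n)%:R).
  by rewrite ler_nat.
by rewrite natrM mulr1 mulrC.
Qed.

(* The coefficients are at most 1 when [j0] maximizes the coefficient of a
   dependency between the columns. *)
Lemma low_rank_degenerate X : (forall i j, `|X i j| <= 1) -> (\rank X < n)%N ->
  exists j0, exists2 Z, hyperplane (Ordinal nm) j0 0 Z & X = degenerate j0 Z.
Proof.
move=> X1 rX; have : ~~ row_free X^T by rewrite /row_free mxrank_tr ltn_eqF.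
rewrite -kermx_eq0 => /rowV0Pn[v /sub_kermxP vX v0].
have [k vk] : exists k, v 0 k != 0.
  by apply/existsP; apply: contraNT v0; rewrite negb_exists => /forallP v0;
    apply/eqP/rowP => k; rewrite mxE; apply/eqP/negPn.
pose j0 := [arg max_(j > k) `|v 0 j|]%O.
have vmax j : `|v 0 j| <= `|v 0 j0|.
  by rewrite /j0; case: arg_maxP => // i _ /(_ j); apply.
have vj0 : v 0 j0 != 0.
  by rewrite -normr_gt0; apply: lt_le_trans (vmax k); rewrite normr_gt0.
pose c l := - v 0 l / v 0 j0.
have Xj0 i : X i j0 = \sum_(l | l != j0) c l * X i l.
  have /rowP/(_ i) := vX; rewrite !mxE (bigD1 j0) //= mxE => e.
  have -> : \sum_(l | l != j0) c l * X i l =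
      - (\sum_(l | l != j0) v 0 l * X^T l i) / v 0 j0.
    rewrite -sumrN mulr_suml; apply: eq_bigr => l _.
    by rewrite mxE /c !mulNr mulrAC.
  have -> : \sum_(l | l != j0) v 0 l * X^T l i = - (v 0 j0 * X i j0).
    by apply/eqP; rewrite -addr_eq0 addrC e.
  by rewrite opprK mulrAC divff // mul1r.
pose w l := widen_ord (ltnW nm) l.
(* [degenerate] reads only the first [n] entries of the column [j0]. The later ones, which exist
   because n < m, are free; setting them to 0 places [Z] in a hyperplane. *)
pose Z : 'M[R]_(m, n) := \matrix_(i, j) if j == j0
  then if insub (val i) is Some l then c l else 0 else X i j.
have Zw l : Z (w l) j0 = c l by rewrite mxE eqxx valK.
have Zj i j : j != j0 -> Z i j = X i j by rewrite mxE => /negPf ->.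
exists j0, Z; last first.
  apply/matrixP => i j; rewrite mxE; case: eqP => [->|/eqP jj0];
    last by rewrite Zj.
  by rewrite Xj0; apply: eq_bigr => l lj0; rewrite -/(w l) Zw Zj.
split; last by rewrite mxE eqxx insubF //= ltnn.
move=> i j; case: (eqVneq j j0) => [->|jj0]; last by rewrite Zj.
rewrite mxE eqxx; case: insub => [l|]; last by rewrite normr0.
by rewrite /c normrM normrN normfV ler_pdivrMr ?normr_gt0 // mul1r.
Qed.

Lemma eq_cofactor (p : nat) (A B : 'M[R]_p) (j l : 'I_p) :
  (forall a b, a != j -> A a b = B a b) -> cofactor A j l = cofactor B j l.
Proof.
move=> AB; rewrite /cofactor; congr (_ * \det _); apply/matrixP => a b.
by rewrite !mxE AB // eq_sym neq_lift.
Qed.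

(** Each coefficient is the quotient by det X1 of the minor in which a row of X1 is replaced by a
    row of [X], and det X1 is maximal in absolute value. *)
Lemma maximal_minor X : \rank X = n ->
  exists f : {ffun 'I_n -> 'I_m}, rowsub f X \in unitmx /\
    forall i j, `|(row i X *m invmx (rowsub f X)) 0 j| <= 1.
Proof.
move=> rX; have fullX : row_full X by rewrite /row_full rX.
pose f0 := [ffun i => fullrankfun fullX i].
pose f : {ffun 'I_n -> 'I_m} :=
  [arg max_(g > f0) `|\det (rowsub (fun_of_fin g) X)|]%O.
have fmax (g : {ffun 'I_n -> 'I_m}) : `|\det (rowsub g X)| <=
  `|\det (rowsub f X)|.
  by rewrite /f; case: arg_maxP => // h _ /(_ g); apply.
have det0 : \det (rowsub f X) != 0.
  rewrite -normr_gt0; apply: lt_le_trans (fmax f0); rewrite normr_gt0.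
  rewrite -unitfE -unitmxE; have ->
    : rowsub f0 X = rowsub (fullrankfun fullX) X.
    by apply/matrixP => i j; rewrite !mxE ffunE.
  exact: fullrowsub_unit.
exists f; split; first by rewrite unitmxE unitfE.
move=> i j; set X1 := rowsub f X in fmax det0 *.
pose g : {ffun 'I_n -> 'I_m} := [ffun l => if l == j then i else f l].
(* Cramer's rule. *)
suff -> : (row i X *m invmx X1) 0 j = \det (rowsub g X) / \det X1.
  by rewrite normrM normfV ler_pdivrMr ?normr_gt0 // mul1r.
rewrite mxE (expand_det_row _ j) mulr_suml; apply: eq_bigr => l _.
rewrite /invmx unitmxE unitfE det0 !mxE ffunE eqxx (mulrC (_^-1)) mulrA.
congr (_ * _ / _); apply: eq_cofactor => a b aj.
by rewrite !mxE ffunE (negPf aj).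
Qed.

End null_sets.

(** * Back to the matrices X *)

Section charts_cover.
Context (R : realType) (m n : nat) (psi : nat -> R).
Hypothesis n_gt0 : (0 < n)%N.
Hypothesis psi_le1 : exists Q, forall s, (Q <= s)%N -> psi s <= 1.

Definition off_chart (f : {ffun 'I_n -> 'I_m}) : pred 'I_m :=
  [pred i | i \notin codom f].

(** [k] records the negative entries of X'. Subtracting this shift adds 1 to them, which brings X'
    into the unit cube where [misses] is defined. *)
Definition neg_shift (k : {ffun 'I_m * 'I_n -> bool}) i j : R :=
  - (k (i, j))%:R.

Lemma supnorm_int_max (q : 'rV[int]_m) i : (`|q ord0 i| <= supnorm_int q)%N.
Proof. exact: (@leq_bigmax _ (fun i => `|q ord0 i|%N)). Qed.

Lemma not_W0_bounded X : @unit_cube R m n X -> ~ W0 psi X ->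
  exists N, forall q : 'rV[int]_m, q != 0 ->
    mx_norm (map_mx intr q *m X) < psi (supnorm_int q) -> (supnorm_int q < N)%N.
Proof.
move=> X01 nW; have : finite_set [set q : 'rV[int]_m |
    q != 0 /\ mx_norm (map_mx intr q *m X) < psi (supnorm_int q)].
  by apply: contrapT => inf; apply: nW; split.
move=> /finite_seqP[s sE]; exists (\max_(q <- s) supnorm_int q).+1 => q q0 qX.
rewrite ltnS; apply: (@leq_bigmax_seq _ _ xpredT) => //.
have : [set` s] q by rewrite -sE.
by [].
Qed.

Variables (X : 'M[R]_(m, n)) (f : {ffun 'I_n -> 'I_m}).
Hypotheses (X01 : @unit_cube R m n X) (nW : ~ W0 psi X).
Hypothesis fX : rowsub f X \in unitmx.

Let Y : 'M[R]_(m, n) := X *m invmx (rowsub f X).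

Hypothesis Y1 : forall i j, `|Y i j| <= 1.

Lemma chart_inj : injective f.
Proof.
move=> a b fab; apply/eqP; apply: contraTT fX => ab.
rewrite unitmxE (determinant_alternate ab) ?unitr0 // => j.
by rewrite !mxE fab.
Qed.

Let X_Y i j : X i j = \sum_l Y i l * X (f l) j.
Proof.
have -> : X i j = (Y *m rowsub f X) i j by rewrite mulmxKV.
by rewrite mxE; apply: eq_bigr => l _; rewrite !mxE.
Qed.

Let X_norm i j : `|X i j| <= 1.
Proof. by have /andP[x0 x1] := X01 i j; rewrite ger0_norm. Qed.

(** For an entry of absolute value 1 in the row multiplied by s, the choice of E0 fails. Such
    matrices come from a hyperplane, and no shift is made. *)
Lemma chart_boundary i0 j0 : i0 \notin codom f -> `|Y i0 j0| = 1 ->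
  exists b : bool,
    (chart f (fun _ _ => 0) @` @hyperplane R m n i0 j0 ((-1) ^+ b)) X.
Proof.
move=> i0f Y1E; pose b := Y i0 j0 < 0; exists b.
exists (\matrix_(i, j) if i \in codom f then X i j else Y i j).
  split; first by move=> i j; rewrite mxE; case: ifP.
  rewrite mxE (negPf i0f) /b; case: ltrP Y1E => [lt|ge] e.
    by rewrite expr1 intrN -e ltr0_norm // opprK.
  by rewrite expr0 -e ger0_norm.
apply/matrixP => i j; rewrite mxE; case: (boolP (i \in codom f)) => inf.
  by rewrite mxE inf.
rewrite [RHS]X_Y; apply: eq_bigr => l _; rewrite !mxE (negPf inf) addr0.
by rewrite codom_f.
Qed.

(** A solution (q, Q) for [Z] would yield an integer vector [v] with v X = w X1, where |w| <
    psi(s)/n and the entries of X1 are at most 1, so |vX| < psi(s). As |v| = s >= N, this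
    contradicts the choice of [N]. *)
Lemma chart_interior i0 : i0 \notin codom f -> (forall j, `|Y i0 j| < 1) ->
  exists E0 Q0 k, (4 * m <= E0)%N /\
    (chart f (neg_shift k) @`
       @misses R m n (off_chart f) i0 E0 (fun s => psi s / n%:R) Q0) X.
Proof.
move=> i0f Ylt; have [Qpsi psi1] := psi_le1.
have [N NP] := not_W0_bounded X01 nW.
have nR : 0 < n%:R :> R by rewrite ltr0n.
pose g := \big[Order.max/0]_j `|Y i0 j|.
have g1 : g < 1 by apply/bigmax_ltP; split.
have gY j : `|Y i0 j| <= g by apply: le_bigmax.
(* These choices give m/E0 <= (1-g)/2 and 1 <= s(1-g)/2. The entries [u l] are then at most sg +
   s(1-g)/2 + s(1-g)/2 = s, so the supremum norm of [v] is exactly s. *)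
pose E0 := (4 * m + (Num.truncn (2 * m%:R / (1 - g))).+1)%N.
pose Q0 := (N + Qpsi + 1 + (Num.truncn (2 / (1 - g))).+1)%N.
have E0g : m%:R <= (1 - g) / 2 * E0%:R.
  rewrite mulrAC ler_pdivlMr // mulrC [leRHS]mulrC -ler_pdivrMr ?subr_gt0 //.
  by apply: le_trans (ltW (truncnS_gt _)) _; rewrite ler_nat leq_addl.
have Q0g s : (Q0 <= s)%N -> 1 <= (1 - g) / 2 * s%:R.
  move=> Qs; rewrite mulrAC ler_pdivlMr // mul1r [leRHS]mulrC -ler_pdivrMr
    ?subr_gt0 //.
  apply: le_trans (ltW (truncnS_gt _)) _; rewrite ler_nat.
  by apply: leq_trans Qs; rewrite leq_addl.
have E0n : (0 < E0)%N by rewrite /E0 addnS.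
have E00 : 0 < E0%:R :> R by rewrite ltr0n.
pose k := [ffun ij : 'I_m * 'I_n => Y ij.1 ij.2 < 0].
exists E0, Q0, k; split; first by rewrite leq_addr.
pose Z : 'M[R]_(m, n) := \matrix_(i, j) if i \in codom f then X i j
  else Y i j - neg_shift k i j.
have Zf l j : Z (f l) j = X (f l) j by rewrite mxE codom_f.
have ZY i j : i \notin codom f -> Z i j = Y i j - neg_shift k i j.
  by move=> inf; rewrite mxE (negPf inf).
exists Z; last first.
  apply/matrixP => i j; rewrite mxE; case: (boolP (i \in codom f)) => inf.
    by rewrite mxE inf.
  by rewrite [RHS]X_Y; apply: eq_bigr => l _; rewrite Zf ZY // subrK.
split.
  move=> i j; case: (boolP (i \in codom f)) => inf; first by rewrite mxE inf.
  rewrite ZY // /neg_shift ffunE /= opprK; have := Y1 i j.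
  by rewrite ler_norml => /andP[]; case: ltrP => /=; lra.
move=> q Q Qs qE; set s := q i0 in Qs qE *.
apply: contrapT => noj.
have wlt l : `|\sum_i (q i)%:R * Z i l - (Q l)%:R| < psi s / n%:R.
  by rewrite ltNge; apply/negP => le; apply: noj; exists l.
have q0 i : i \in codom f -> q i = 0%N.
  move=> inf; have ii0 : i != i0 by apply: contraNneq i0f => <-.
  have offi : off_chart f i = false.
    by apply/negP => offi; exact: offi inf.
  by have := qE _ ii0; rewrite offi => /eqP.
have qs i : i != i0 -> (q i * E0 <= s)%N.
  move=> ii0; have := qE _ ii0; case: ifP => // _ /eqP ->.
  by rewrite mul0n.
have q_le i : (q i <= s)%N.
  case: (eqVneq i i0) => [->//|/qs]; apply: leq_trans.
  by rewrite leq_pmulr.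
(* The sum compensates for the passage from X' to its shift [Z], so that [w] below is the same
   linear form in either of them. *)
pose u l : int := - (Q l)%:Z + \sum_i (q i)%:Z * (k (i, l))%:Z.
pose v : 'rV[int]_m := \row_i ((q i)%:Z + \sum_l if f l == i then u l else 0).
have v_off i : i \notin codom f -> v 0 i = (q i)%:Z.
  move=> inf; rewrite mxE big1 ?addr0 // => l _; case: eqP => // fl.
  by move: inf; rewrite -fl codom_f.
have v_f l : v 0 (f l) = u l.
  rewrite mxE q0 ?codom_f // add0r (bigD1 l) //= eqxx big1 ?addr0 // => l' l'l.
  by rewrite (inj_eq chart_inj) (negPf l'l).
pose w l : R := (u l)%:~R + \sum_i (q i)%:R * Y i l.
have wE l : w l = \sum_i (q i)%:R * Z i l - (Q l)%:R.
  rewrite /w /u intrD intrN addrC addrCA; rewrite [RHS]addrC; congr (_ + _).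
  rewrite rmorph_sum -big_split /=; apply: eq_bigr => i _; rewrite intrM.
  case: (boolP (i \in codom f)) => inf; first by rewrite q0 // !mul0r addr0.
  by rewrite ZY // /neg_shift opprK mulrDr.
have vX j : (map_mx intr v *m X) 0 j = \sum_l w l * X (f l) j.
  rewrite mxE.
  have -> : \sum_i map_mx intr v 0 i * X i j =
      \sum_i (q i)%:R * X i j + \sum_l (u l)%:~R * X (f l) j.
    rewrite (eq_bigr (fun i => (q i)%:R * X i j +
        \sum_l (if f l == i then (u l)%:~R else 0) * X i j)); last first.
      move=> i _; rewrite !mxE intrD mulrDl; congr (_ + _).
      rewrite rmorph_sum /= mulr_suml; apply: eq_bigr => l _.
      by case: eqP.
    rewrite big_split /=; congr (_ + _); rewrite exchange_big /=.
    apply: eq_bigr => l _; rewrite (bigD1 (f l)) //= eqxx big1 ?addr0 // => i.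
    by rewrite eq_sym => /negPf ->; rewrite mul0r.
  rewrite [RHS](eq_bigr (fun l => (u l)%:~R * X (f l) j +
      \sum_i (q i)%:R * (Y i l * X (f l) j))); last first.
    move=> l _; rewrite mulrDl mulr_suml; congr (_ + _).
    by apply: eq_bigr => i _; rewrite mulrA.
  rewrite big_split /= addrC; congr (_ + _); rewrite exchange_big /=.
  by apply: eq_bigr => i _; rewrite -mulr_sumr -X_Y.
have s_gt0 : (0 < s)%N by apply: leq_trans Qs; rewrite /Q0 addnS.
have i0v : v 0 i0 = s by rewrite v_off.
have u_le l : (`|u l| <= s)%N.
  rewrite -(ler_nat R) natr_absz intr_norm.
  have -> : (u l)%:~R = w l - \sum_i (q i)%:R * Y i l :> R by rewrite /w addrK.
  apply: le_trans (ler_normB _ _) _.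
  have w1 : `|w l| <= (1 - g) / 2 * s%:R.
    apply: le_trans (Q0g _ Qs); rewrite wE; apply: le_trans (ltW (wlt l)) _.
    rewrite ler_pdivrMr // mul1r; apply: le_trans (psi1 _ _) _.
      by apply: leq_trans Qs; rewrite /Q0 -!addnA addnCA leq_addr.
    by rewrite ler1n.
  have qY : `|\sum_i (q i)%:R * Y i l| <= s%:R * g + (1 - g) / 2 * s%:R.
    rewrite (bigD1 i0) //=; apply: le_trans (ler_normD _ _) _; apply: lerD.
      by rewrite normrM normr_nat ler_wpM2l.
    apply: le_trans (ler_norm_sum _ _ _) _.
    apply: (@le_trans _ _ (\sum_(i < m) s%:R / E0%:R)).
      rewrite big_mkcond; apply: ler_sum => i _; case: ifP => [ii0|_].
        rewrite normrM normr_nat -[leRHS]mulr1; apply: ler_pM => //.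
        by rewrite ler_pdivlMr // -natrM ler_nat qs.
      by rewrite divr_ge0.
    rewrite sumr_const card_ord -[leLHS]mulr_natl mulrA ler_pdivrMr //
      [leRHS]mulrAC.
    by rewrite ler_wpM2r.
  by have := lerD w1 qY; move: (s%:R : R) => x; lra.
have vs : supnorm_int v = s.
  apply/eqP; rewrite eqn_leq; apply/andP; split; last first.
    by have := supnorm_int_max v i0; rewrite i0v.
  apply/bigmax_leqP => i _; case: (boolP (i \in codom f)) =>
    [/codomP[l ->]|inf].
    by rewrite v_f u_le.
  by rewrite v_off // q_le.
have v0 : v != 0.
  by apply/eqP => /rowP/(_ i0); rewrite i0v mxE => -[]; move: s_gt0; lia.
have psi_pos : 0 < psi s.
  have := wlt (Ordinal n_gt0); move/(le_lt_trans (normr_ge0 _)).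
  by rewrite pmulr_lgt0 // invr_gt0.
have := NP v v0; rewrite vs => /(_ _).
have -> : (s < N)%N = false.
  by apply/negbTE; rewrite -leqNgt; apply: leq_trans Qs;
    rewrite /Q0 -!addnA leq_addr.
suff vXlt : mx_norm (map_mx intr v *m X) < psi s by move=> /(_ vXlt).
rewrite mx_normrE; apply/bigmax_ltP; split => // -[a j] _ /=.
rewrite (ord1 a) vX; apply: le_lt_trans (ler_norm_sum _ _ _) _.
apply: (@lt_le_trans _ _ (\sum_(l < n) psi s / n%:R)); last first.
  by rewrite sumr_const card_ord -[leLHS]mulr_natl mulrCA divff
    ?mulr1 // gt_eqF.
apply: ltr_sum; first by apply/hasP; exists (Ordinal n_gt0);
  rewrite ?mem_index_enum.
move=> l _; rewrite normrM; apply: le_lt_trans (_ : `|w l| * 1 < _).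
  by rewrite ler_wpM2l.
by rewrite mulr1 wE.
Qed.

End charts_cover.

(** * Countably many null pieces cover the complement *)

Section divergence.
Context (R : realType) (m n : nat) (psi : nat -> R).
Hypotheses (n_gt0 : (0 < n)%N) (nm : (n < m)%N) (mn3 : (3 < m + n)%N).
Hypothesis psi_gt0 : forall r, (1 <= r)%N -> 0 < psi r.
Hypothesis psi_cvg0 : psi r @[r --> \oo] --> (0 : R).

Lemma psi_eventually_le1 : exists Q, forall s, (Q <= s)%N -> psi s <= 1.
Proof.
have /cvgrPdist_le/(_ 1 ltr01) [Q _ H] := psi_cvg0; exists Q => s Qs.
by have := H s Qs; rewrite sub0r normrN; apply: le_trans; exact: ler_norm.
Qed.

Lemma psi_div_eventually_le1 :
  exists Q, forall s, (Q <= s)%N -> psi s / n%:R <= 1.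
Proof.
have [Q H] := psi_eventually_le1; exists Q => s /H h.
rewrite ler_pdivrMr ?ltr0n // mul1r; apply: le_trans h _.
by rewrite ler1n.
Qed.

Lemma nneseries_unbounded (a : nat -> R) : (forall r, (1 <= r)%N -> 0 <= a r) ->
  (\sum_(1 <= r <oo) (a r)%:E = +oo)%E ->
  forall y, exists X, y <= \sum_(1 <= r < X) a r.
Proof.
move=> a0 aoo y; apply: contrapT => noX.
have ub X : \sum_(1 <= r < X) a r <= y.
  by rewrite leNgt; apply/negP => /ltW lt; apply: noX; exists X.
suff : (\sum_(1 <= r <oo) (a r)%:E <= y%:E)%E by rewrite aoo.
apply: lime_le.
  by apply: is_cvg_nneseries => r r1 _; rewrite lee_fin a0.
by apply: nearW => X; rewrite sumEFin lee_fin.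
Qed.

Hypothesis psi_div : (\sum_(1 <= r <oo)
  (psi r ^+ n * r%:R ^+ (m - n - 1)%N)%:E = +oo)%E.

(** From s >= E0 on, s %/ E0 >= s/(2 E0), so each term is at least [c] times that of the divergent
    series; the finitely many earlier terms are discarded. *)
Lemma thinned_series_unbounded E0 (x : R) Q : (0 < E0)%N -> (0 < Q)%N ->
  exists X, x <= \sum_(s < X.+1 | (Q <= s)%N)
    ((s %/ E0)%:R ^+ (m - n - 1) * (psi s / n%:R) ^+ n).
Proof.
move=> E00 Q0; set d := (m - n - 1)%N.
pose a r : R := psi r ^+ n * r%:R ^+ d.
have a0 r : (1 <= r)%N -> 0 <= a r.
  by move=> r1; rewrite mulr_ge0 ?exprn_ge0 // ltW // psi_gt0.
pose c : R := (n%:R ^+ n * (2 * E0%:R) ^+ d)^-1.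
have c0 : 0 < c by rewrite invr_gt0 mulr_gt0 ?exprn_gt0 ?mulr_gt0 ?ltr0n.
pose Q' := (Q + E0)%N.
have Q'0 : (0 < Q')%N by rewrite addn_gt0 Q0.
have [X XP] := nneseries_unbounded a0 psi_div
  (x / c + \sum_(1 <= r < Q') a r).
exists (X + Q')%N.
pose T s : R := (s %/ E0)%:R ^+ d * (psi s / n%:R) ^+ n.
have T0 s : (0 < s)%N -> 0 <= T s.
  move=> s0; rewrite mulr_ge0 ?exprn_ge0 // divr_ge0 // ltW // psi_gt0 //.
have aT s : (Q' <= s)%N -> c * a s <= T s.
  move=> Qs; have s0 : (0 < s)%N by apply: leq_trans Qs.
  have pn : 0 <= psi s ^+ n by rewrite exprn_ge0 // ltW // psi_gt0.
  have -> : c * a s = (s%:R / (2 * E0%:R)) ^+ d * (psi s / n%:R) ^+ n.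
    by rewrite !expr_div_n /c /a invfM; ring.
  rewrite ler_wpM2r // ?exprn_ge0 ?divr_ge0 //; first by rewrite ltW // psi_gt0.
  rewrite lerXn2r ?nnegrE ?divr_ge0 ?mulr_ge0 //.
  rewrite ler_pdivrMr ?mulr_gt0 ?ltr0n // mulrA -natrM -natrM ler_nat.
  have /ltnW := ltn_ceil s E00; rewrite mulSn => /leq_trans; apply.
  rewrite mulnAC muln2 -addnn leq_add2r.
  by rewrite leq_pmull // divn_gt0 // (leq_trans _ Qs) // leq_addl.
have -> : \sum_(s < (X + Q').+1 | (Q <= s)%N) T s =
    \sum_(0 <= s < (X + Q').+1 | (Q <= s)%N) T s by rewrite big_mkord.
have QX : (Q' <= (X + Q').+1)%N by rewrite leqW // leq_addl.
rewrite (big_cat_nat (n := Q')) //=.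
rewrite -[leLHS]add0r; apply: lerD.
  apply: sumr_ge0 => s Qs; apply: T0; exact: leq_trans Qs.
rewrite big_mkcond /=.
apply: (@le_trans _ _ (\sum_(Q' <= s < (X + Q').+1) c * a s)); last first.
  rewrite !big_nat; apply: ler_sum => s /andP[Qs _].
  by rewrite (leq_trans (leq_addr _ _) Qs) aT.
rewrite -mulr_sumr mulrC -ler_pdivrMr //.
rewrite -(lerD2l (\sum_(1 <= r < Q') a r)) -big_cat_nat //= addrC.
apply: le_trans XP _; case: (leqP 1 X) => X1; last first.
  rewrite [leLHS]big_geq; last exact: ltnW.
  by rewrite big_nat; apply: sumr_ge0 => s /andP[/a0].
have XX : (X <= (X + Q').+1)%N by rewrite leqW // leq_addr.
rewrite [leRHS](big_cat_nat (n := X)) //= lerDl big_nat.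
by apply: sumr_ge0 => s /andP[Xs _]; apply: a0; exact: leq_trans Xs.
Qed.

Lemma card_off_chart (f : {ffun 'I_n -> 'I_m}) i0 : injective f ->
  i0 \notin codom f ->
  #|[pred i | off_chart f i && (i != i0)]| = (m - n - 1)%N.
Proof.
move=> finj i0f.
have cf : #|codom f| = n by rewrite card_codom // card_ord.
have := cardC (mem (codom f)); rewrite cf card_ord.
have := cardD1 i0 (predC (mem (codom f))).
have -> : (i0 \in predC (mem (codom f))) = true by rewrite inE.
have -> : #|[predD1 predC (mem (codom f)) & i0]| =
    #|[pred i | off_chart f i && (i != i0)]|.
  by apply: eq_card => i; rewrite !inE andbC.
move=> ->; rewrite add1n; clear; lia.
Qed.

(** The parameters of a piece depend on the matrix. They are gathered in a countable type, so that
    countable subadditivity applies. *)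
Let index := ('I_n + {ffun 'I_n -> 'I_m} * 'I_m * 'I_n * bool +
  {ffun 'I_n -> 'I_m} * 'I_m * nat * nat * {ffun 'I_m * 'I_n -> bool})%type.

Let piece (a : index) : set 'M[R]_(m, n) :=
  match a with
  | inl (inl j0) => degenerate nm j0 @` hyperplane (Ordinal nm) j0 0
  | inl (inr (f, i0, j0, b)) =>
      chart f (fun _ _ => 0) @` hyperplane i0 j0 ((-1) ^+ b)
  | inr (f, i0, E0, Q0, k) =>
      if (injectiveb f) && (i0 \notin codom f) && (4 * m <= E0)%N then
        chart f (neg_shift R k) @` misses (off_chart f) i0 E0 (fun s =>
          psi s / n%:R) Q0
      else set0
  end.

Lemma null_content_piece a : null_content (piece a).
Proof.
case: a => [[j0|[[[f i0] j0] b]]|[[[[f i0] E0] Q0] k]] /=.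
- apply: null_content_degenerate; first by move=> Z i j [].
  exact: null_content_hyperplane.
- apply: null_content_chart; first by move=> i j; rewrite normr0.
    by move=> Z i j [].
  exact: null_content_hyperplane.
case: ifP => [/andP[/andP[/injectiveP finj i0f] E0m]|_];
  last exact: null_content0.
apply: null_content_chart.
- by move=> i j; rewrite /neg_shift normrN normr_nat; case: (k _);
  rewrite ?ler01.
- by move=> Z i j [/(_ i j)/andP[z0 z1] _]; rewrite ger0_norm.
have cK := card_off_chart finj i0f.
apply: null_content_covers => eps eps0.
apply: covers_arbitrarily_small => //.
(* Here d + n = m - 1, and m >= 3 follows from n < m and m + n > 3. *)
- by rewrite cK; move: nm mn3 n_gt0; clear; lia.
- by move=> r r1; rewrite divr_gt0 ?psi_gt0 ?ltr0n.
- exact: psi_div_eventually_le1.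
move=> x Q Qpos; rewrite cK; apply: thinned_series_unbounded => //.
by apply: leq_trans E0m; rewrite muln_gt0 /=; apply: leq_ltn_trans nm.
Qed.

Lemma not_W0_piece (X : 'M[R]_(m, n)) :
  @unit_cube R m n X -> ~ W0 psi X -> exists a, piece a X.
Proof.
move=> X01 nW.
have [rX|] := eqVneq (\rank X) n; last first.
  rewrite neq_ltn [X in _ || X]ltnNge rank_leq_col orbF => rX.
  have [|j0 [Z HZ ->]] := low_rank_degenerate nm _ rX.
    by move=> i j; have /andP[x0 x1] := X01 i j; rewrite ger0_norm.
  by exists (inl (inl j0)); exists Z.
have [f [fX Y1]] := maximal_minor rX.
have {}Y1 i j : `|(X *m invmx (rowsub f X)) i j| <= 1.
  by have := Y1 i j; rewrite -row_mul mxE.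
have finj := chart_inj fX.
have [i0 i0f] : exists i0, i0 \notin codom f.
  apply/existsP; rewrite -negb_forall; apply/negP => /forallP all.
  have : (#|'I_m| <= #|codom f|)%N.
    by apply/subset_leq_card/fintype.subsetP => i _; exact: all.
  by rewrite card_codom // !card_ord leqNgt nm.
have [|/forallNP bd] := pselect (exists j0,
  `|(X *m invmx (rowsub f X)) i0 j0| = 1).
  move=> [j0 bd]; have [b bX] := chart_boundary X01 fX Y1 i0f bd.
  by exists (inl (inr (f, i0, j0, b))).
have Ylt j : `|(X *m invmx (rowsub f X)) i0 j| < 1.
  by rewrite lt_neqAle Y1 andbT; apply/eqP; exact: bd.
have [E0 [Q0 [k [E0m kX]]]] :=
  chart_interior n_gt0 psi_eventually_le1 X01 nW fX Y1 i0f Ylt.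
exists (inr (f, i0, E0, Q0, k)) => /=.
have -> : injectiveb f by apply/injectiveP.
by rewrite i0f E0m.
Qed.

Lemma divergence_W0 : lebesgue_mx (@W0 R m n psi) = 1%E.
Proof.
have [mu muE] := lebesgue_tuple_measure R (m * n).
have cubeE : @unit_cube R m n = int_cell 1 0.
  apply/seteqP; split => Z ZP i j; have := ZP i j;
    by rewrite !mxE mulr1 add0r.
have cube1 : lebesgue_mx (@unit_cube R m n) = 1%E.
  by rewrite cubeE lebesgue_mx_int_cell // expr1n invr1.
have mcube : measurable (@mx_of_tuple R m n @^-1` (@unit_cube R m n)).
  by rewrite cubeE; exact: measurable_int_cell.
have mW := @measurable_W0 R m n psi.
pose B := @unit_cube R m n `\` W0 psi.
have mB : measurable (@mx_of_tuple R m n @^-1` B).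
  by rewrite /B setDE preimage_setI -preimage_setC; apply: measurableI => //;
    exact: measurableC.
have B0 : lebesgue_mx B = 0%E.
  apply: (lebesgue_mx_null mB (A := piece)); last exact: null_content_piece.
  by move=> X [X01 nW]; have [a aX] := not_W0_piece X01 nW; exists a.
have Wcube : @W0 R m n psi `<=` @unit_cube R m n by move=> X [].
apply/eqP; rewrite eq_le; apply/andP; split.
  rewrite -cube1 /lebesgue_mx muE; apply: le_measure; rewrite ?inE //.
  by move=> t; exact: Wcube.
rewrite -cube1 -[leRHS]adde0 -B0 /lebesgue_mx muE.
apply: le_trans (measureU2 mu mW mB); apply: le_measure; rewrite ?inE //.
  exact: measurableU.
move=> t tc; case: (pselect (W0 psi (mx_of_tuple t))) => tW; first by left.
by right.
Qed.

End divergence.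

(** * Convergence *)

Section strips.

Lemma card_strip m p (v : 'I_m -> int) (i0 : 'I_m) (s B : nat) :
  (0 < p)%N -> (0 < s <= B)%N -> `|v i0|%N = s ->
  (#|[pred t : {ffun 'I_m -> 'I_p} | (`|(\sum_i v i * (t i)%:Z)%R| <= B)%N]| * s
     <= 3 * B * p ^ m.-1)%N.
Proof.
move=> p0 /andP[s0 sB] vs; pose z := Ordinal p0.
pose S (t : {ffun 'I_m -> 'I_p}) : int := \sum_i v i * (t i)%:Z.
pose D := pred1 i0.
have cD : #|predC D| = m.-1.
  by have := cardC D; rewrite card1 card_ord add1n => /(congr1 predn).
pose N := (2 * B %/ s)%N.
(* When only [t i0] varies, the sum takes values that are [s] apart. *)
pose f (t : {ffun 'I_m -> 'I_p}) :=
  ([ffun i => if D i then z else t i],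
    inord (absz (S t + B%:Z)%R %/ s) : 'I_N.+1).
have fS (t : {ffun 'I_m -> 'I_p}) : (`|S t| <= B)%N ->
    (absz (S t + B%:Z)%R %/ s < N.+1)%N.
  by move=> tB; rewrite ltnS leq_div2r //; move: tB; clear; lia.
have : (#|[pred t : {ffun 'I_m -> 'I_p} | (`|S t| <= B)%N]| <=
  N.+1 * p ^ m.-1)%N.
  rewrite -cD -(card_pinned z D) mulnC -[X in (_ <= _ * X)%N]card_ord -cardX.
  apply: (@leq_card_inj _ _ f) => [t _|t u].
    rewrite !inE /= andbT; apply/forallP => i; apply/implyP => Di.
    by rewrite ffunE Di.
  rewrite !inE => tB uB [/ffunP tu /(congr1 val)].
  rewrite /= !inordK ?fS // => e.
  have off i : i != i0 -> t i = u i.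
    by move=> Di; have := tu i; rewrite !ffunE !ifN.
  have SE : S t - S u = v i0 * ((t i0)%:Z - (u i0)%:Z).
    rewrite /S -sumrB (bigD1 i0) //= big1 ?addr0 ?mulrBr //.
    by move=> i /off ->; rewrite subrr.
  have close : (`|(S t - S u)%R| < s)%N.
    have := divn_eq (absz (S t + B%:Z)%R) s; have :=
      divn_eq (absz (S u + B%:Z)%R) s.
    rewrite e; have := ltn_pmod (absz (S t + B%:Z)%R) s0.
    have := ltn_pmod (absz (S u + B%:Z)%R) s0.
    move: (_ %% _)%N (_ %% _)%N (_ * s)%N => x y w.
    move: tB uB; move: (S t) (S u); clear; lia.
  have e0 : t i0 = u i0.
    apply: val_inj; move: close; rewrite SE abszM vs.
    have [//|ne] := eqVneq (val (t i0)) (val (u i0)).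
    rewrite ltnNge leq_pmulr //; move: ne => /=; clear; lia.
  by apply/ffunP => i; case: (eqVneq i i0) => [->|/off].
move=> h; apply: (@leq_trans (N.+1 * p ^ m.-1 * s)).
  by rewrite leq_mul2r h orbT.
rewrite mulnAC leq_mul2r; apply/orP; right.
have : (N * s <= 2 * B)%N by exact: leq_trunc_div.
by rewrite mulSn; move: sB; clear; lia.
Qed.

Context (R : realType) (m n : nat).

Definition strip (v : 'I_m -> int) (e : R) : set 'M[R]_(m, n) :=
  [set Z | unit_cube Z /\ forall j, `|\sum_i (v i)%:~R * Z i j| < e].

(** Passing from [Z] to the corner of its cell changes the scaled form by at most ms <= pe, so the
    width at most doubles. *)
Lemma strip_cell p (v : 'I_m -> int) (s : nat) (e : R) (t : grid m n p) Z :
  (forall i, (`|v i| <= s)%N) -> (m * s)%:R <= p%:R * e ->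
  strip v e Z -> grid_cell t Z ->
  forall j, (`|(\sum_i v i * (t j i)%:Z)%R| <= Num.truncn (2 * (p%:R * e)))%N.
Proof.
move=> vs msp [_ vZ] tZ j.
have pe0 : 0 <= p%:R * e by apply: le_trans msp.
have e0 : 0 <= e by apply: le_trans (ltW (vZ j)).
rewrite truncn_ge_nat ?mulr_ge0 //.
rewrite natr_absz intr_norm rmorph_sum /=.
have -> : \sum_i (v i * (t j i)%:Z)%:~R =
    p%:R * (\sum_i (v i)%:~R * Z i j) -
    \sum_i (v i)%:~R * (Z i j * p%:R - (t j i)%:R) :> R.
  rewrite mulr_sumr -sumrB; apply: eq_bigr => i _; rewrite intrM.
  by rewrite -pmulrn; ring.
apply: le_trans (ler_normB _ _) _.
have h1 : `|p%:R * (\sum_i (v i)%:~R * Z i j)| <= p%:R * e.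
  by rewrite normrM normr_nat ler_wpM2l // ltW.
have h2 : `|\sum_i (v i)%:~R * (Z i j * p%:R - (t j i)%:R)| <= (m * s)%:R :> R.
  apply: le_trans (ler_norm_sum _ _ _) _.
  apply: (@le_trans _ _ (\sum_(i < m) s%:R)).
    apply: ler_sum => i _; rewrite normrM -[leRHS]mulr1; apply: ler_pM => //.
      by rewrite -intr_norm -natr_absz ler_nat.
    have /andP[z1 z2] := tZ i j; rewrite -natr1 in z2.
    by rewrite ger0_norm ?subr_ge0 // lerBlDr addrC.
  by rewrite sumr_const card_ord natrM mulr_natl.
lra.
Qed.

Definition shell_strips (s : nat) (e : R) : set 'M[R]_(m, n) :=
  [set Z | exists v : 'I_m -> int, [/\ forall i, (`|v i| <= s)%N,
     exists i0, `|v i0|%N = s & strip v e Z]].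

(** With 1/p at most e/(ms), a strip needs at most (6 p^m e / s)^n cells, and the shell has at most
    2m (2s+1)^(m-1) <= 2m (3s)^(m-1) vectors. *)
Lemma covers_shell_strips (s : nat) (e : R) : (0 < m)%N -> (0 < s)%N -> 0 < e ->
  exists M (C : pred (grid m n M)), [/\ (0 < M)%N, covers (shell_strips s e) C &
    density R C <= (2 * m * 3 ^ m.-1 * 6 ^ n)%:R * (s%:R ^+ m.-1 * e ^+ n /
      s%:R ^+ n)].
Proof.
move=> m0 s0 e0; pose p := (Num.truncn ((m * s)%:R / e)).+1.
have p0R : 0 < p%:R :> R by rewrite ltr0n.
have sR : 0 < s%:R :> R by rewrite ltr0n.
have msp : (m * s)%:R <= p%:R * e.
  by rewrite -ler_pdivrMr // ltW // truncnS_gt.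
pose B := Num.truncn (2 * (p%:R * e)).
have pe0 : 0 <= p%:R * e by rewrite mulr_ge0 // ltW.
have h0 : 0 <= 2 * (p%:R * e) by rewrite mulr_ge0.
have Ble : B%:R <= 2 * (p%:R * e).
  by have /andP[] := truncn_itv h0.
have sB : (0 < s <= B)%N.
  rewrite s0 truncn_ge_nat //=.
  have : s%:R <= (m * s)%:R :> R by rewrite ler_nat leq_pmull.
  by move=> h; have := le_trans h msp; lra.
pose V := {ffun 'I_m -> 'I_(2 * s).+1}.
pose vec (w : V) i : int := (w i)%:Z - s%:Z.
pose edge (w : V) := [exists i0, `|vec w i0|%N == s].
pose cells (w : V) := [pred t : grid m n p |
  [forall j, (`|(\sum_i vec w i * (t j i)%:Z)%R| <= B)%N]].
pose C : pred (grid m n p) := [pred t : grid m n p | [exists w,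
  edge w && cells w t]].
exists p, C; split => // [Z [v [vs [i0 vi0] vZ]]|].
  have Z01 : unit_cube Z by case: vZ.
  have [t tZ] : exists t : grid m n p, grid_cell t Z.
    by exists (grid_floor (ltn0Sn _ : (0 < p)%N) Z); exact: grid_floorP.
  exists t => //.
  pose w : V := [ffun i => inord (absz (v i + s%:Z)%R)].
  have wE : vec w =1 v.
    move=> i; rewrite /vec ffunE inordK; first by have := vs i; clear; lia.
    by have := vs i; clear; lia.
  apply/existsP; exists w; apply/andP; split.
    by apply/existsP; exists i0; rewrite wE vi0.
  apply/forallP => j.
  have -> : \sum_i vec w i * (t j i)%:Z = \sum_i v i * (t j i)%:Z.
    by apply: eq_bigr => i _; rewrite wE.
  exact: strip_cell vs msp vZ tZ j.
have cw w : edge w -> (#|cells w|%:R <= (6 * (p%:R ^+ m * e) / s%:R) ^+ n :> R).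
  move=> /existsP[i0 /eqP wi0].
  have -> : #|cells w| = (\prod_(j < n) #|[pred t : {ffun 'I_m -> 'I_p} |
      (`|(\sum_i vec w i * (t i)%:Z)%R| <= B)%N]|)%N.
    by rewrite -(card_forall_family (fun _ => [pred t : {ffun 'I_m -> 'I_p} |
      (`|(\sum_i vec w i * (t i)%:Z)%R| <= B)%N])).
  rewrite prod_nat_const card_ord natrX lerXn2r ?nnegrE //.
    by rewrite divr_ge0 ?mulr_ge0 ?exprn_ge0 // ltW.
  have := @card_strip m p (vec w) i0 s B (ltn0Sn _) sB wi0.
  rewrite ler_pdivlMr // -(ler_nat R) natrM => /le_trans; apply.
  rewrite !natrM natrX -[in leRHS](prednK m0) exprS.
  have : 0 <= p%:R ^+ m.-1 :> R by rewrite exprn_ge0.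
  move: (p%:R ^+ m.-1) => x x0; have := ler_wpM2r x0 Ble; lra.
have cedge : (#|edge| <= m * (2 * (2 * s).+1 ^ m.-1))%N.
  pose z b : 'I_(2 * s).+1 := if b then ord_max else ord0.
  apply: leq_trans (_ : (\sum_(i0 < m) \sum_(b : bool)
     #|[pred w : V | [forall i, pred1 i0 i ==> (w i == z b)]]| <= _)%N);
       last first.
    have h i0 (b : bool) : (#|[pred w : V | [forall i, pred1 i0 i ==>
      (w i == z b)]]|
        = (2 * s).+1 ^ m.-1)%N.
      rewrite card_pinned; congr (_ ^ _)%N.
      have := cardC (pred1 i0); rewrite card1 card_ord add1n.
      by move=> /(congr1 predn).
    apply: leq_trans (_ : (\sum_(i0 < m) 2 * (2 * s).+1 ^ m.-1 <= _)%N).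
      apply: leq_sum => i0 _.
      by rewrite (eq_bigr _ (fun b _ => h i0 b)) sum_nat_const card_bool.
    by rewrite sum_nat_const card_ord.
  rewrite -sum1_card.
  under [leqRHS]eq_bigr do under eq_bigr do rewrite -sum1_card big_mkcond.
  under [leqRHS]eq_bigr do rewrite exchange_big.
  rewrite exchange_big /= big_mkcond /=; apply: leq_sum => w _.
  case: ifP => // /existsP[i0 /eqP wi0].
  have [b wb] : exists b, w i0 = z b.
    move: wi0; rewrite /vec => wi0.
    have : (w i0 = 0%N :> nat) \/ (w i0 = (2 * s)%N :> nat).
      by have := ltn_ord (w i0); move: wi0; clear; lia.
    by move=> [h|h]; [exists false|exists true]; apply: val_inj.
  rewrite (bigD1 i0) //= (bigD1 b) //= inE.
  have -> : [forall i, pred1 i0 i ==> (w i == z b)].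
    by apply/forallP => i; apply/implyP => /eqP ->; rewrite wb.
  by [].
have cC : #|C|%:R <= #|edge|%:R * (6 * (p%:R ^+ m * e) / s%:R) ^+ n :> R.
  apply: (@le_trans _ _ (\sum_(w | edge w) #|cells w|)%N%:R).
    rewrite ler_nat -sum1_card.
    under [leqRHS]eq_bigr do rewrite -sum1_card big_mkcond.
    rewrite exchange_big /= big_mkcond /=; apply: leq_sum => t _.
    case: ifP => // /existsP[w /andP[ew cwt]].
    have tw : t \in cells w by exact: cwt.
    by rewrite (bigD1 w) //= tw.
  rewrite natr_sum; apply: (@le_trans _ _ (\sum_(w | edge w)
      (6 * (p%:R ^+ m * e) / s%:R) ^+ n)); first by apply: ler_sum => w;
        exact: cw.
  by rewrite sumr_const [leRHS]mulr_natl.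
rewrite /density ler_pdivrMr ?exprn_gt0 //; apply: le_trans cC _.
have e3 : (#|edge|%:R <= (2 * m * 3 ^ m.-1)%:R * s%:R ^+ m.-1 :> R).
  rewrite -natrX -natrM ler_nat; apply: leq_trans cedge _.
  rewrite mulnCA mulnA -[leqRHS]mulnA leq_mul2l -expnMn leq_expnl ?orbT //.
  by move: s0; clear; lia.
have x0 : 0 <= (6 * (p%:R ^+ m * e) / s%:R) ^+ n.
  by rewrite exprn_ge0 // divr_ge0 ?mulr_ge0 ?exprn_ge0 // ltW.
apply: le_trans (ler_wpM2r x0 e3) _.
rewrite le_eqVlt; apply/orP; left; apply/eqP.
rewrite !exprMn exprVn -exprM [in RHS]natrM [in RHS](natrX _ 6).
by move: (_ ^- n) => y; ring.
Qed.

End strips.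

Section convergence.
Context (R : realType) (m n : nat) (psi : nat -> R).
Hypothesis nm : (n < m)%N.
Hypothesis psi_gt0 : forall r, (1 <= r)%N -> 0 < psi r.

Lemma finite_supnorm_lt (N : nat) :
  finite_set [set q : 'rV[int]_m | (supnorm_int q < N)%N].
Proof.
pose f (w : 'rV['I_(2 * N).+1]_m) : 'rV[int]_m :=
  \row_i ((w ord0 i)%:Z - N%:Z).
apply: (@sub_finite_set _ _ (f @` setT)); last exact: finite_image.
move=> q /= qN; exists (\row_i inord (absz (q ord0 i + N%:Z)%R)) => //.
apply/rowP => i; rewrite !mxE (_ : q 0 i = q ord0 i) //.
have qi : (`|q ord0 i| < N)%N by apply: leq_ltn_trans (supnorm_int_max q i) qN.
by rewrite inordK; move: qi; clear; lia.
Qed.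

Lemma W0_shell_strips X (N : nat) : @W0 R m n psi X ->
  exists2 s, (N <= s)%N & shell_strips s (psi s) X.
Proof.
have m0 : (0 < m)%N by apply: leq_ltn_trans nm.
move=> [X01 inf].
have [q [q0 qX] Nq] : exists2 q : 'rV[int]_m, q != 0 /\
    mx_norm (map_mx intr q *m X) < psi (supnorm_int q) & (N <= supnorm_int q)%N.
  apply: contrapT => noq; apply: inf;
    apply: sub_finite_set (finite_supnorm_lt N).
  move=> q Sq /=; rewrite ltnNge; apply/negP => Nq.
  by apply: noq; exists q.
exists (supnorm_int q) => //; exists (fun i => q ord0 i); split.
- exact: supnorm_int_max.
- have [|i0 E] := @bigop.eq_bigmax _ (fun i : 'I_m => `|q ord0 i|%N).
    by rewrite card_ord.
  by exists i0; rewrite -E.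
split => // j; move: qX; rewrite mx_normrE => /bigmax_ltP[_ /(_ (ord0, j) isT)].
rewrite /= mxE; congr (`|_| < _); apply: eq_bigr => i _.
by rewrite mxE.
Qed.

Hypothesis psi_sum : (\sum_(1 <= r <oo)
  (psi r ^+ n * r%:R ^+ (m - n - 1)%N)%:E < +oo)%E.

Lemma convergence_W0 : lebesgue_mx (@W0 R m n psi) = 0%E.
Proof.
have m0 : (0 < m)%N by apply: leq_ltn_trans nm.
have [mu muE] := lebesgue_tuple_measure R (m * n).
pose a r : R := psi r ^+ n * r%:R ^+ (m - n - 1).
have a0 r : (1 <= r)%N -> 0 <= a r.
  by move=> r1; rewrite mulr_ge0 ?exprn_ge0 // ltW // psi_gt0.
pose K : R := (2 * m * 3 ^ m.-1 * 6 ^ n)%:R.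
have K0 : 0 <= K by rewrite ler0n.
(* The shell s = 0 gets the empty set, as nothing is assumed on [psi 0]. *)
have /choice[U UP] : forall s, exists U : set 'M[R]_(m, n),
    measurable (@mx_of_tuple R m n @^-1` U) /\
    (lebesgue_mx U <= (if s is 0%N then 0 else K * a s)%:E)%E /\
    ((0 < s)%N -> shell_strips s (psi s) `<=` U).
  case=> [|s].
    exists set0; rewrite preimage_set0; split; first exact: measurable0.
    by split => //; rewrite /lebesgue_mx preimage_set0 muE measure0.
  have [M [C [M0 cov dC]]] :=
    covers_shell_strips n m0 (ltn0Sn s) (psi_gt0 (ltn0Sn s)).
  have [l Al lC] := covers_int_cells cov.
  exists (int_cells M l); split; first exact: measurable_int_cells.
  split; last by move=> _.
  have h := @lebesgue_mx_int_cells_le R m n M l M0.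
  apply: (le_trans h).
  rewrite lee_fin lC; apply: le_trans dC _; rewrite ler_wpM2l //.
  have sR : s.+1%:R != 0 :> R by rewrite pnatr_eq0.
  (* The power s^n in the denominator cancels, which leaves the term [a s] of the series. *)
  have -> : m.-1 = ((m - n - 1) + n)%N by move: nm; clear; lia.
  by rewrite exprD mulrAC mulfK ?expf_neq0 // mulrC.
pose F s := @mx_of_tuple R m n @^-1` U s.
have F0 : mu (lim_sup_set F) = 0%E.
  apply: lim_sup_set_cvg0; first by move=> s; case: (UP s).
  have Sfin : (\sum_(1 <= r <oo) (a r)%:E)%E \is a fin_num.
    rewrite ge0_fin_numE //; apply: nneseries_ge0 => r r1 _.
    by rewrite lee_fin a0.
  apply: (@le_lt_trans _ _ (K * fine (\sum_(1 <= r <oo) (a r)%:E)%E)%:E);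
    last first.
    exact: ltry.
  apply: lime_le; first by apply: is_cvg_nneseries => s _ _; exact: measure_ge0.
  apply: nearW => N.
  apply: (@le_trans _ _ (\sum_(1 <= r < N) (K * a r)%:E)%E).
    have bound s : (mu (F s) <= (if s is 0%N then 0 else K * a s)%:E)%E.
      by have [_ [h _]] := UP s; rewrite -muE.
    apply: (@le_trans _ _ (\sum_(0 <=
      s < N) (if s is 0%N then 0 else K * a s)%:E)%E).
      by apply: lee_sum => s _; exact: bound.
    case: N => [|N]; first by rewrite !big_geq.
    rewrite big_ltn // add0e !big_nat; apply: lee_sum => -[//|s] _.
    exact: lexx.
  rewrite sumEFin lee_fin -mulr_sumr ler_wpM2l // -lee_fin fineK // -sumEFin.
  by apply: nneseries_lim_ge => r r1 _; rewrite lee_fin a0.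
apply/eqP; rewrite eq_le {2}/lebesgue_mx muE measure_ge0 andbT -F0
  /lebesgue_mx muE.
apply: le_measure; rewrite ?inE.
- exact: measurable_W0.
- apply: bigcapT_measurable => N; apply: bigcup_measurable => s _.
  by case: (UP s).
(* The successor makes s positive, as required by the inclusion in [U s]. *)
move=> t Wt N _; have [s Ns sX] := W0_shell_strips N.+1 Wt.
exists s; first exact: ltnW.
by have [_ [_]] := UP s; apply => //; exact: leq_ltn_trans Ns.
Qed.

End convergence.

(* The exponent m - n - 1 is computed in nat; it is not truncated, as n < m. *)
Theorem corollary2p2 (R : realType) (m n : nat) (psi : nat -> R)
    (m_ge1 : (1 <= m)%N) (n_ge1 : (1 <= n)%N)
    (lt_nm : (n < m)%N) (mn_gt3 : (3 < m + n)%N)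
    (psi_gt0 : forall r : nat, (1 <= r)%N -> 0 < psi r)
    (psi_cvg0 : psi r @[r --> \oo] --> (0 : R)) :
  ((\sum_(1 <= r <oo) (psi r ^+ n * r%:R ^+ (m - n - 1)%N)%:E < +oo)%E ->
     lebesgue_mx (@W0 R m n psi) = 0%E) /\
  ((\sum_(1 <= r <oo) (psi r ^+ n * r%:R ^+ (m - n - 1)%N)%:E = +oo)%E ->
     lebesgue_mx (@W0 R m n psi) = 1%E).
Proof. by split => psi_sum; [exact: convergence_W0|exact: divergence_W0]. Qed.
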